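(* (i) Suppose that a pair of smooth functions $(\phi,u):\overline{\Omega}\times[0,T]\to\mathbb{R}\times\mathbb{R}^2$ satisfies, in $\Omega\times(0,T)$, $$\frac{\partial\phi}{\partial t}+\nabla\cdot(\phi u)=0,$$ $$\rho\phi\Bigl[\frac{\partial u}{\partial t}+(u\cdot\nabla)u\Bigr]-2\mu\nabla\cdot(\phi D(u))+\rho g\phi\nabla\eta=0,$$ $$\phi=\eta+\zeta,$$ together with the boundary conditions $$u=0\ \text{ on }\Gamma_D\times(0,T),$$ $$(D(u)n)\times n=0,\quad u\cdot n=0\ \text{ on }\Gamma_S\times(0,T),$$ $$u=c\,\frac{\eta}{\phi}\,n\ \text{ on }\Gamma_T\times(0,T).$$ Then $$\frac{d}{dt}E(t)=I_1(t;\Gamma_T)+I_2(t;\Gamma_T)+I_3(t;\Gamma_T)+I_4(t;\Omega).$$ (ii) Furthermore, if $\Gamma=\Gamma_D\cup\Gamma_S$ and $\phi(x,t)>0$ for all $(x,t)\in\overline{\Omega}\times[0,T]$, then $$\frac{d}{dt}E(t)=I_4(t;\Omega)\le0.$$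
   Context: Let $\Omega\subset\mathbb{R}^2$ be a bounded domain with boundary $\Gamma=\partial\Omega$ and unit outward normal vector $n$, and let $T$ be a positive constant. The boundary $\Gamma$ consists of three non-overlapped parts $\Gamma_D,\Gamma_S,\Gamma_T$ (Dirichlet, slip and transmission boundaries), i.e., $\overline{\Gamma}=\overline{\Gamma}_D\cup\overline{\Gamma}_S\cup\overline{\Gamma}_T$ and $\Gamma_D\cap\Gamma_S=\Gamma_S\cap\Gamma_T=\Gamma_T\cap\Gamma_D=\varnothing$. Here $\phi$ is the total height of wave, $u=(u_1,u_2)^T$ is the velocity, and $\eta:\overline{\Omega}\times[0,T]\to\mathbb{R}$ is the water level from the reference height. The constants $\rho$ (density), $\mu$ (viscosity), $g$ (gravity) and $c_0$ are positive, $\zeta\in C^1(\overline{\Omega})$ is a given depth function with $\zeta(x)>0$ for $x\in\overline{\Omega}$, and $c(x)=c_0\sqrt{g\zeta(x)}$. The strain-rate tensor is $D(u)=\frac12(\nabla u+(\nabla u)^T)$, $|A|^2=\sum_{i,j=1}^2A_{ij}^2$ for a $2\times2$ matrix $A$, and $a\times b=a_1b_2-a_2b_1$ for $a,b\in\mathbb{R}^2$. The total energy at time $t\in[0,T]$ is $$E(t)=\int_\Omega\frac{\rho}{2}\phi|u|^2\,dx+\int_\Omega\frac{\rho g|\eta|^2}{2}\,dx.$$ For $t\in[0,T]$, with all integrands evaluated at time $t$, $$I_1(t;\Gamma_T)=-\frac{\rho}{2}\int_{\Gamma_T}\phi|u|^2\,u\cdot n\,ds,\qquad I_2(t;\Gamma_T)=-\rho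 g\int_{\Gamma_T}\phi\,\eta\,u\cdot n\,ds,$$ $$I_3(t;\Gamma_T)=2\mu\int_{\Gamma_T}\phi\,[D(u)n]\cdot u\,ds,\qquad I_4(t;\Omega)=-2\mu\int_\Omega\phi|D(u)|^2\,dx.$$ *)

(* Defs.v *)
From mathcomp Require Import all_boot all_order all_algebra.
From mathcomp Require Import all_classical all_reals all_analysis.

Set Implicit Arguments.
Unset Strict Implicit.
Unset Printing Implicit Defensive.

Import Order.TTheory GRing.Theory Num.Theory.
Import numFieldNormedType.Exports.

Local Open Scope classical_set_scope.
Local Open Scope ring_scope.

(** The norm that MathComp-Analysis puts on a product is the max norm; the
    Euclidean structure of the plane is therefore given by [dot] and [enorm].
    Points and vectors of the plane are pairs [a : R * R], and [co i a] is the
    coordinate of [a] with index [i : 'I_2]. *)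

Section Plane.
Context {R : realType}.
Implicit Types (a b : R * R) (A : 'M[R]_2).

Definition co (i : 'I_2) a : R := if i == 0 then a.1 else a.2.
Definition bas (i : 'I_2) : R * R := ((i == 0)%:R, (i == 1)%:R).

Definition dot a b : R := \sum_(i < 2) co i a * co i b.
Definition enorm a : R := Num.sqrt (dot a a).
Definition cross a b : R := a.1 * b.2 - a.2 * b.1.

Definition mxact A a : R * R :=
  (\sum_(j < 2) A 0 j * co j a, \sum_(j < 2) A 1 j * co j a).
Definition frob2 A : R := \sum_(i < 2) \sum_(j < 2) A i j ^+ 2.

End Plane.

Section Smoothness.
Context {R : realType} {V : normedModType R}.
Implicit Types (U : set V) (f : V -> R).

(** [Ck_closure k U f], for [U] open: [f] is of class C^k in [U], and [f] and
    all its partial derivatives of order at most [k] extend continuously to the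
    closure of [U].  Only the values of [f] on [closure U] matter. *)
Fixpoint Ck_closure (k : nat) U f : Prop :=
  {within closure U, continuous f} /\
  if k is k'.+1 then
    forall v : V, exists2 g : V -> R,
      (forall x, U x -> is_derive x v f (g x)) & Ck_closure k' U g
  else True.

Definition smooth_closure U f : Prop := forall k, Ck_closure k U f.

(** The derivative of [f] in the direction [v], extended by continuity from
    [U] to [closure U]; on the boundary ['D_v f] itself would depend on the
    irrelevant values of [f] outside [closure U]. *)
Definition dbar U (v : V) f (x : V) : R :=
  lim ((fun y => 'D_v f y) @ within U (nbhs x)).

End Smoothness.

Definition deriv_within {R : realType} (A : set R) (f : R -> R) (t l : R) : Prop :=
  (fun s => (f s - f t) / (s - t)) @ within A t^' --> l.

Section Domain.
Context {R : realType}.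
Implicit Types (Om A : set (R * R)).

Definition boundary Om : set (R * R) := closure Om `\` interior Om.

Definition bounded_domain Om : Prop :=
  [/\ open Om, connected Om, Om !=set0 & bounded_set Om].

Section Arcs.
Context {N : nat}.
Variable gam : 'I_N -> R -> R * R.

Definition velocity (k : 'I_N) (s : R) : R * R := derive1 (gam k) s.

(** The boundary of [Om] is the union of finitely many regular C^1 arcs
    [gam k : [0, 1] -> R^2]; an arc does not cross itself and distinct arcs
    meet at end points only.  An arc may be closed and end points may coincide
    (corners).  The values of [gam k] outside [0, 1] play no role: a C^1 arc on
    [0, 1] is the restriction of a C^1 curve defined on the whole line. *)
Record piecewise_C1_boundary Om : Prop := PiecewiseC1Boundary {
  arc_derivable : forall k s, derivable (gam k) s 1 ;
  arc_C1 : forall k, continuous (velocity k) ;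
  arc_regular : forall k s, 0 <= s <= 1 -> velocity k s != 0 ;
  arc_simple : forall k l s s', 0 < s < 1 -> 0 <= s' <= 1 ->
    gam k s = gam l s' -> k = l /\ s = s' ;
  arc_cover : boundary Om = \bigcup_k (gam k @` [set s | 0 <= s <= 1])
}.

(** [nu] is the unit outward normal vector at each point of the open arcs, that
    is everywhere on the boundary except at finitely many points. *)
Definition unit_outward_normal Om (nu : R * R -> R * R) : Prop :=
  forall k s, 0 < s < 1 ->
    let x := gam k s in
    [/\ enorm (nu x) = 1,
        dot (nu x) (velocity k s) = 0 &
        \forall e \near 0^'+,
          Om (x - e *: nu x) /\ ~ closure Om (x + e *: nu x)].

Definition regular_pt (x : R * R) : Prop := exists k s, 0 < s < 1 /\ x = gam k s.

(** [\int_A f ds] with respect to arc length, for [A] a part of the boundary. *)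
Definition line_integral A (f : R * R -> R) : R :=
  \sum_(k < N) \int[@lebesgue_measure R]_(s in [set s | 0 < s < 1 /\ A (gam k s)])
     (f (gam k s) * enorm (velocity k s)).

Definition null_length A : Prop :=
  forall k, (@lebesgue_measure R) [set s | 0 < s < 1 /\ A (gam k s)] = 0%E.

(** The last condition makes "the boundary consists of the three parts" precise:
    the closures alone would not prevent [GD `|` GS `|` GT] from missing a set
    of positive length. *)
Record boundary_parts Om (GD GS GT : set (R * R)) : Prop := BoundaryParts {
  parts_closure :
    closure (boundary Om) = closure GD `|` closure GS `|` closure GT ;
  parts_DS : GD `&` GS = set0 ;
  parts_ST : GS `&` GT = set0 ;
  parts_TD : GT `&` GD = set0 ;
  parts_measurable : forall G, [\/ G = GD, G = GS | G = GT] ->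
    measurable (G : set (measurableTypeR R * measurableTypeR R)) ;
  parts_residual : null_length (boundary Om `\` (GD `|` GS `|` GT))
}.

End Arcs.

Definition area_integral A (f : R * R -> R) : R :=
  \int[(@lebesgue_measure R \x @lebesgue_measure R)%E]_(x in A) f x.

End Domain.

Section ShallowWater.
Context {R : realType}.
Variables (Om : set (R * R)) (T rho mu g c0 : R) (zeta : R * R -> R).
Variables (phi eta : (R * R) * R -> R) (u : (R * R) * R -> R * R).
Implicit Types (z : (R * R) * R) (t : R) (i j : 'I_2).

(** The space-time cylinder; a point of space-time is [(x, t)]. *)
Definition cylinder : set ((R * R) * R) := [set z | Om z.1 /\ 0 < z.2 < T].

Definition dirx i : (R * R) * R := (bas i, 0).
Definition dirt : (R * R) * R := (0, 1).

Definition ucomp i z : R := co i (u z).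

(** D(u) on the closed cylinder; in the open one [dbar] agrees with the ordinary
    derivative. *)
Definition strain z : 'M[R]_2 := \matrix_(i, j)
  (2^-1 * (dbar cylinder (dirx j) (ucomp i) z + dbar cylinder (dirx i) (ucomp j) z)).

Definition celerity (x : R * R) : R := c0 * Num.sqrt (g * zeta x).

Definition continuity_eq z : Prop :=
  'D_dirt phi z + \sum_(i < 2) 'D_(dirx i) (fun w => phi w * ucomp i w) z = 0.

Definition momentum_eq z : Prop := forall i,
  rho * phi z *
    ('D_dirt (ucomp i) z + \sum_(j < 2) ucomp j z * 'D_(dirx j) (ucomp i) z)
  - 2 * mu * \sum_(j < 2) 'D_(dirx j) (fun w => phi w * strain w i j) z
  + rho * g * phi z * 'D_(dirx i) eta z = 0.

Definition dirichlet_bc (GD : set (R * R)) : Prop :=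
  forall x t, GD x -> 0 < t < T -> u (x, t) = 0.

Section BoundaryTerms.
Context {N : nat}.
Variables (gam : 'I_N -> R -> R * R) (nu : R * R -> R * R).

Definition slip_bc (GS : set (R * R)) : Prop :=
  forall x t, GS x -> regular_pt gam x -> 0 < t < T ->
    cross (mxact (strain (x, t)) (nu x)) (nu x) = 0 /\ dot (u (x, t)) (nu x) = 0.

Definition transmission_bc (GT : set (R * R)) : Prop :=
  forall x t, GT x -> regular_pt gam x -> 0 < t < T ->
    u (x, t) = (celerity x * (eta (x, t) / phi (x, t))) *: nu x.

Definition energy t : R :=
  area_integral Om (fun x => rho / 2 * phi (x, t) * dot (u (x, t)) (u (x, t)))
  + area_integral Om (fun x => rho * g * `|eta (x, t)| ^+ 2 / 2).

Definition I1 (GT : set (R * R)) t : R :=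
  - (rho / 2) * line_integral gam GT (fun x =>
      phi (x, t) * dot (u (x, t)) (u (x, t)) * dot (u (x, t)) (nu x)).

Definition I2 (GT : set (R * R)) t : R :=
  - (rho * g) * line_integral gam GT (fun x =>
      phi (x, t) * eta (x, t) * dot (u (x, t)) (nu x)).

Definition I3 (GT : set (R * R)) t : R :=
  2 * mu * line_integral gam GT (fun x =>
      phi (x, t) * dot (mxact (strain (x, t)) (nu x)) (u (x, t))).

Definition I4 t : R :=
  - (2 * mu) * area_integral Om (fun x => phi (x, t) * frob2 (strain (x, t))).

End BoundaryTerms.
End ShallowWater.

(* Main.v *)
(** Testing the momentum equation with [u] and the mass equation with
    [rho / 2 |u|^2 + rho g eta] shows that the energy density has time derivative
    [div F - 2 mu phi |D(u)|^2] with
    [F = - rho / 2 phi |u|^2 u - rho g phi eta u + 2 mu phi D(u) u].  Its integral is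
    differentiated under the integral sign, and the divergence becomes the flux of
    [F] through the boundary.  That flux vanishes on [GD], where [u = 0], and on
    [GS], where [u . nu = 0] and [D(u) nu] is parallel to [nu]; on [GT] it is
    [I1 + I2 + I3].  At [t = 0] and [t = T] everything holds by continuity.

    The Gauss-Green formula is proved for domains bounded by regular C^1 arcs.
    Near an interior point of an arc the domain is one side of a graph over one of
    the axes, where the formula follows from Fubini and the fundamental theorem of
    calculus after a shear.  Compactness and products of bumps localize the general
    case, except near the end points of the arcs; there a bump of radius [ep] has
    gradient of size [1 / ep] on an area of size [ep ^ 2], so that the contribution
    of a neighbourhood of a corner tends to zero. *)

Require Import Defs.
From mathcomp Require Import all_boot all_order all_algebra.
From mathcomp Require Import all_classical all_reals all_analysis.
From mathcomp Require Import ring lra.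

Set Implicit Arguments.
Unset Strict Implicit.
Unset Printing Implicit Defensive.

Import Order.TTheory GRing.Theory Num.Theory.
Import numFieldNormedType.Exports.

Local Open Scope classical_set_scope.
Local Open Scope ring_scope.

(** Derivatives are known only up to the closure, so each is carried as a second function:
    [C1on D v f g] makes [g] the continuous extension to [closure D] of the derivative of [f] along
    [v]. Nothing is extended across the boundary; integrals over a slab stop at the graph itself.
    The hypothesis on the normal is pointwise and gives no neighbourhood. That the domain lies on
    one side of a whole piece of an arc is deduced: the two open half-strips along the graph are
    connected and avoid the boundary, so each is entirely inside or entirely outside, and the normal
    at one point decides which. Gauss-Green is proved one coordinate at a time, for one function and
    one partial derivative. Localization cuts off one bump at a time,
    [f = bump * f + (1 - bump) * f], so no partition of unity is normalized. No angle condition is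
    imposed at corners: the estimates use only the area of a square and the length of parameter
    intervals, which admits cusps. *)

Section plane_measurability.
Context {R : realType}.
(** The product sigma-algebra is generated by rectangles, so the open set is written as the union of
    the rational open boxes that it contains; the other boxes are replaced by the empty set to keep
    a countable index type. *)
Lemma open2_measurable (A : set (R * R)) : open A ->
  measurable (A : set (measurableTypeR R * measurableTypeR R)).
Proof.
move=> oA.
pose box (q : (rat * rat) * (rat * rat)) : set (R * R) :=
  `]ratr q.1.1, ratr q.1.2[ `*` `]ratr q.2.1, ratr q.2.2[.
have -> : A = \bigcup_q (if `[< box q `<=` A >] then box q else set0).
  apply/seteqP; split => [[x y] Axy|z [q _]]; last first.
    by case: asboolP => // bA /bA.
  have /nbhs_ballP[e /= e0 eA] : nbhs (x, y) A by exact: open_nbhs_nbhs.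
  have hl (t : R) : exists q : rat * rat, ratr q.1 < t < ratr q.2 /\
     (forall s, ratr q.1 < s < ratr q.2 -> ball t e s).
    have [q /andP[q1 q2]] : exists q : rat, (t - e < ratr q) && (ratr q < t).
      have /rat_in_itvoo[q] : t - e < t by rewrite ltrBlDr ltrDl.
      by rewrite in_itv => qq; exists q.
    have [r /andP[r1 r2]] : exists q : rat, (t < ratr q) && (ratr q < t + e).
      have /rat_in_itvoo[r] : t < t + e by rewrite ltrDl.
      by rewrite in_itv => rr; exists r.
    exists (q, r) => /=; split; first by rewrite q2 r1.
    move=> s /andP[s1 s2]; rewrite /ball/= ltr_distl.
    by apply/andP; split; [rewrite ltrBlDr|]; lra.
  have [qx [xq bx]] := hl x; have [qy [yq by_]] := hl y.
  have bA : box (qx, qy) `<=` A.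
    move=> [s t] [/=]; rewrite !in_itv/= => ss tt.
    by apply: eA; split; [exact: bx|exact: by_].
  exists (qx, qy) => //; by rewrite asboolT//= ; split => /=; rewrite in_itv.
apply: countable_bigcupT_measurable => // q.
case: asboolP => [bA|nA]; last exact: measurable0.
by apply: measurableX => //; exact: measurable_itv.
Qed.

Lemma closed2_measurable (A : set (R * R)) : closed A ->
  measurable (A : set (measurableTypeR R * measurableTypeR R)).
Proof.
by move=> /closed_openC/open2_measurable/measurableC; rewrite setCK.
Qed.

Lemma within_continuous2_measurable (K : set (R * R)) (f : R * R -> R) :
  closed K -> {within K, continuous f} ->
  measurable_fun (K : set (measurableTypeR R * measurableTypeR R)) f.
Proof.
move=> cK /continuousP cf; apply: (measurability _ (measurable_realfun.RGenOpens.measurableE R)).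
move=> _ [_ [a [b ->] <-]].
have /open_subspaceP[V oV VD] : open (from_subspace K f @^-1` `]a, b[%classic).
  exact/cf/interval_open.
rewrite setIC -VD; apply: measurableI; [exact: open2_measurable|exact: closed2_measurable].
Qed.
End plane_measurability.

(** * Differentiation along lines and graphs *)

Section calculus.
Context {R : realType}.

(** Both orders of [a] and [b] are allowed, so that increments of either sign need no case
    distinction later. *)
Lemma MVT_between (f df : R -> R) (a b : R) :
  (forall x, (a <= x <= b) || (b <= x <= a) -> is_derive x 1 f (df x)) ->
  exists2 c, (a <= c <= b) || (b <= c <= a) & f b - f a = df c * (b - a).
Proof.
move=> fd; have cf u v : ((a == u) && (b == v)) || ((a == v) && (b == u)) ->
    {within `[u, v], continuous f}.
  move=> uv; apply: derivable_within_continuous => x.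
  rewrite in_itv/= => xuv.
  have [] // := fd x.
  by move: uv => /orP[]/andP[/eqP-> /eqP->]; rewrite xuv ?orbT.
have [ab|/ltW ba] := leP a b.
  have [c cab e] : exists2 c, c \in `[a, b] & f b - f a = df c * (b - a).
    apply: MVT_segment => //; last by apply: cf; rewrite !eqxx.
    move=> x /subset_itv_oo_cc; rewrite in_itv/= => xab.
    by apply: fd; rewrite xab.
  by exists c => //; rewrite in_itv/= in cab; rewrite cab.
have [c cab e] : exists2 c, c \in `[b, a] & f a - f b = df c * (a - b).
  apply: MVT_segment => //; last by apply: cf; rewrite !eqxx orbT.
  move=> x /subset_itv_oo_cc; rewrite in_itv/= => xab.
  by apply: fd; rewrite xab orbT.
exists c; first by rewrite in_itv/= in cab; rewrite cab orbT.
by rewrite -opprB e -mulrN opprB.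
Qed.

(** The difference quotients of [F] at [x] and of [f] at [z] along [v] are the same function of [h];
    hence no chain rule, and no Fréchet differentiability of [f], is needed. *)
Lemma is_derive_line (V : normedModType R) (f : V -> R) (F : R -> R) x z v d :
  (forall h, F (h + x) = f (h *: v + z)) ->
  is_derive z v f d -> is_derive x 1 F d.
Proof.
move=> Ff [df fd].
have E : (fun h : R => h^-1 *: (F (h *: (1 : R) + x) - F x)) =
         (fun h : R => h^-1 *: (f (h *: v + z) - f z)).
  apply/funext => h; rewrite [h *: 1]mulr1 Ff; congr (_ *: (_ - _)).
  by rewrite -[x in LHS]add0r Ff scale0r add0r.
by apply: DeriveDef; [rewrite /derivable E|rewrite /derive E].
Qed.

(* Only [f^~ y] need be differentiated off the curve: write the increment as
   [(f x (k x) - f x0 (k x)) + (f x0 (k x) - f x0 (k x0))]. *)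
Lemma is_derive_graph (f fx : R -> R -> R) (k : R -> R) (fy dk x0 : R) :
  (\forall z \near ((x0, k x0) : R * R), is_derive (z.1 : R) 1 (f^~ z.2) (fx z.1 z.2)) ->
  fx z.1 z.2 @[z --> ((x0, k x0) : R * R)] --> fx x0 (k x0) ->
  is_derive (k x0) 1 (f x0) fy -> is_derive x0 1 k dk ->
  is_derive x0 1 (fun x => f x (k x)) (fx x0 (k x0) + dk * fy).
Proof.
move=> fxd cfx fyd kd.
have -> : (fun x => f x (k x)) =
    (fun x => f x (k x) - f x0 (k x)) + (f x0 \o k).
  by apply/funext => x; rewrite !fctE subrK.
apply: is_deriveD; last by apply: is_derive_eq; rewrite mulrC.
set w := fun x => _; set a := fx x0 _.
apply/is_derive1_caratheodory.
(* The Carathéodory slope of [w], which vanishes at [x0]. By the mean value theorem in the first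
   variable it equals [fx c (k z)] with [c] between [x0] and [z], and this tends to [a]. *)
exists (fun z => if z == x0 then a else w z / (z - x0)); split.
- move=> z; have [->|zx] := eqVneq; first by rewrite !subrr mulr0.
  by rewrite divfK ?subr_eq0// /w subrr subr0.
- rewrite /prop_for /continuous_at /= eqxx; apply/cvgrPdist_lt => e e0.
  move/cvgrPdist_lt : cfx => /(_ _ e0) cfx.
  have : nbhs ((x0, k x0) : R * R) (fun z : R * R =>
      is_derive (z.1 : R) 1 (f^~ z.2) (fx z.1 z.2) /\ `|a - fx z.1 z.2| < e).
    by apply: filterI.
  move=> /nbhs_ballP[d /= d0 dP].
  have ck : {for x0, continuous k}.
    by apply/differentiable_continuous/derivable1_diffP; case: kd.
  move/cvgrPdist_lt : ck => /(_ _ d0) ck.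
  near=> z.
  have [_|zx] := eqVneq; first by rewrite subrr normr0.
  have kz : `|k x0 - k z| < d by near: z.
  have zd : `|x0 - z| < d by near: z; exact: (nbhsx_ballx x0 _ d0).
  have bz c : (x0 <= c <= z) || (z <= c <= x0) -> ball (x0, k x0) d (c, k z).
    move=> cb; split; rewrite /ball//=; apply: le_lt_trans zd.
    have [xz|zx'] := leP x0 z.
    + rewrite !ler0_norm ?subr_le0//; last by move/orP: cb => []/andP[]; lra.
      by move/orP: cb => []/andP[]; lra.
    + rewrite !ger0_norm ?subr_ge0 ?(ltW zx')//; last by move/orP: cb => []/andP[]; lra.
      by move/orP: cb => []/andP[]; lra.
  have [c cb E] : exists2 c, (x0 <= c <= z) || (z <= c <= x0) &
      f z (k z) - f x0 (k z) = fx c (k z) * (z - x0).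
    apply: (@MVT_between (f^~ (k z)) (fx^~ (k z))) => c cb.
    by have [] := dP _ (bz _ cb).
  rewrite /w E mulfK ?subr_eq0//.
  by have [] := dP _ (bz _ cb).
- by rewrite eqxx.
Unshelve. all: by end_near. Qed.
End calculus.

(** * Functions with a derivative continuous up to the closure *)

Section C1on.
Context {R : realType} {V : normedModType R}.
Implicit Types (D : set V) (v : V) (f g : V -> R).

Definition C1on D v f g : Prop :=
  [/\ {within closure D, continuous f}, {within closure D, continuous g} &
      forall z, D z -> is_derive z v f (g z)].

Lemma C1on_cst D v (c : R) : C1on D v (fun=> c) (fun=> 0).
Proof.
split; [exact/continuous_subspaceT/cst_continuous|
        exact/continuous_subspaceT/cst_continuous|].
by move=> z _; exact: is_derive_cst.
Qed.

Lemma C1onD D v f1 g1 f2 g2 : C1on D v f1 g1 -> C1on D v f2 g2 ->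
  C1on D v (fun z => f1 z + f2 z) (fun z => g1 z + g2 z).
Proof.
move=> [cf1 cg1 d1] [cf2 cg2 d2]; split.
- by move=> z; apply: continuousD; [exact: cf1|exact: cf2].
- by move=> z; apply: continuousD; [exact: cg1|exact: cg2].
- by move=> z Dz; apply: is_deriveD; [exact: d1|exact: d2].
Qed.

Lemma C1onM D v f1 g1 f2 g2 : C1on D v f1 g1 -> C1on D v f2 g2 ->
  C1on D v (fun z => f1 z * f2 z) (fun z => g1 z * f2 z + f1 z * g2 z).
Proof.
move=> [cf1 cg1 d1] [cf2 cg2 d2]; split.
- by move=> z; apply: continuousM; [exact: cf1|exact: cf2].
- have c1 : {within closure D, continuous (fun z => g1 z * f2 z)}.
    by move=> z; apply: continuousM; [exact: cg1|exact: cf2].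
  have c2 : {within closure D, continuous (fun z => f1 z * g2 z)}.
    by move=> z; apply: continuousM; [exact: cf1|exact: cg2].
  by move=> z; exact: (continuousD (c1 z) (c2 z)).
- move=> z Dz; apply: is_derive_eq.
    by apply: is_deriveM; [exact: d1|exact: d2].
  by rewrite addrC mulrC.
Qed.

Lemma C1on_scale D v (c : R) f g : C1on D v f g ->
  C1on D v (fun z => c * f z) (fun z => c * g z).
Proof.
move=> fg; have := C1onM (C1on_cst D v c) fg.
by congr (C1on _ _ _ _); apply/funext => z; rewrite mul0r add0r.
Qed.

Lemma C1onB D v f1 g1 f2 g2 : C1on D v f1 g1 -> C1on D v f2 g2 ->
  C1on D v (fun z => f1 z - f2 z) (fun z => g1 z - g2 z).
Proof.
move=> h1 /(C1on_scale (-1)) h2; have := C1onD h1 h2.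
by congr (C1on _ _ _ _); apply/funext => z; rewrite mulN1r.
Qed.

(** [D] is open, so the derivative at a point of [D] sees only values in [D]. *)
Lemma eq_C1on D v f1 g1 f2 g2 : open D ->
  (forall z, closure D z -> f1 z = f2 z) ->
  (forall z, closure D z -> g1 z = g2 z) ->
  C1on D v f1 g1 -> C1on D v f2 g2.
Proof.
move=> oD ef eg [cf cg d]; split.
- by apply: subspace_eq_continuous cf => z; rewrite inE; exact: ef.
- by apply: subspace_eq_continuous cg => z; rewrite inE; exact: eg.
- move=> z Dz; rewrite -eg; last exact: subset_closure.
  apply: near_eq_is_derive (d _ Dz).
  near=> y; apply: ef; apply: subset_closure.
  by near: y; exact: open_nbhs_nbhs.
Unshelve. all: by end_near. Qed.

Lemma Ck_closure_C1on k D v f : Ck_closure k.+1 D f ->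
  exists2 g, C1on D v f g & Ck_closure k D g.
Proof.
move=> [cf /(_ v)[g dg kg]]; exists g => //; split => //.
by case: k kg => [|k] [].
Qed.

Lemma within_continuous_bounded (K : set V) f : compact K ->
  {within K, continuous f} -> exists M, 0 < M /\ forall z, K z -> `|f z| <= M.
Proof.
move=> cK cf; have [M [_ hM]] := compact_bounded (continuous_compact cf cK).
exists (`|M| + 1); split => [|z Kz]; first by rewrite ltr_wpDl.
by apply: hM; [rewrite ltr_pwDr// ler_norm|exists z].
Qed.

End C1on.

(** * Compactness and closures *)

Section plane_topology.
Context {R : realType}.

Lemma bounded_set2P (A : set (R * R)) : bounded_set A ->
  exists2 M, 0 < M & A `<=` `[-M, M] `*` `[-M, M].
Proof.
move=> [M [_ hM]]; exists (`|M| + 1); first by rewrite ltr_wpDl.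
move=> [x y] Axy; have := hM (`|M| + 1) _ _ Axy.
rewrite ltr_pwDr// ?ler_norm// => /(_ isT).
rewrite /= prod_normE/= ge_max !ler_norml => /andP[/andP[a1 a2] /andP[b1 b2]].
by split => /=; rewrite in_itv/=; apply/andP.
Qed.

Lemma closure_box (A : set (R * R)) M : A `<=` `[-M, M] `*` `[-M, M] ->
  closure A `<=` `[-M, M] `*` `[-M, M].
Proof.
move=> AM; rewrite -[X in _ `<=` X](_ : closure (`[-M, M] `*` `[-M, M]) = _).
  exact: closure_subset.
apply/esym/closure_id; apply: compact_closed.
  exact: (@norm_hausdorff _ (R * R)%type).
by apply: compact_setX; exact: segment_compact.
Qed.

Lemma bounded_closure_compact (A : set (R * R)) : bounded_set A ->
  compact (closure A).
Proof.
move=> /bounded_set2P[M _ AM]; apply: (subclosed_compact _ _ (closure_box AM)).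
  exact: closed_closure.
by apply: compact_setX; exact: segment_compact.
Qed.

Lemma closure_slab (A : set (R * R)) (T : R) x t : 0 < T ->
  closure A x -> 0 <= t <= T -> closure (cylinder A T) (x, t).
Proof.
move=> T0 Ax tT B /nbhs_ballP[e /= e0 eB].
have [y [Ay xy]] := Ax _ (nbhsx_ballx x _ e0).
have [s [sT st]] : exists s, 0 < s < T /\ `|t - s| < e.
  (* [t] moves by [m] towards the middle: [T / 4] keeps it in []0, T[] from either half, [e / 2]
     keeps it in the ball. *)
  pose m := Num.min (e / 2) (T / 4); have m0 : 0 < m by rewrite lt_min; lra.
  have [m1 m2] : m <= e / 2 /\ m <= T / 4 by split; rewrite ge_min lexx ?orbT.
  have [tT2|tT2] := leP t (T / 2).
  - by exists (t + m); split; [lra|rewrite opprD addNKr normrN gtr0_norm//; lra].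
  - exists (t - m); split; first lra.
    by rewrite opprB addrC subrK gtr0_norm//; lra.
by exists (y, s); split => //; apply: eB; split.
Qed.

End plane_topology.

Lemma within_continuous_comp {U V W : topologicalType} (A : set U) (B : set V)
    (S : U -> V) (F : V -> W) :
  {within A, continuous S} -> (forall z, A z -> B (S z)) ->
  {within B, continuous F} -> {within A, continuous (F \o S)}.
Proof.
rewrite !subspace_continuousP => cS AB cF z Az O /= nO.
have h1 : nbhs (S z) (fun y => B y -> O (F y)) := cF _ (AB _ Az) _ nO.
have h2 : nbhs z (fun y => A y -> B (S y) -> O (F (S y))) := cS _ Az _ h1.
by apply: filterS h2 => y h Ay; exact: h Ay (AB _ Ay).
Qed.

(** * Iterated integrals in either order *)

Section iterated.
Context {R : realType}.
Notation mu := (@lebesgue_measure R).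
Notation mu2 := (mu \x mu)%E.
Implicit Types (D : set (R * R)) (G : R * R -> R).

(* The two coordinate orders, so that graphs over either axis are treated at once. *)
Definition coord (b : bool) (x y : R) : R * R := if b then (y, x) else (x, y).

Lemma mu2_box (a b c d : R) : a <= b -> c <= d ->
  mu2 (`[a, b]%classic `*` `[c, d]%classic) = ((b - a) * (d - c))%:E.
Proof.
move=> ab cd; rewrite product_measure1E//= !lebesgue_measure_itv/= !lte_fin.
have -> : (if a < b then (b%:E - a%:E)%E else 0%E) = (b - a)%:E.
  by case: ltgtP ab => // -> _; rewrite subrr.
have -> : (if c < d then (d%:E - c%:E)%E else 0%E) = (d - c)%:E.
  by case: ltgtP cd => // -> _; rewrite subrr.
by rewrite EFinM.
Qed.

Lemma integrable_bounded2 D G (B M : R) :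
  measurable (D : set (measurableTypeR R * measurableTypeR R)) ->
  measurable_fun (D : set (measurableTypeR R * measurableTypeR R)) G ->
  D `<=` `[-B, B] `*` `[-B, B] ->
  (forall z, D z -> `|G z| <= M) -> mu2.-integrable D (EFin \o G).
Proof.
move=> mD mG DB GM; apply: measurable_bounded_integrable => //; last first.
  exists M; split; rewrite ?num_real// => m Mm z Dz /=.
  exact: le_trans (GM _ Dz) (ltW Mm).
have [B0|B0] := leP 0 B.
  apply: (@le_lt_trans _ _ (mu2 (`[-B, B]%classic `*` `[-B, B]%classic))).
    by apply: le_measure; rewrite ?inE//; exact: measurableX.
  by rewrite mu2_box ?ltry// ge0_cp.
suff -> : D = set0 by rewrite measure0.
rewrite -subset0 => z /DB[/=]; rewrite in_itv/= => /andP[z1 z2]; lra.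
Qed.

Lemma integrable_bounded1 (A : set R) (g : R -> R) (B M : R) :
  measurable A -> measurable_fun A g -> A `<=` `[-B, B] ->
  (forall x, A x -> `|g x| <= M) -> mu.-integrable A (EFin \o g).
Proof.
move=> mA mg AB gM; apply: measurable_bounded_integrable => //; last first.
  exists M; split; rewrite ?num_real// => m Mm z Dz /=.
  exact: le_trans (gM _ Dz) (ltW Mm).
apply: (@le_lt_trans _ _ (mu `[-B, B]%classic)).
  by apply: le_measure; rewrite ?inE.
by rewrite lebesgue_measure_itv/=; case: ifP => _; rewrite ?ltry// -EFinB ltry.
Qed.

(** Fubini for the extension of [G] by zero to the whole plane; [b] selects which coordinate is the
    outer variable. *)
Lemma area_iterated (b : bool) D G (B M : R) :
  measurable (D : set (measurableTypeR R * measurableTypeR R)) ->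
  measurable_fun (D : set (measurableTypeR R * measurableTypeR R)) G ->
  D `<=` `[-B, B] `*` `[-B, B] ->
  (forall z, D z -> `|G z| <= M) ->
  area_integral D G = \int[mu]_x \int[mu]_y (G \_ D) (coord b x y).
Proof.
move=> mD mG DB GM; rewrite /area_integral Rintegral_mkcond.
set g := G \_ D.
have mg : measurable_fun (setT : set (measurableTypeR R * measurableTypeR R)) g.
  by apply/(measurable_restrictT _ mD).
have ig : mu2.-integrable setT (EFin \o g).
  rewrite /g -restrict_EFin; apply/integrable_restrict => //=.
  by rewrite setTI; exact: (@integrable_bounded2 _ _ B M).
have g0 z : ~ (`[-B, B] `*` `[-B, B]) z -> g z = 0.
  by move=> zB; rewrite /g patchE memNset// => /DB.
have gM z : `|g z| <= `|M|.
  rewrite /g patchE; case: ifPn => [|_]; last by rewrite normr0.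
  by rewrite inE => /GM /le_trans; apply; exact: ler_norm.
(* The sections are bounded and supported in a segment, so their extended integrals are finite and
   the real-valued inner integral loses nothing. *)
have isec (k : R -> R) : measurable_fun setT k -> (forall y, `|k y| <= `|M|) ->
    (forall y, ~ `[-B, B]%classic y -> k y = 0) ->
    (\int[mu]_y (k y)%:E)%E = (\int[mu]_y k y)%:E.
  move=> mk kM k0; rewrite /Rintegral fineK//; apply: integrable_fin_num => //.
  rewrite (_ : (fun y => _) = (EFin \o k) \_ `[-B, B]); last first.
    apply/funext => y; rewrite patchE; case: ifPn => //.
    by rewrite notin_setE => /k0/= ->.
  apply/integrable_restrict => //; rewrite setTI.
  by apply: (@integrable_bounded1 _ _ B `|M|) => //; exact: measurable_funTS.
rewrite /Rintegral; congr fine; rewrite /coord; case: b.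
- rewrite -(integral21_prod_meas1 ig); apply: eq_integral => y _.
  rewrite /fubini_G isec//.
    exact: measurableT_comp mg (pair2_measurable y).
  by move=> x xB; apply: g0 => -[].
- rewrite -(integral12_prod_meas1 ig); apply: eq_integral => x _.
  rewrite /fubini_F isec//.
    exact: measurableT_comp mg (pair1_measurable x).
  by move=> y yB; apply: g0 => -[].
Qed.

Lemma area_rect (b : bool) (g : R * R -> R) (x0 x1 y0 y1 : R) :
  let Q := coord b x0 y0 in let Q' := coord b x1 y1 in
  {within `[Q.1, Q'.1] `*` `[Q.2, Q'.2], continuous g} ->
  area_integral (`]Q.1, Q'.1[ `*` `]Q.2, Q'.2[) g =
  \int[mu]_(x in `]x0, x1[) \int[mu]_(y in `]y0, y1[) g (coord b x y).
Proof.
move=> q q' cg; set Q := `[_, _] `*` `[_, _] in cg; set Q' := `]_, _[ `*` _.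
have kQ : compact Q by apply: compact_setX; exact: segment_compact.
have cQ : closed Q.
  by apply: compact_closed => //; exact: (@norm_hausdorff _ (R * R)%type).
have QQ : Q' `<=` Q.
  by move=> [x y] [/= xq yq]; split; exact: subset_itv_oo_cc.
have [M [_ hM]] := within_continuous_bounded kQ cg.
have [B _ hB] := bounded_set2P (compact_bounded kQ).
have mQ' : measurable (Q' : set (measurableTypeR R * measurableTypeR R)).
  by apply: measurableX; exact: measurable_itv.
have mg : measurable_fun (Q' : set (measurableTypeR R * measurableTypeR R)) g.
  apply: measurable_funS QQ _ => //; first exact: closed2_measurable.
  exact: within_continuous2_measurable.
rewrite (area_iterated b mQ' mg (subset_trans QQ hB) (fun z zQ => hM z (QQ z zQ))).
rewrite [RHS]Rintegral_mkcond; apply: eq_Rintegral => x _.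
rewrite [RHS]patchE; case: ifPn => [|].
- rewrite inE => xQ; rewrite [RHS]Rintegral_mkcond; apply: eq_Rintegral => y _.
  rewrite !patchE; congr (if _ then _ else _); apply/idP/idP; rewrite !inE;
    rewrite /Q' /q /q' /coord; case: (b) => /=.
  + by case.
  + by case.
  + by move=> yQ; split.
  + by move=> yQ; split.
- rewrite notin_setE => xQ; rewrite -[RHS](Rintegral_set0 mu (fun=> 0)).
  rewrite [RHS]Rintegral_mkcond; apply: eq_Rintegral => y _; rewrite !patchE in_set0.
  rewrite memNset//; move: xQ; rewrite /Q' /q /q' /coord.
  by case: (b) => xQ [].
Qed.

End iterated.

(** * Integrals over intervals *)

Section one_dim.
Context {R : realType}.
Notation mu := (@lebesgue_measure R).

Lemma Rintegral_oo_cc (a b : R) (g : R -> R) : {within `[a, b], continuous g} ->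
  \int[mu]_(x in `]a, b[) g x = \int[mu]_(x in `[a, b]) g x.
Proof.
move=> cg.
have ig : mu.-integrable `[a, b] (EFin \o g).
  by apply: continuous_compact_integrable => //; exact: segment_compact.
rewrite Rintegral_itv_bndo_bndc ?Rintegral_itv_obnd_cbnd//;
  by apply: integrableS ig => //; apply: subset_itv; rewrite bnd_simp.
Qed.

Lemma Rintegral_FTC (a b : R) (F g : R -> R) : a < b ->
  {within `[a, b], continuous g} -> {within `[a, b], continuous F} ->
  (forall x, a < x < b -> is_derive x 1 F (g x)) ->
  \int[mu]_(x in `]a, b[) g x = F b - F a.
Proof.
move=> ab cg cF dF; rewrite Rintegral_oo_cc// /Rintegral.
rewrite (@continuous_FTC2 _ g F _ _ ab cg)//.
- have [c l r] := (continuous_within_itvP _ ab).1 cF.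
  by split => // x; rewrite in_itv/= => /dF[].
- by move=> x; rewrite in_itv/= => /dF h; rewrite derive1E derive_val.
Qed.

Lemma Rintegral_translate (c t0 t1 : R) (g : R -> R) : t0 < t1 ->
  {within `[c + t0, c + t1], continuous g} ->
  \int[mu]_(y in `]c + t0, c + t1[) g y = \int[mu]_(t in `]t0, t1[) g (c + t).
Proof.
move=> tt cg; have dc (x : R) : is_derive x 1 (fun t : R => c + t) (1 : R).
  by rewrite -[X in is_derive _ _ _ X]add0r; apply: is_deriveD.
have dE : derive1 (fun t : R => c + t) = cst 1.
  by apply/funext => x; rewrite derive1E derive_val.
have cc : continuous (fun t : R => c + t).
  by move=> x; apply/differentiable_continuous/derivable1_diffP; case: (dc x).
rewrite !Rintegral_oo_cc//.
- rewrite /Rintegral (@integration_by_substitution_increasing _ (fun t => c + t))//.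
  + by congr fine; apply: eq_integral => x _; rewrite dE/= mulr1.
  + exact: ltW.
  + by move=> x y _ _; rewrite ltrD2l.
  + by rewrite dE => x _; exact: cst_continuous.
  + by rewrite dE; exact: is_cvg_cst.
  + by rewrite dE; exact: is_cvg_cst.
  + split => [x _||]; first by case: (dc x).
    * exact/cvg_at_right_filter/cc.
    * exact/cvg_at_left_filter/cc.
- apply: (within_continuous_comp (B := `[c + t0, c + t1]) _ _ cg).
    exact: continuous_subspaceT.
  by move=> z/=; rewrite !in_itv/= !lerD2l.
Qed.

End one_dim.

(** * Regions bounded by a graph *)

Section curved_rectangle.
Context {R : realType}.
Notation mu := (@lebesgue_measure R).
Notation mu2 := (mu \x mu)%E.
Variables (a b t0 t1 : R) (h dh : R -> R) (f fx fy : R -> R -> R).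
Hypotheses (ab : a < b) (tt : t0 < t1).
Hypotheses (ch : {within `[a, b], continuous h}).
Hypotheses (cdh : {within `[a, b], continuous dh}).
Hypothesis hd : forall x, a < x < b -> is_derive x 1 h (dh x).
Let K : set (R * R) :=
  [set z | a <= z.1 <= b /\ h z.1 + t0 <= z.2 <= h z.1 + t1].
Hypothesis cf : {within K, continuous (fun z => f z.1 z.2)}.
Hypothesis cfx : {within K, continuous (fun z => fx z.1 z.2)}.
Hypothesis cfy : {within K, continuous (fun z => fy z.1 z.2)}.
Hypothesis dfx : forall x y, a < x < b -> h x + t0 < y < h x + t1 ->
  is_derive x 1 (f^~ y) (fx x y).
Hypothesis dfy : forall x y, a < x < b -> h x + t0 < y < h x + t1 ->
  is_derive y 1 (f x) (fy x y).

Let slice_continuous (F : R -> R -> R) x : a <= x <= b ->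
  {within K, continuous (fun z => F z.1 z.2)} ->
  {within `[h x + t0, h x + t1], continuous (F x)}.
Proof.
move=> xab cF.
apply: (within_continuous_comp (S := pair x) _ _ cF).
  by apply: continuous_subspaceT => y; exact: (cvg_pair (cvg_cst x) cvg_id).
by move=> y /=; rewrite in_itv.
Qed.

Lemma curved_rect_y x : a < x < b ->
  \int[mu]_(y in `]h x + t0, h x + t1[) fy x y = f x (h x + t1) - f x (h x + t0).
Proof.
move=> xab; have xab' : a <= x <= b by lra.
apply: Rintegral_FTC; rewrite ?ltrD2l//; last by move=> y yt; exact: dfy.
- exact: (slice_continuous (F := fy) xab' cfy).
- exact: (slice_continuous (F := f) xab' cf).
Qed.

Let Q := `[a, b]%classic `*` `[t0, t1]%classic.

Let shear_continuous (F : R -> R -> R) :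
  {within K, continuous (fun z => F z.1 z.2)} ->
  {within Q, continuous (fun z => F z.1 (h z.1 + z.2))}.
Proof.
move=> cF.
have c1 : {within Q, continuous (@fst R R)}.
  by apply: continuous_subspaceT => z; exact: cvg_fst.
have c2 : {within Q, continuous (@snd R R)}.
  by apply: continuous_subspaceT => z; exact: cvg_snd.
have c3 : {within Q, continuous (fun z => h z.1)}.
  by apply: (within_continuous_comp c1 _ ch) => z [].
apply: (within_continuous_comp (S := fun z => (z.1, h z.1 + z.2)) _ _ cF).
  by move=> z; exact: (cvg_pair (c1 z) (continuousD (c3 z) (c2 z))).
move=> z [/=]; rewrite !in_itv/= => zab zt; split => //=.
by rewrite !lerD2l.
Qed.

(* Shear by [y = h x + t]: the x-derivative of [f x (h x + t)] has zero
   integral, and it is [fx + dh * fy]. *)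
Lemma curved_rect_x :
  (forall t, t0 < t < t1 -> f a (h a + t) = 0 /\ f b (h b + t) = 0) ->
  \int[mu]_(x in `]a, b[) \int[mu]_(y in `]h x + t0, h x + t1[) fx x y =
  - \int[mu]_(x in `]a, b[) (dh x * (f x (h x + t1) - f x (h x + t0))).
Proof.
move=> f0; pose D := `]a, b[%classic `*` `]t0, t1[%classic.
pose g1 z := fx z.1 (h z.1 + z.2).
pose g2 z := dh z.1 * fy z.1 (h z.1 + z.2).
have cg1 : {within Q, continuous g1} by exact: shear_continuous.
have cdh2 : {within Q, continuous (fun z => dh z.1)}.
  apply: (within_continuous_comp (S := @fst R R) _ _ cdh) => [|z []//].
  by apply: continuous_subspaceT => z; exact: cvg_fst.
have cfy2 := shear_continuous cfy.
have cg2 : {within Q, continuous g2}.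
  by move=> z; exact: (continuousM (cdh2 z) (cfy2 z)).
have cg : {within Q, continuous (fun z => g1 z + g2 z)}.
  by move=> z; exact: (continuousD (cg1 z) (cg2 z)).
have kQ : compact Q by apply: compact_setX; exact: segment_compact.
have cQ : closed Q.
  by apply: compact_closed => //; exact: (@norm_hausdorff _ (R * R)%type).
have mD : measurable (D : set (measurableTypeR R * measurableTypeR R)).
  by apply: measurableX; exact: measurable_itv.
have DQ : D `<=` Q.
  by move=> [x y] [/= xq yq]; split; exact: subset_itv_oo_cc.
have iD (g : R * R -> R) : {within Q, continuous g} -> mu2.-integrable D (EFin \o g).
  move=> cg'; have [M [_ hM]] := within_continuous_bounded kQ cg'.
  have [B _ hB] := bounded_set2P (compact_bounded kQ).
  apply: (@integrable_bounded2 _ _ _ B M) => //.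
  - apply: measurable_funS DQ _ => //; first exact: closed2_measurable.
    exact: within_continuous2_measurable.
  - exact: subset_trans hB.
  - by move=> z /DQ /hM.
have E : area_integral D (fun z => g1 z + g2 z) =
    area_integral D g1 + area_integral D g2.
  by apply: RintegralD => //; exact: iD.
(* With [t] as the outer variable, the inner integral is that of the [x]-derivative of
   [f x (h x + t)], hence a difference of end values, zero by [f0]. The zero on the right is
   rewritten as an integral over the empty set, so that integrands can be compared after extension
   by zero. *)
have E0 : area_integral D (fun z => g1 z + g2 z) = 0.
  rewrite (@area_rect _ true _ t0 t1 a b)//=.
  rewrite -[RHS](Rintegral_set0 mu (fun=> 0)) [RHS]Rintegral_mkcond.
  rewrite [LHS]Rintegral_mkcond; apply: eq_Rintegral => t _.
  rewrite !patchE in_set0; case: ifPn => //; rewrite inE/= in_itv/= => tt'.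
  have ht : forall x, a <= x <= b -> Q (x, t).
    by move=> x xab; split; rewrite /= in_itv/=; lra.
  have cpt (G : R * R -> R) : {within Q, continuous G} ->
      {within `[a, b], continuous (fun x => G (x, t))}.
    move=> cG; apply: (within_continuous_comp (S := fun x => (x, t)) _ _ cG).
      by apply: continuous_subspaceT => x; exact: (cvg_pair cvg_id (cvg_cst t)).
    by move=> x /=; rewrite in_itv/=; exact: ht.
  transitivity (f b (h b + t) - f a (h a + t)); last first.
    by have [-> ->] := f0 _ tt'; rewrite subrr.
  apply: (@Rintegral_FTC _ a b (fun x => f x (h x + t))) => //.
  - exact: (cpt _ cg).
  - exact: (cpt _ (shear_continuous cf)).
  - move=> x xab.
    have ch' : {for x, continuous h}.
      by apply/differentiable_continuous/derivable1_diffP; case: (hd xab).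
    have ch1 : {for ((x, h x + t) : R * R), continuous (fun z => h z.1)}.
      by apply: (@continuous_comp _ _ _ fst h); [exact: cvg_fst|exact: ch'].
    (* The sheared point is interior to [K]. The vertical margins are halved because both [z.2] and
       [h z.1] move. *)
    have nK : \forall z \near ((x, h x + t) : R * R),
        a < z.1 < b /\ h z.1 + t0 < z.2 < h z.1 + t1.
      have [d [d0 d1 d2 d3 d4]] : exists d, [/\ 0 < d, d <= x - a, d <= b - x,
          d <= (t - t0) / 2 & d <= (t1 - t) / 2].
        exists (Num.min (Num.min (x - a) (b - x)) (Num.min ((t - t0) / 2) ((t1 - t) / 2))).
        split; [rewrite !lt_min; lra|..]; by rewrite !ge_min lexx ?orbT.
      near=> z.
      have z1 : `|x - z.1| < d.
        by near: z; apply: (@cvgr_dist_lt _ _ _ _ _ _ _ cvg_fst).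
      have z2 : `|h x + t - z.2| < d.
        by near: z; apply: (@cvgr_dist_lt _ _ _ _ _ _ _ cvg_snd).
      have z3 : `|h x - h z.1| < d.
        by near: z; apply: (@cvgr_dist_lt _ _ _ _ _ _ _ ch1).
      move: z1 z2 z3; rewrite !ltr_norml => /andP[z1 z1'] /andP[z2 z2'] /andP[z3 z3'].
      by split; apply/andP; split; lra.
    have cK (F : R -> R -> R) : {within K, continuous (fun z => F z.1 z.2)} ->
        F z.1 z.2 @[z --> ((x, h x + t) : R * R)] --> F x (h x + t).
      move=> cF; have {}cF := (subspace_continuousP _ _).1 cF.
      have Kx : K (x, h x + t) by split => /=; lra.
      move=> O nO.
      have hO : nbhs ((x, h x + t) : R * R) (fun z => K z -> O (F z.1 z.2)).
        exact: cF _ Kx _ nO.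
      apply: filterS2 nK hO => z [z1 z2]; apply; split; lra.
    rewrite /g1 /g2/=; apply: (@is_derive_graph _ f fx (fun x => h x + t)).
    + by apply: filterS nK => z [z1 z2]; exact: dfx.
    + exact: cK.
    + by apply: dfy => //; lra.
    + rewrite -[dh x]addr0; have dhx := hd xab.
      exact: (@is_deriveD _ _ _ h (cst t) x 1 (dh x) 0).
(* Now [x] is the outer variable: a translation in each slice undoes the shear, and the slice of
   [g2] is [dh x] times an integral of [fy], known from [curved_rect_y]. *)
move: E; rewrite E0 => /esym/eqP; rewrite addr_eq0 => /eqP.
rewrite (@area_rect _ false _ a b t0 t1)//= (@area_rect _ false _ a b t0 t1)//=.
move=> E; transitivity (\int[mu]_(x in `]a, b[) \int[mu]_(y in `]t0, t1[) g1 (x, y)).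
  apply: eq_Rintegral => x; rewrite inE/= in_itv/= => xab.
  have xab' : a <= x <= b by lra.
  by apply: Rintegral_translate => //; exact: (slice_continuous (F := fx) xab' cfx).
rewrite E; congr (- _); apply: eq_Rintegral => x; rewrite inE/= in_itv/= => xab.
have xab' : a <= x <= b by lra.
rewrite -curved_rect_y// Rintegral_translate//; last exact: (slice_continuous (F := fy) xab' cfy).
rewrite /g2/= RintegralZl//.
have cfyt : {within `[t0, t1], continuous (fun t => fy x (h x + t))}.
  apply: (within_continuous_comp (S := pair x) _ _ cfy2).
    by apply: continuous_subspaceT => y; exact: (cvg_pair (cvg_cst x) cvg_id).
  by move=> y /= yt; split => //=; rewrite in_itv.
have : mu.-integrable `[t0, t1] (EFin \o (fun t => fy x (h x + t))).
  by apply: continuous_compact_integrable => //; exact: segment_compact.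
by apply: integrableS => //; apply: subset_itv_oo_cc.
Unshelve. all: by end_near. Qed.

End curved_rectangle.

(** * Local graph representation of the boundary *)

Section graph_chart.
Context {R : realType}.

(* Near [s0] the curve [s |-> coord b (p s) (q s)] is the graph of [h] over
   [[a, c]], traversed in the direction [sg]; the domain is the side
   [sd * (y - h x) < 0] of the graph, and [(n1, n2)] is the outward normal. *)
Record graph_chart (Om : set (R * R)) (b : bool) (p q dp dq n1 n2 : R -> R)
    (s0 sa sb a c kap sg sd : R) (h dh : R -> R) : Prop := GraphChart {
  chart_s : [/\ 0 < sa, sa < s0, s0 < sb & sb < 1] ;
  chart_ac : a < c ;
  chart_kap : 0 < kap ;
  chart_sg : (sg = 1 /\ p sa = a /\ p sb = c) \/ (sg = -1 /\ p sa = c /\ p sb = a) ;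
  chart_sd : sd = 1 \/ sd = -1 ;
  chart_dp : forall s, sa <= s <= sb -> 0 < sg * dp s ;
  chart_p : forall s, sa < s < sb -> a < p s < c ;
  chart_h : forall s, sa <= s <= sb ->
    [/\ a <= p s <= c, h (p s) = q s & dh (p s) = dq s / dp s] ;
  chart_dh : forall x, a <= x <= c -> is_derive x 1 h (dh x) /\ {for x, continuous dh} ;
  chart_side : forall x t, a <= x <= c -> `|t| < kap ->
    (Om (coord b x (h x + t)) <-> sd * t < 0) ;
  chart_normal : forall s, sa < s < sb ->
    n1 s * Num.sqrt (dp s ^+ 2 + dq s ^+ 2) = - (sg * sd) * dq s /\
    n2 s * Num.sqrt (dp s ^+ 2 + dq s ^+ 2) = (sg * sd) * dp s
}.

Lemma is_derive_le0 (f : R -> R) (l : R) : is_derive (0 : R) 1 f l -> f 0 = 0 ->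
  (\forall e \near 0^'+, f e <= 0) -> l <= 0.
Proof.
move=> /is_derive1_caratheodory[g [fE cg gl]] f0 fe.
rewrite leNgt; apply/negP => l0.
have gp : \forall e \near 0^'+, 0 < g e.
  apply: cvg_within; rewrite /prop_for /continuous_at gl in cg.
  exact: (cvgr_gt _ cg).
have [e [e0 fe0 ge0]] : exists e, [/\ 0 < e, f e <= 0 & 0 < g e].
  apply: (@filter_ex _ (0^'+)); near=> e.
  by split; near: e => //; exact: nbhs_right_gt.
have := fE e; rewrite f0 !subr0 => fee.
by move: fe0; rewrite fee leNgt mulr_gt0.
Unshelve. all: by end_near. Qed.

(** [A] contains no boundary point, so [Om] and [closure Om] have the same trace on [A]; this trace
    is both open and closed in [A]. *)
Lemma open_dichotomy (Om A : set (R * R)) : open Om -> connected A ->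
  (forall z, A z -> ~ boundary Om z) -> (exists2 z, A z & Om z) -> A `<=` Om.
Proof.
move=> oO cA Ab [z0 Az0 Oz0]; suff <- : A `&` Om = A by exact: subIsetr.
apply: cA; first by exists z0.
- by exists Om.
- exists (closure Om); first exact: closed_closure.
  apply/seteqP; split => z [Az Oz]; split => //; first exact: subset_closure.
  apply: contrapT => nOz; apply: (Ab z Az); split => //.
  by move=> /interior_subset.
Qed.

Lemma coord_ball b (x y x' y' r : R) :
  ball (coord b x y) r (coord b x' y') <-> `|x - x'| < r /\ `|y - y'| < r.
Proof. by rewrite /coord; case: b; split => -[]. Qed.

Lemma coord_inj b (x y x' y' : R) :
  coord b x y = coord b x' y' -> x = x' /\ y = y'.
Proof. by case: b => -[-> ->]. Qed.

Lemma coord_continuous b {T : topologicalType} (F G : T -> R) z :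
  {for z, continuous F} -> {for z, continuous G} ->
  {for z, continuous (fun t => coord b (F t) (G t))}.
Proof. by case: b => cF cG; [exact: (cvg_pair cG cF)|exact: (cvg_pair cF cG)]. Qed.

Lemma is_derive1_continuous (f : R -> R) (x l : R) : is_derive x 1 f l ->
  {for x, continuous f}.
Proof. by case=> fd _; apply/differentiable_continuous/derivable1_diffP. Qed.

Lemma is_derive_affine (u v : R) : is_derive (0 : R) 1 (fun e => u - e * v) (- v).
Proof.
apply/is_derive1_caratheodory; exists (fun=> - v); split => //.
- by move=> z; ring.
- exact: cvg_cst.
Qed.

Lemma is_derive_comp_affine (h : R -> R) (u v l : R) : is_derive u 1 h l ->
  is_derive (0 : R) 1 (fun e => h (u - e * v)) (l * - v).
Proof.
move=> hd; have d1 := is_derive_affine u v.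
have hd' : is_derive (u - 0 * v) 1 h l by rewrite mul0r subr0.
exact: (@is_derive1_comp _ h (fun e => u - e * v) 0 l (- v)).
Qed.

(** The difference in the hypothesis is the vertical offset from the graph of the point reached from
    [(u, h u)] by going [e] against [(m1, m2)]. It is zero at [e = 0], so its sign for small [e > 0]
    passes to its derivative. *)
Lemma graph_side_normal (h : R -> R) (u l m1 m2 ep : R) : is_derive u 1 h l ->
  (\forall e \near 0^'+, ep * (h u - e * m2 - h (u - e * m1)) <= 0) ->
  ep * (- m2 + m1 * l) <= 0.
Proof.
move=> hd fe.
have D : is_derive (0 : R) 1 (fun e => ep * (h u - e * m2 - h (u - e * m1)))
    (ep * (- m2 + m1 * l)).
  have d1 := is_derive_affine (h u) m2.
  have d2 := is_derive_comp_affine m1 hd.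
  have d3 := @is_deriveB _ _ _ _ _ _ _ _ _ d1 d2.
  have d4 := @is_deriveM _ _ _ _ _ _ _ _ (is_derive_cst ep (0 : R) 1) d3.
  by apply: is_derive_eq d4 _; rewrite /GRing.scale/=; ring.
have f0 : ep * (h u - 0 * m2 - h (u - 0 * m1)) = 0.
  by rewrite !mul0r !subr0 subrr mulr0.
exact: (is_derive_le0 D f0 fe).
Qed.

(** A unit vector orthogonal to the tangent [(P, Q)] is [(-Q, P)] over its length, up to sign; the
    last inequality fixes the sign, as it forces [0 <= ep * a2]. *)
Lemma normal_components (P Q a1 a2 sg ep : R) :
  sg = 1 \/ sg = -1 -> ep = 1 \/ ep = -1 -> 0 < sg * P ->
  a1 ^+ 2 + a2 ^+ 2 = 1 -> a1 * P + a2 * Q = 0 ->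
  ep * (- a2 + a1 * (Q / P)) <= 0 ->
  a1 * Num.sqrt (P ^+ 2 + Q ^+ 2) = - (sg * ep) * Q /\
  a2 * Num.sqrt (P ^+ 2 + Q ^+ 2) = (sg * ep) * P.
Proof.
move=> sg1 ep1 sP a12 at0 l0.
have ep2 : ep ^+ 2 = 1 by case: ep1 => ->; ring.
have sg2 : sg ^+ 2 = 1 by case: sg1 => ->; ring.
have P0 : P != 0 by apply: contraTneq sP => ->; rewrite mulr0 ltxx.
have a1E : a1 = - a2 * Q / P by apply: (mulIf P0); rewrite divfK//; lra.
set w := Num.sqrt _.
have w2 : w ^+ 2 = P ^+ 2 + Q ^+ 2 by rewrite sqr_sqrtr// addr_ge0 ?sqr_ge0.
have w20 : 0 < w ^+ 2.
  by rewrite w2 ltr_pwDl ?sqr_ge0// lt_neqAle sqr_ge0 eq_sym sqrf_eq0 P0.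
have a2s : 0 <= ep * a2.
  have E : ep * (- a2 + a1 * (Q / P)) * P ^+ 2 = - (ep * a2) * w ^+ 2.
    by rewrite w2 a1E; field.
  have : - (ep * a2) * w ^+ 2 <= 0 by rewrite -E mulr_le0_ge0 ?sqr_ge0.
  by rewrite pmulr_lle0//; lra.
have E2 : a2 * w = sg * ep * P.
  have E3 : (ep * a2 * w) ^+ 2 = (sg * P) ^+ 2.
    rewrite !exprMn ep2 sg2 !mul1r w2.
    transitivity ((a1 ^+ 2 + a2 ^+ 2) * P ^+ 2); last by rewrite a12 mul1r.
    by rewrite a1E; field.
  have E4 : ep * a2 * w = sg * P.
    have w0 : 0 <= ep * a2 * w by rewrite mulr_ge0// sqrtr_ge0.
    by apply/eqP; rewrite -(@eqrXn2 _ 2 _ _ isT w0 (ltW sP)) E3.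
  transitivity (ep * (ep * a2 * w)); last by rewrite E4; ring.
  by rewrite -[LHS]mul1r -ep2; ring.
split=> //; rewrite a1E.
transitivity (- (a2 * w) * Q / P); first by field.
by rewrite E2; field.
Qed.

End graph_chart.

(** * Existence of graph charts *)

Section graph_chart_existence.
Context {R : realType}.

Lemma constant_sign_interval (dp : R -> R) (s0 : R) : continuous dp ->
  0 < s0 < 1 -> dp s0 != 0 ->
  exists sg d : R, [/\ sg = 1 \/ sg = -1, 0 < d &
    forall s, `|s - s0| <= d -> 0 < s < 1 /\ 0 < sg * dp s].
Proof.
move=> cdp s01 dp0.
have [sg [sg1 sgp]] : exists sg : R, (sg = 1 \/ sg = -1) /\ 0 < sg * dp s0.
  have [d0|d0|d0] := ltgtP (dp s0) 0.
  - by exists (-1); split; [right|lra].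
  - by exists 1; split; [left|lra].
  - by move: dp0; rewrite d0 eqxx.
have cs : {for s0, continuous (fun s => sg * dp s)}.
  by apply: continuousM; [exact: cvg_cst|exact: cdp].
have n0 : \forall s \near s0, 0 < s < 1 /\ 0 < sg * dp s.
  near=> s; split; last by near: s; exact: (cvgr_gt _ cs).
  by apply/andP; split; near: s; case/andP: s01 => ??; [exact: lt_nbhsr|exact: lt_nbhsl].
have /nbhs_ballP[d /= d0 dP] := n0.
exists sg, (d / 2); split => //; first lra.
by move=> s sd; apply: dP; rewrite /ball/= distrC; lra.
Unshelve. all: by end_near. Qed.

(** Since [dp s0 != 0], [p] is invertible near [s0] and the curve is the graph of [q] composed with
    the inverse. In a strip too thin to meet any other part of the boundary, connectedness settles
    each side of the graph, and the normal tells which side is inside. *)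
Lemma graph_chart_exists (Om : set (R * R)) (b : bool)
    (p q dp dq n1 n2 : R -> R) (s0 : R) :
  open Om -> (forall s : R, is_derive s 1 p (dp s)) ->
  (forall s : R, is_derive s 1 q (dq s)) -> continuous dp -> continuous dq ->
  0 < s0 < 1 -> dp s0 != 0 ->
  (forall s : R, 0 < s < 1 -> boundary Om (coord b (p s) (q s))) ->
  (forall d : R, 0 < d -> exists2 r : R, 0 < r &
    forall z, ball (coord b (p s0) (q s0)) r z -> boundary Om z ->
    exists2 s, `|s - s0| < d & z = coord b (p s) (q s)) ->
  (forall s : R, 0 < s < 1 ->
    [/\ n1 s ^+ 2 + n2 s ^+ 2 = 1, n1 s * dp s + n2 s * dq s = 0 &
    \forall e \near 0^'+, Om (coord b (p s - e * n1 s) (q s - e * n2 s)) /\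
       ~ closure Om (coord b (p s + e * n1 s) (q s + e * n2 s))]) ->
  exists (sa sb a c kap sg sd : R) (h dh : R -> R),
  graph_chart Om b p q dp dq n1 n2 s0 sa sb a c kap sg sd h dh.
Proof.
move=> oOm pd qd cdp cdq s01 dp0 onb isol nrm.
have [sg [d [sg1 d0 dP]]] := constant_sign_interval cdp s01 dp0.
have mono s s' : `|s - s0| <= d -> `|s' - s0| <= d -> s < s' -> sg * p s < sg * p s'.
  rewrite !ler_norml => /andP[s1 s2] /andP[s3 s4] ss.
  have [e eb E] : exists2 e, (s <= e <= s') || (s' <= e <= s) & p s' - p s = dp e * (s' - s).
    by apply: MVT_between => x _; exact: pd.
  rewrite -subr_gt0 -mulrBr E mulrA mulr_gt0 ?subr_gt0//.
  apply: (dP _ _).2; rewrite ler_norml.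
  by move/orP : eb => [|] /andP[e1 e2]; apply/andP; split; lra.
have inj s s' : `|s - s0| <= d -> `|s' - s0| <= d -> p s = p s' -> s = s'.
  move=> sd sd' pp; have [ss|ss|//] := ltgtP s s'.
  - by have := mono _ _ sd sd' ss; rewrite pp ltxx.
  - by have := mono _ _ sd' sd ss; rewrite pp ltxx.
(* The local inverse of [p]; [s0] is a default value off the range of [p]. *)
pose g x := xget s0 [set s | `|s - s0| <= d /\ p s = x].
have gK s : `|s - s0| <= d -> g (p s) = s.
  move=> sd; rewrite /g; case: xgetP => [s' _ [sd' ps']|/(_ s)/= []//].
  exact: inj.
have cp : continuous p by move=> s; exact: is_derive1_continuous (pd s).
have cq : continuous q by move=> s; exact: is_derive1_continuous (qd s).
have gd s : `|s - s0| < d -> is_derive (p s) 1 g (dp s)^-1.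
  move=> sd; apply: is_derive_inverse.
  - near=> t; apply: gK; apply/ltW; near: t.
    have c : {for s, continuous (fun t => `|t - s0|)}.
      by apply: continuous_comp; [apply: continuousB; [exact: cvg_id|exact: cvg_cst]|exact: norm_continuous].
    exact: (cvgr_lt _ c).
  - by near=> t; exact: cp.
  - have [_ dps] := dP _ (ltW sd); apply: contraTneq dps => ->.
    by rewrite mulr0 ltxx.
pose h := q \o g; pose dh x := dq (g x) / dp (g x).
have hd s : `|s - s0| < d -> is_derive (p s) 1 h (dh (p s)).
  move=> sd; have ds := gd _ sd; have dq' := qd (g (p s)).
  rewrite /dh gK ?ltW// in dq' *.
  apply: is_derive_eq; rewrite /= gK ?ltW//.
have cdh s : `|s - s0| < d -> {for p s, continuous dh}.
  move=> sd; have cg := is_derive1_continuous (gd _ sd).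
  have [_ dps] := dP _ (ltW sd).
  apply: continuousM; first by apply: continuous_comp; [exact: cg|exact: cdq].
  apply: continuousV; last by apply: continuous_comp; [exact: cg|exact: cdp].
  by rewrite /= gK ?ltW//; apply: contraTneq dps => ->; rewrite mulr0 ltxx.
have [r0 r00 r0P] := isol _ d0.
(* In the ball of radius [r0] the boundary is only the curve near [s0]. The graph may drift by [kap]
   and the strip adds [kap] more, so half of [r0] keeps the strip inside that ball. *)
pose kap := r0 / 2; have kap0 : 0 < kap by rewrite /kap; lra.
have [e [e0 ed eP]] : exists e, [/\ 0 < e, e < d &
    forall s, `|s - s0| <= e -> `|p s0 - p s| < kap /\ `|q s0 - q s| < kap].
  have n0 : \forall s \near s0, `|p s0 - p s| < kap /\ `|q s0 - q s| < kap.
    by near=> s; split; near: s; [have := cp s0|have := cq s0]; move=> /cvgrPdist_lt; exact.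
  have /nbhs_ballP[e' /= e'0 e'P] := n0.
  have [m0 m1 m2] : [/\ 0 < Num.min d e', Num.min d e' <= d & Num.min d e' <= e'].
    by rewrite lt_min d0 e'0 !ge_min !lexx orbT.
  exists (Num.min d e' / 2); split; [lra|lra|move=> s se].
  by apply: e'P; rewrite /ball/= distrC; lra.
pose sa := s0 - e; pose sb := s0 + e.
have sI s : sa <= s <= sb -> `|s - s0| <= e.
  by rewrite ler_norml /sa /sb => /andP[? ?]; apply/andP; split; lra.
have sId s : sa <= s <= sb -> `|s - s0| < d by move=> /sI; lra.
have sabs : sa < sb by rewrite /sa /sb; lra.
have aI : sa <= sa <= sb by lra.
have bI : sa <= sb <= sb by lra.
have mono' s s' : sa <= s <= sb -> sa <= s' <= sb -> s < s' -> sg * p s < sg * p s'.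
  by move=> /sId/ltW sI1 /sId/ltW sI2; exact: mono.
have [a [c acP]] : exists a c, (sg = 1 /\ p sa = a /\ p sb = c) \/
    (sg = -1 /\ p sa = c /\ p sb = a).
  case: (sg1) => ->; first by exists (p sa), (p sb); left.
  by exists (p sb), (p sa); right.
have ac : a < c.
  have := mono' _ _ aI bI sabs.
  by case: acP => -[-> [-> ->]]; clear; lra.
have pI s : sa <= s <= sb -> a <= p s <= c.
  move=> sI1; have h1 : sg * p sa <= sg * p s.
    have [->//|sas] := eqVneq sa s; apply/ltW/mono' => //.
    by rewrite lt_neqAle sas; lra.
  have h2 : sg * p s <= sg * p sb.
    have [->//|sas] := eqVneq s sb; apply/ltW/mono' => //.
    by rewrite lt_neqAle sas; lra.
  by case: acP h1 h2 => -[-> [-> ->]]; clear; lra.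
have pIo s : sa < s < sb -> a < p s < c.
  move=> sI1; have h1 : sg * p sa < sg * p s by apply: mono' => //; move: sI1; clear; lra.
  have h2 : sg * p s < sg * p sb by apply: mono' => //; move: sI1; clear; lra.
  by case: acP h1 h2 => -[-> [-> ->]]; clear; lra.
have ivt x : a <= x <= c -> exists2 s, sa <= s <= sb & p s = x.
  move=> xac; have [|||s] := @IVT _ p sa sb x.
  - exact: ltW.
  - exact: continuous_subspaceT.
  - case: acP => -[_ [-> ->]]; rewrite ge_min le_max; move: xac; clear; lra.
  - by rewrite in_itv/= => sI1 <-; exists s.
have ivto x : a < x < c -> exists2 s, sa < s < sb & p s = x.
  move=> xac; have [|s sI1 ps] := ivt x; first lra.
  exists s => //; have [sas sbs] : sa != s /\ s != sb.
    by split; apply/eqP => E; move: ps; [rewrite -E|rewrite E];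
      move: xac; case: acP => -[_ [<- <-]]; clear; lra.
  by rewrite !lt_neqAle sas sbs; lra.
have hp s : sa <= s <= sb -> h (p s) = q s.
  by move=> /sId/ltW sI1; rewrite /h/= gK.
have box x t : a <= x <= c -> `|t| < kap ->
    ball (coord b (p s0) (q s0)) r0 (coord b x (h x + t)).
  move=> /ivt[s sI1 <-] tk; apply/coord_ball.
  have [ps qs] := eP _ (sI _ sI1); rewrite hp//.
  split; first by rewrite (lt_trans ps)// /kap; lra.
  have -> : q s0 - (q s + t) = (q s0 - q s) - t by ring.
  by apply: (le_lt_trans (ler_normB _ _)); rewrite /kap in qs tk; lra.
have nbd x t : a <= x <= c -> `|t| < kap ->
    boundary Om (coord b x (h x + t)) -> t = 0.
  move=> xac tk /(r0P _ (box _ _ xac tk))[s sd /coord_inj[xp]].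
  by rewrite xp /h/= gK ?(ltW sd)//; lra.
have ch x : a <= x <= c -> {for x, continuous h}.
  by move=> /ivt[s /sId sd <-]; exact: is_derive1_continuous (hd _ sd).
(* Membership is carried first along the translated graph at height [ep * t1] from [x1] to [x2],
   then vertically from [t1] to [t2]. Neither path meets the boundary, by [nbd]. *)
have side ep x1 x2 t1 t2 : ep = 1 \/ ep = -1 -> a <= x1 <= c -> a <= x2 <= c ->
    0 < t1 < kap -> 0 < t2 < kap ->
    Om (coord b x1 (h x1 + ep * t1)) -> Om (coord b x2 (h x2 + ep * t2)).
  move=> ep1 x1I x2I t1I t2I O1.
  have ept t : 0 < t < kap -> `|ep * t| < kap /\ ep * t != 0.
    move=> /andP[t0 tk]; split.
      by rewrite normrM (gtr0_norm t0); case: ep1 => ->; rewrite ?normrN normr1 mul1r.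
    by rewrite mulf_neq0 ?(gt_eqF t0)//; case: ep1 => ->; rewrite ?oppr_eq0 oner_eq0.
  have O2 : Om (coord b x2 (h x2 + ep * t1)).
    suff : (fun x => coord b x (h x + ep * t1)) @` `[a, c] `<=` Om.
      by apply; exists x2; rewrite //= in_itv.
    apply: open_dichotomy => //.
    - apply: connected_continuous_connected.
        by apply/connected_intervalP; exact: interval_is_interval.
      apply: continuous_in_subspaceT => x; rewrite inE/= in_itv/= => xI.
      apply: (@coord_continuous _ b _ id (fun x => h x + ep * t1)); first exact: cvg_id.
      apply: continuousD; last exact: cvg_cst.
      exact: ch.
    - move=> _ [x /=] xI <- /nbd E; move: xI; rewrite in_itv/= => xI.
      have [e1 e2] := ept _ t1I; have := E _ e1.
      by move=> /(_ xI)/eqP; rewrite (negbTE e2).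
    - by exists (coord b x1 (h x1 + ep * t1)) => //; exists x1; rewrite //= in_itv.
  suff : (fun t => coord b x2 (h x2 + ep * t)) @` `]0, kap[ `<=` Om.
    by apply; exists t2; rewrite //= in_itv.
  apply: open_dichotomy => //.
  - apply: connected_continuous_connected.
      by apply/connected_intervalP; exact: interval_is_interval.
    apply: continuous_subspaceT => t.
    apply: (@coord_continuous _ b _ (cst x2) (fun t => h x2 + ep * t)); first exact: cvg_cst.
    apply: continuousD; first exact: cvg_cst.
    by apply: continuousM; [exact: cvg_cst|exact: cvg_id].
  - move=> _ [t /=] tI <- /nbd E; move: tI; rewrite in_itv/= => tI.
    have [e1 e2] := ept _ tI; have := E _ e1.
    by move=> /(_ x2I)/eqP; rewrite (negbTE e2).
  - by exists (coord b x2 (h x2 + ep * t1)) => //; exists t1; rewrite //= in_itv.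
have nOb z : boundary Om z -> ~ Om z.
  by move=> [_ nO] Oz; apply: nO; move: oOm; rewrite openE; exact.
have graph_bd x : a <= x <= c -> boundary Om (coord b x (h x)).
  move=> /ivt[s sI1 <-]; rewrite hp//; apply: onb.
  by have [] := dP s _; last by []; apply/ltW/sId.
(* Used with [m = -1] and [m = 1]: points slightly off the curve along the normal stay in the
   strip. *)
have nbox (m : R) s : sa < s < sb -> \forall e \near 0^'+,
    a < p s + m * e * n1 s < c /\
    `|q s + m * e * n2 s - h (p s + m * e * n1 s)| < kap.
  move=> sI1; apply: cvg_within.
  have sI2 : sa <= s <= sb by lra.
  have xs := pIo _ sI1.
  have c1 n : {for (0 : R), continuous (fun e => m * e * n)}.
    apply: continuousM; last exact: cvg_cst.
    by apply: continuousM; [exact: cvg_cst|exact: cvg_id].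
  have c2 : {for (0 : R), continuous (fun e => p s + m * e * n1 s)}.
    by apply: continuousD; [exact: cvg_cst|exact: c1].
  have c3 : {for (0 : R), continuous (fun e => h (p s + m * e * n1 s))}.
    apply: (@continuous_comp _ _ _ _ h); first exact: c2.
    by rewrite mulr0 mul0r addr0; apply: ch; lra.
  have c4 : {for (0 : R), continuous
      (fun e => `|q s + m * e * n2 s - h (p s + m * e * n1 s)|)}.
    apply: cvg_norm; apply: (@continuousB _ _ _ (fun e => q s + m * e * n2 s)); last exact: c3.
    by apply: continuousD; [exact: cvg_cst|exact: c1].
  near=> e'; split.
  - apply/andP; split; near: e'.
    + by apply: (cvgr_gt _ c2); rewrite mulr0 mul0r addr0; lra.
    + by apply: (cvgr_lt _ c2); rewrite mulr0 mul0r addr0; lra.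
  - near: e'; apply: (cvgr_lt _ c4).
    by rewrite !mulr0 !mul0r !addr0 hp// subrr normr0.
have s0I : sa < s0 < sb by rewrite /sa /sb; lra.
have nrm' s : sa < s < sb -> \forall e \near 0^'+,
   [/\ a <= p s - e * n1 s <= c, a <= p s + e * n1 s <= c,
    `|q s - e * n2 s - h (p s - e * n1 s)| < kap,
    `|q s + e * n2 s - h (p s + e * n1 s)| < kap &
    Om (coord b (p s - e * n1 s) (q s - e * n2 s)) /\
     ~ closure Om (coord b (p s + e * n1 s) (q s + e * n2 s))].
  move=> sI1; have sI2 : sa <= s <= sb by lra.
  have [_ _ nn] := nrm s (dP s (ltW (sId _ sI2))).1.
  apply: filterS3 (nbox (-1) _ sI1) (nbox 1 _ sI1) nn => e'.
  rewrite !mulN1r !mul1r !mulNr => -[/andP[? ?] ?] [/andP[? ?] ?] ?.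
  by split=> //; apply/andP; split; apply: ltW.
(* The normal at [s0] yields a point inside and a point outside, at vertical offsets [t1] and [t2]
   from the graph. Neither offset is zero, and [t2] has the sign opposite to [t1], for otherwise
   [side] would put the outer point in [Om]. *)
have [ep [ep1 sidein sideout]] : exists ep, [/\ ep = 1 \/ ep = -1,
    (forall x t, a <= x <= c -> 0 < t < kap -> Om (coord b x (h x + ep * t))) &
    (forall x t, a <= x <= c -> 0 < t < kap -> ~ Om (coord b x (h x - ep * t)))].
  have [e' [xm xp tm tp [Om1 Op]]] := filter_ex (nrm' _ s0I).
  set x1 := p s0 - _ in xm tm Om1; set x2 := p s0 + _ in xp tp Op.
  pose t1 := q s0 - e' * n2 s0 - h x1; pose t2 := q s0 + e' * n2 s0 - h x2.
  have y1 : q s0 - e' * n2 s0 = h x1 + t1 by rewrite /t1; ring.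
  have y2 : q s0 + e' * n2 s0 = h x2 + t2 by rewrite /t2; ring.
  rewrite y1 in Om1; rewrite y2 in Op.
  have t10 : t1 != 0.
    apply/eqP => t10; move: Om1; rewrite t10 addr0; apply: nOb.
    by apply: graph_bd.
  have t20 : t2 != 0.
    apply/eqP => t20; apply: Op; rewrite t20 addr0.
    by have [] : boundary Om (coord b x2 (h x2)) by apply: graph_bd.
  pose ep := Num.sg t1.
  have ep1 : ep = 1 \/ ep = -1.
    rewrite /ep; have [t11|t11|t11] := ltgtP t1 0.
    - by right; rewrite ltr0_sg.
    - by left; rewrite gtr0_sg.
    - by rewrite t11 eqxx in t10.
  have et1 : 0 < `|t1| < kap by rewrite normr_gt0 t10 tm.
  have et2 : 0 < `|t2| < kap by rewrite normr_gt0 t20 tp.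
  have in1 x t : a <= x <= c -> 0 < t < kap -> Om (coord b x (h x + ep * t)).
    by move=> xI tI; apply: (side _ x1 _ `|t1|) => //; rewrite -numEsg.
  have ept2 : t2 = - ep * `|t2|.
    have [ee|//] : t2 = ep * `|t2| \/ t2 = - ep * `|t2|.
      have [_|_] := ler0P t2; case: ep1 => ->.
      - by right; ring.
      - by left; ring.
      - by left; ring.
      - by right; ring.
    by exfalso; apply: Op; rewrite ee; apply/subset_closure/in1.
  exists ep; split => // x t xI tI Oxt; apply: Op; apply: subset_closure; rewrite ept2.
  apply: (side (- ep) x x2 t `|t2|) => //; last by rewrite mulNr.
  by case: ep1 => ->; rewrite ?opprK; [right|left].
(* The domain is where [ep * t > 0], while a chart asks for [sd * t < 0]; hence [sd = - ep]. *)
exists sa, sb, a, c, kap, sg, (- ep), h, dh.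
have sided x t : a <= x <= c -> `|t| < kap -> (Om (coord b x (h x + t)) <-> - ep * t < 0).
  move=> xI tk; have [t0|t0|t0] := ltgtP (ep * t) 0.
  - split => [Ox|]; last by move: t0; clear; lra.
    exfalso; apply: (sideout x `|t| xI); last first.
      suff <- : t = - (ep * `|t|) by [].
      by move: t0; case: ep1 => ->; clear => ?; [rewrite ltr0_norm|rewrite gtr0_norm]; lra.
    by rewrite tk andbT normr_gt0; apply: contraTneq t0 => ->; rewrite mulr0 ltxx.
  - split => [Ox|_]; first by move: t0; clear; lra.
    have -> : t = ep * `|t|.
      by move: t0; case: ep1 => ->; clear => ?; [rewrite gtr0_norm|rewrite ltr0_norm]; lra.
    apply: sidein => //.
    by rewrite tk andbT normr_gt0; apply: contraTneq t0 => ->; rewrite mulr0 ltxx.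
  - have -> : t = 0 by case: ep1 t0 => ->; clear; lra.
    rewrite addr0 mulr0 ltxx; split => // Ox; exfalso; apply: nOb Ox.
    by apply: graph_bd.
have normal s : sa < s < sb ->
    n1 s * Num.sqrt (dp s ^+ 2 + dq s ^+ 2) = - (sg * - ep) * dq s /\
    n2 s * Num.sqrt (dp s ^+ 2 + dq s ^+ 2) = (sg * - ep) * dp s.
  move=> sI1; have sI2 : sa <= s <= sb by lra.
  have sd := sId _ sI2; have [s01' dps] := dP _ (ltW sd).
  have [n12 nt _] := nrm _ s01'.
  (* Points reached against the normal are inside, which fixes the sign of their offset from the
     graph and so selects the outward one of the two unit normals. *)
  have l0 : - ep * (- n2 s + n1 s * dh (p s)) <= 0.
    apply: graph_side_normal (hd _ sd) _.
    apply: filterS (nrm' _ sI1) => e' [xm _ tm _ [Om1 _]].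
    rewrite hp//; apply/ltW/(sided _ _ xm tm).
    by congr (Om (coord b _ _)): Om1; ring.
  rewrite /dh gK ?(ltW sd)// in l0.
  apply: normal_components => //.
  by case: ep1 => ->; rewrite ?opprK; [right|left].
split => //.
- have [/andP[sa0 _] _] := dP _ (ltW (sId _ aI)).
  have [/andP[_ sb1] _] := dP _ (ltW (sId _ bI)).
  by split=> //; rewrite /sa /sb; move: e0; clear; lra.
- by case: ep1 => ->; rewrite ?opprK; [right|left].
- by move=> s /sId/ltW/dP[].
- move=> s sI1; split; [exact: pI|exact: hp|].
  by rewrite /dh gK//; exact/ltW/sId.
- move=> x /ivt[s sI1 <-]; split; [apply: hd|apply: cdh]; exact: sId.
Unshelve. all: by end_near. Qed.

End graph_chart_existence.

(** * Change of variable along a chart *)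

Section chart_integrals.
Context {R : realType}.
Notation mu := (@lebesgue_measure R).

(** [sg * dp] is [|dp|]: for [sg = -1] the parameter runs backwards, and the sign compensates for
    the exchanged end points. *)
Lemma Rintegral_monotone_change (p dp G : R -> R) (sa sb a c sg : R) :
  sa < sb -> a < c -> (forall s : R, is_derive s 1 p (dp s)) -> continuous dp ->
  (forall s, sa <= s <= sb -> 0 < sg * dp s) ->
  (sg = 1 /\ p sa = a /\ p sb = c) \/ (sg = -1 /\ p sa = c /\ p sb = a) ->
  {within `[a, c], continuous G} ->
  (forall s, sa <= s <= sb -> a <= p s <= c) ->
  \int[mu]_(x in `]a, c[) G x = \int[mu]_(s in `]sa, sb[) (sg * (G (p s) * dp s)).
Proof.
move=> sab ac pd cdp sgp acP cG pI.
have cp : continuous p by move=> s; exact: is_derive1_continuous (pd s).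
have pE : derive1 p = dp by apply/funext => s; rewrite derive1E derive_val.
have cGp : {within `[sa, sb], continuous (fun s => G (p s) * dp s)}.
  have c1 : {within `[sa, sb], continuous (G \o p)}.
    apply: (within_continuous_comp (B := `[a, c]) _ _ cG).
      exact: continuous_subspaceT.
    by move=> s; rewrite /= !in_itv/=; exact: pI.
  have c2 : {within `[sa, sb], continuous dp} by exact: continuous_subspaceT.
  by move=> s; exact: (continuousM (c1 s) (c2 s)).
have mono (s s' : R) : s \in `[sa, sb] -> s' \in `[sa, sb] -> s < s' ->
    sg * p s < sg * p s'.
  rewrite !in_itv/= => sI sI' ss.
  have [e eb E] : exists2 e, (s <= e <= s') || (s' <= e <= s) & p s' - p s = dp e * (s' - s).
    by apply: MVT_between => x _; exact: pd.
  rewrite -subr_gt0 -mulrBr E mulrA mulr_gt0 ?subr_gt0//.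
  by apply: sgp; move/orP : eb => [|] /andP[e1 e2]; apply/andP; split; lra.
have cGps : {within `[sa, sb], continuous (fun s => sg * (G (p s) * dp s))}.
  have c0 : {within `[sa, sb], continuous (cst sg)}.
    exact/continuous_subspaceT/cst_continuous.
  by move=> s; exact: (continuousM (c0 s) (cGp s)).
rewrite !Rintegral_oo_cc//.
have po : derivable_oo_LRcontinuous p sa sb.
  split => [x _||]; first by case: (pd x).
  - exact/cvg_at_right_filter/cp.
  - exact/cvg_at_left_filter/cp.
have lr : cvg (derive1 p x @[x --> sa^'+]) /\ cvg (derive1 p x @[x --> sb^'-]).
  rewrite pE; split.
  - by apply/cvg_ex; exists (dp sa); exact/cvg_at_right_filter/cdp.
  - by apply/cvg_ex; exists (dp sb); exact/cvg_at_left_filter/cdp.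
case: acP => -[sgE [pa pb]]; rewrite sgE in mono *.
- rewrite /Rintegral -pa -pb (@integration_by_substitution_increasing _ p)//.
  + by congr fine; apply: eq_integral => x _; rewrite pE mul1r.
  + exact: ltW.
  + by move=> x y xI yI xy; have := mono _ _ xI yI xy; rewrite !mul1r.
  + by rewrite pE => x _; exact: cdp.
  + by case: lr.
  + by case: lr.
  + by rewrite pa pb.
- rewrite /Rintegral -pa -pb (@integration_by_substitution_decreasing _ p)//.
  + by congr fine; apply: eq_integral => x _; rewrite pE; congr EFin; rewrite /= mulrN mulN1r.
  + exact: ltW.
  + by move=> x y xI yI xy; have := mono _ _ yI xI xy; lra.
  + by rewrite pE => x _; exact: cdp.
  + by case: lr.
  + by case: lr.
  + by rewrite pa pb.
Qed.

End chart_integrals.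

(** * Area integrals over a slab along a graph *)

Section slab_area.
Context {R : realType}.
Notation mu := (@lebesgue_measure R).
Variables (Om : set (R * R)) (b : bool) (a c t0 t1 : R) (h dh : R -> R).
Variables (f fX fY : R * R -> R).
Hypotheses (oOm : open Om) (bOm : bounded_set Om).
Hypotheses (ac : a < c) (tt : t0 < t1).
Hypotheses (ch : {within `[a, c], continuous h}).
Hypotheses (cdh : {within `[a, c], continuous dh}).
Hypothesis hd : forall x, a < x < c -> is_derive x 1 h (dh x).
Hypothesis fX1 : C1on Om (coord b 1 0) f fX.
Hypothesis fY1 : C1on Om (coord b 0 1) f fY.
Hypothesis inside : forall x y, a < x < c -> h x + t0 < y < h x + t1 ->
  Om (coord b x y).
Hypothesis inside_closure : forall x y, a <= x <= c -> h x + t0 <= y <= h x + t1 ->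
  closure Om (coord b x y).
Hypothesis vanish : forall x y, Om (coord b x y) ->
  ~ (a < x < c /\ h x + t0 < y < h x + t1) ->
  fX (coord b x y) = 0 /\ fY (coord b x y) = 0.

Let K : set (R * R) :=
  [set z | a <= z.1 <= c /\ h z.1 + t0 <= z.2 <= h z.1 + t1].

Let curried_continuous (F : R * R -> R) : {within closure Om, continuous F} ->
  {within K, continuous (fun z => F (coord b z.1 z.2))}.
Proof.
move=> cF; apply: (within_continuous_comp (S := fun z => coord b z.1 z.2) _ _ cF).
  by apply: continuous_subspaceT => z;
    apply: (@coord_continuous _ b _ fst snd); [exact: cvg_fst|exact: cvg_snd].
by move=> z [? ?]; exact: inside_closure.
Qed.

(** The extension of [F] by zero from [Om] agrees with that from the slab: the open slab lies in
    [Om], and off the slab [F] vanishes. *)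
Let area_slices (F : R * R -> R) : {within closure Om, continuous F} ->
  (forall x y, Om (coord b x y) -> ~ (a < x < c /\ h x + t0 < y < h x + t1) ->
    F (coord b x y) = 0) ->
  area_integral Om F =
  \int[mu]_(x in `]a, c[) \int[mu]_(y in `]h x + t0, h x + t1[) F (coord b x y).
Proof.
move=> cF F0.
have kOm := bounded_closure_compact bOm.
have [M [_ hM]] := within_continuous_bounded kOm cF.
have [B _ hB] := bounded_set2P bOm.
have mOm := open2_measurable oOm.
have mF : measurable_fun (Om : set (measurableTypeR R * measurableTypeR R)) F.
  apply: (measurable_funS _ (@subset_closure _ Om)).
    by apply: closed2_measurable; exact: closed_closure.
  by apply: within_continuous2_measurable => //; exact: closed_closure.
rewrite (area_iterated b mOm mF hB (fun z zO => hM z (subset_closure zO))).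
rewrite [RHS]Rintegral_mkcond; apply: eq_Rintegral => x _.
rewrite [RHS]patchE; case: ifPn => [|].
- rewrite inE/= in_itv/= => xI; rewrite [RHS]Rintegral_mkcond.
  apply: eq_Rintegral => y _; rewrite !patchE.
  have [yI|yI] := boolP (y \in (`]h x + t0, h x + t1[%classic : set R)).
    rewrite mem_set//; apply: inside => //.
    by move: yI; rewrite inE/= in_itv.
  case: ifPn => //; rewrite inE => Oxy; apply: F0 => // -[_ yI'].
  by move: yI; rewrite notin_setE/= in_itv/= yI'.
- rewrite notin_setE/= in_itv/= => xI; rewrite -[RHS](Rintegral_set0 mu (fun=> 0)).
  rewrite [RHS]Rintegral_mkcond; apply: eq_Rintegral => y _; rewrite !patchE in_set0.
  case: ifPn => //; rewrite inE => Oxy; apply: F0 => // -[xI' _].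
  by move: xI; rewrite xI'.
Qed.

Let dX x y : a < x < c -> h x + t0 < y < h x + t1 ->
  is_derive x 1 (fun x => f (coord b x y)) (fX (coord b x y)).
Proof.
move=> xI yI; have [_ _ /(_ _ (inside xI yI))] := fX1.
apply: is_derive_line => r; congr f.
by rewrite /coord; case: b; congr pair => /=; rewrite ?scaler0 ?add0r//; congr (_ + _); exact/esym/mulr1.
Qed.

Let dY x y : a < x < c -> h x + t0 < y < h x + t1 ->
  is_derive y 1 (fun y => f (coord b x y)) (fY (coord b x y)).
Proof.
move=> xI yI; have [_ _ /(_ _ (inside xI yI))] := fY1.
apply: is_derive_line => r; congr f.
by rewrite /coord; case: b; congr pair => /=; rewrite ?scaler0 ?add0r//; congr (_ + _); exact/esym/mulr1.
Qed.

Let cf : {within closure Om, continuous f}. Proof. by case: fX1. Qed.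
Let cfX : {within closure Om, continuous fX}. Proof. by case: fX1. Qed.
Let cfY : {within closure Om, continuous fY}. Proof. by case: fY1. Qed.

Lemma slab_area_y : area_integral Om fY =
  \int[mu]_(x in `]a, c[) (f (coord b x (h x + t1)) - f (coord b x (h x + t0))).
Proof.
rewrite area_slices//; last by move=> x y Oxy /(vanish Oxy)[].
apply: eq_Rintegral => x; rewrite inE/= in_itv/= => xI.
by apply: (@curved_rect_y _ a c t0 t1 h (fun x y => f (coord b x y))
  (fun x y => fY (coord b x y))) => //; exact: curried_continuous.
Qed.

Lemma slab_area_x :
  (forall t, t0 < t < t1 ->
    f (coord b a (h a + t)) = 0 /\ f (coord b c (h c + t)) = 0) ->
  area_integral Om fX =
  - \int[mu]_(x in `]a, c[)
      (dh x * (f (coord b x (h x + t1)) - f (coord b x (h x + t0)))).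
Proof.
move=> f0; rewrite area_slices//; last by move=> x y Oxy /(vanish Oxy)[].
by apply: (@curved_rect_x _ a c t0 t1 h dh (fun x y => f (coord b x y))
  (fun x y => fX (coord b x y)) (fun x y => fY (coord b x y))) => //;
  exact: curried_continuous.
Qed.

End slab_area.

(** * The area side in a chart *)

Section chart_formula.
Context {R : realType}.
Notation mu := (@lebesgue_measure R).

(** [prj b] is the coordinate along the axis of the chart and [prj (~~ b)] the one across it;
    together they invert [coord b]. *)
Definition prj (b : bool) (z : R * R) : R := if b then z.2 else z.1.

Lemma prj_coord b z : coord b (prj b z) (prj (~~ b) z) = z.
Proof. by case: b z => -[]. Qed.


Lemma enorm_prj b z : enorm z = Num.sqrt (prj b z ^+ 2 + prj (~~ b) z ^+ 2).
Proof.
rewrite /enorm /dot big_ord_recl big_ord1 /co/= -!expr2.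
by case: b => //=; rewrite addrC.
Qed.

Section area.
Variables (Om U : set (R * R)) (b : bool).
Variables (p q dp dq n1 n2 : R -> R) (s0 sa sb a c kap sg sd : R) (h dh : R -> R).
Variables (f fX fY : R * R -> R).
Hypotheses (oOm : open Om) (bOm : bounded_set Om).
Hypothesis chart : graph_chart Om b p q dp dq n1 n2 s0 sa sb a c kap sg sd h dh.
Hypothesis fX1 : C1on Om (coord b 1 0) f fX.
Hypothesis fY1 : C1on Om (coord b 0 1) f fY.
Hypothesis Ubox : forall x y, U (coord b x y) -> a < x < c /\ `|y - h x| < kap / 2.
Hypothesis vanish : forall z, closure Om z -> ~ U z ->
  [/\ f z = 0, fX z = 0 & fY z = 0].

(** The half of the strip inside the domain: below the graph for [sd = 1], above it for [sd = -1].
    Its depth [kap / 2] is the width to which [Ubox] confines [U], so that the functions vanish on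
    the far edge. *)
Let t0 := if sd == 1 then - (kap / 2) else 0.
Let t1 := if sd == 1 then 0 else kap / 2.

Let sd_cases : (sd = 1 /\ t0 = - (kap / 2) /\ t1 = 0) \/
  (sd = -1 /\ t0 = 0 /\ t1 = kap / 2).
Proof.
rewrite /t0 /t1; case: (chart_sd chart) => ->; rewrite ?eqxx; first by left.
by right; rewrite -subr_eq0 -opprD oppr_eq0 -[1 + 1]/(2%:R) pnatr_eq0.
Qed.

Let k0 : 0 < kap := chart_kap chart.

Let tt : t0 < t1.
Proof. by case: sd_cases => -[_ [-> ->]]; move: k0; lra. Qed.

Let ch x : a <= x <= c -> {for x, continuous h}.
Proof. by move=> /(chart_dh chart)[/is_derive1_continuous]. Qed.

Let chw : {within `[a, c], continuous h}.
Proof. by apply: continuous_in_subspaceT => x; rewrite inE/= in_itv/=; exact: ch. Qed.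

Let cdhw : {within `[a, c], continuous dh}.
Proof.
apply: continuous_in_subspaceT => x; rewrite inE/= in_itv/=.
by move=> /(chart_dh chart)[].
Qed.

Let inside x y : a <= x <= c -> h x + t0 <= y <= h x + t1 -> y != h x ->
  Om (coord b x y).
Proof.
move=> xI yI yh; have -> : y = h x + (y - h x) by ring.
have tI : t0 <= y - h x <= t1 by lra.
have tn0 : y - h x != 0 by rewrite subr_eq0.
have tk : `|y - h x| < kap.
  by rewrite ltr_norml; move: tI; case: sd_cases => -[_ [-> ->]]; move: k0; lra.
apply/(chart_side chart xI tk).
rewrite lt_neqAle mulf_neq0//; last by case: sd_cases => -[-> _]; rewrite ?oppr_eq0 oner_eq0.
by move: tI; case: sd_cases => -[-> [-> ->]]; move: k0; lra.
Qed.

Let inside_closure x y : a <= x <= c -> h x + t0 <= y <= h x + t1 ->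
  closure Om (coord b x y).
Proof.
move=> xI yI; have [->|yh] := eqVneq y (h x); last exact/subset_closure/inside.
move=> B /nbhs_ballP[e /= e0 eB].
have [d [d0 de dk]] : exists d, [/\ 0 < d, d < e & d <= kap / 2].
  exists (Num.min (e / 2) (kap / 2)); have : 0 < Num.min (e / 2) (kap / 2).
    by rewrite lt_min; move: k0 e0; lra.
  have : Num.min (e / 2) (kap / 2) <= e / 2 by rewrite ge_min lexx.
  have : Num.min (e / 2) (kap / 2) <= kap / 2 by rewrite ge_min lexx orbT.
  by move: e0; split; lra.
(* A point of the graph is approached vertically from inside; the domain is where [sd * t < 0],
   whence the shift by [- sd * d]. *)
exists (coord b x (h x - sd * d)); split.
- apply: inside => //.
  + by case: sd_cases => -[-> [-> ->]]; move: d0 dk; lra.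
  + apply/eqP => E; have : sd * d = 0 by move: E; lra.
    by case: sd_cases => -[-> _]; move: d0; lra.
- apply: eB; apply/coord_ball; split; first by rewrite subrr normr0.
  rewrite opprB addrC subrK normrM (gtr0_norm d0).
  by case: sd_cases => -[-> _]; rewrite ?normrN normr1 mul1r.
Qed.

Let off x y : closure Om (coord b x y) -> ~ (a < x < c /\ `|y - h x| < kap / 2) ->
  [/\ f (coord b x y) = 0, fX (coord b x y) = 0 & fY (coord b x y) = 0].
Proof. by move=> cl n; apply: vanish => // /Ubox. Qed.

Let off_slab x y : Om (coord b x y) -> ~ (a < x < c /\ h x + t0 < y < h x + t1) ->
  fX (coord b x y) = 0 /\ fY (coord b x y) = 0.
Proof.
move=> Oxy n; suff [] : [/\ f (coord b x y) = 0, fX (coord b x y) = 0 & fY (coord b x y) = 0] by [].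
apply: off; first exact: subset_closure.
move=> [xI yk]; apply: n; split => //.
have yE : y = h x + (y - h x) by ring.
have : sd * (y - h x) < 0.
  have xI' : a <= x <= c by move: xI; lra.
  have tk : `|y - h x| < kap by move: yk k0; lra.
  by apply/(chart_side chart xI' tk); rewrite -yE.
move: yk; rewrite ltr_norml.
by case: sd_cases => -[-> [-> ->]]; lra.
Qed.

(** Of the two edges of the slab only the graph counts: the far edge is at vertical distance exactly
    [kap / 2], hence off [U]. *)
Let jump x : a <= x <= c ->
  f (coord b x (h x + t1)) - f (coord b x (h x + t0)) = sd * f (coord b x (h x)).
Proof.
move=> xI; case: sd_cases => -[-> [E0 E1]]; rewrite E0 E1 addr0.
- have [->] : [/\ f (coord b x (h x - kap / 2)) = 0,
    fX (coord b x (h x - kap / 2)) = 0 & fY (coord b x (h x - kap / 2)) = 0].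
    apply: off; first by apply: inside_closure => //; rewrite E0 E1; move: k0; lra.
    move=> [_]; rewrite addrAC subrr add0r normrN gtr0_norm ?ltxx//.
    by move: k0; lra.
  by rewrite subr0 mul1r.
- have [->] : [/\ f (coord b x (h x + kap / 2)) = 0,
    fX (coord b x (h x + kap / 2)) = 0 & fY (coord b x (h x + kap / 2)) = 0].
    apply: off; first by apply: inside_closure => //; rewrite E0 E1; move: k0; lra.
    move=> [_]; rewrite addrAC subrr add0r gtr0_norm ?ltxx//.
    by move: k0; lra.
  by rewrite sub0r mulN1r.
Qed.

Let insideo x y : a < x < c -> h x + t0 < y < h x + t1 -> Om (coord b x y).
Proof.
move=> xI yI; apply: inside; [by move: xI; lra|by move: yI; lra|].
by apply/eqP => yE; move: yI; rewrite yE; case: sd_cases => -[_ [-> ->]]; lra.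
Qed.

Lemma chart_graph_closure x : a <= x <= c -> closure Om (coord b x (h x)).
Proof.
by move=> xI; apply: inside_closure => //; case: sd_cases => -[_ [-> ->]]; move: k0; lra.
Qed.

Let hdo x : a < x < c -> is_derive x 1 h (dh x).
Proof. by move=> xI; apply: (chart_dh chart _).1; move: xI; lra. Qed.

Lemma chart_area_y : area_integral Om fY =
  \int[mu]_(x in `]a, c[) (sd * f (coord b x (h x))).
Proof.
rewrite (slab_area_y oOm bOm tt fX1 fY1 insideo inside_closure off_slab).
apply: eq_Rintegral => x; rewrite inE/= in_itv/= => xI; apply: jump.
by move: xI; lra.
Qed.

Lemma chart_area_x : area_integral Om fX =
  - \int[mu]_(x in `]a, c[) (dh x * (sd * f (coord b x (h x)))).
Proof.
rewrite (slab_area_x oOm bOm (chart_ac chart) tt chw cdhw hdo fX1 fY1 insideo inside_closure off_slab).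
  congr (- _); apply: eq_Rintegral => x; rewrite inE/= in_itv/= => xI; congr (_ * _).
  by apply: jump; move: xI; lra.
move=> t tI; have ac := chart_ac chart; split.
- have [] // : [/\ f (coord b a (h a + t)) = 0, fX (coord b a (h a + t)) = 0 & fY (coord b a (h a + t)) = 0].
  apply: off; first by apply: inside_closure; move: ac tI; lra.
  by move=> [/andP[]]; rewrite ltxx.
- have [] // : [/\ f (coord b c (h c + t)) = 0, fX (coord b c (h c + t)) = 0 & fY (coord b c (h c + t)) = 0].
  apply: off; first by apply: inside_closure; move: ac tI; lra.
  by move=> [/andP[_]]; rewrite ltxx.
Qed.

End area.
End chart_formula.

(** * From the chart to the line integral *)

Section chart_line.
Context {R : realType}.
Notation mu := (@lebesgue_measure R).

Lemma Rintegral_support d (T : measurableType d) (m : {measure set T -> \bar R})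
    (D D' : set T) (g g' : T -> R) :
  (forall x, D' x -> D x /\ g x = g' x) -> (forall x, D x -> ~ D' x -> g x = 0) ->
  \int[m]_(x in D) g x = \int[m]_(x in D') g' x.
Proof.
move=> DD' g0; rewrite [LHS]Rintegral_mkcond [RHS]Rintegral_mkcond.
apply: eq_Rintegral => x _; rewrite !patchE.
have [xD'|xD'] := boolP (x \in D').
  have [Dx <-] := DD' _ (set_mem xD'); by rewrite mem_set.
case: ifPn => // /set_mem xD; apply: g0 => //.
by move: xD'; rewrite notin_setE.
Qed.

Lemma Rintegral_eq0 d (T : measurableType d) (m : {measure set T -> \bar R})
    (D : set T) (g : T -> R) : (forall x, D x -> g x = 0) -> \int[m]_(x in D) g x = 0.
Proof.
move=> g0; rewrite -[RHS](Rintegral_set0 m (fun=> 0)).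
by apply: Rintegral_support => // x Dx _; exact: g0.
Qed.

Lemma line_integral_full (N : nat) (gam : 'I_N -> R -> R * R) (F : R * R -> R) :
  line_integral gam setT F =
  \sum_(k < N) \int[mu]_(s in `]0, 1[) (F (gam k s) * enorm (velocity gam k s)).
Proof.
apply: eq_bigr => k _; congr (Rintegral _ _ _).
by apply/seteqP; split => s /=; rewrite in_itv/= => // -[].
Qed.

Variables (N : nat) (gam : 'I_N -> R -> R * R) (nu : R * R -> R * R).
Variables (Om U : set (R * R)) (b : bool) (k : 'I_N).
Notation p := (fun s => prj b (gam k s)).
Notation q := (fun s => prj (~~ b) (gam k s)).
Notation dp := (fun s => prj b (velocity gam k s)).
Notation dq := (fun s => prj (~~ b) (velocity gam k s)).
Variables (s0 sa sb a c kap sg sd : R) (h dh : R -> R).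
Variables (f fX fY : R * R -> R).
Hypotheses (oOm : open Om) (bOm : bounded_set Om).
Hypothesis chart : graph_chart Om b p q dp dq
  (fun s => prj b (nu (gam k s))) (fun s => prj (~~ b) (nu (gam k s)))
  s0 sa sb a c kap sg sd h dh.
Hypothesis fX1 : C1on Om (coord b 1 0) f fX.
Hypothesis fY1 : C1on Om (coord b 0 1) f fY.
Hypothesis Ubox : forall x y, U (coord b x y) -> a < x < c /\ `|y - h x| < kap / 2.
Hypothesis vanish : forall z, closure Om z -> ~ U z ->
  [/\ f z = 0, fX z = 0 & fY z = 0].
Hypothesis pd : forall s : R, is_derive s 1 p (dp s).
Hypotheses (cdp : continuous dp) (cdq : continuous dq).
Hypothesis cgam : continuous (gam k).
Hypothesis gam_closure : forall l s, 0 <= s <= 1 -> closure Om (gam l s).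
Hypothesis Uarc : forall l s, 0 <= s <= 1 -> U (gam l s) -> l = k /\ sa < s < sb.

Let sI s : sa <= s <= sb -> 0 <= s <= 1.
Proof. by have [] := chart_s chart; lra. Qed.

(** The other arcs, and the arc [k] outside []sa, sb[], do not meet [U], so a single parameter
    interval carries the integral. *)
Let line_local (c' : bool) (w : R -> R) :
  (forall s, sa < s < sb -> prj c' (nu (gam k s)) * enorm (velocity gam k s) = w s) ->
  line_integral gam setT (fun z => f z * prj c' (nu z)) =
  \int[mu]_(s in `]sa, sb[) (f (gam k s) * w s).
Proof.
move=> wE; rewrite line_integral_full (bigD1 k)//= big1 ?addr0; last first.
  move=> l lk; apply: Rintegral_eq0 => s; rewrite /= in_itv/= => s01.
  have [->] : [/\ f (gam l s) = 0, fX (gam l s) = 0 & fY (gam l s) = 0].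
    apply: vanish; first by apply: gam_closure; lra.
    by move=> /Uarc[|lk' _]; [lra|rewrite lk' eqxx in lk].
  by rewrite !mul0r.
apply: Rintegral_support => s /=; rewrite !in_itv/=.
- move=> ss; split; last by rewrite -mulrA wE.
  by have [] := chart_s chart; move: ss; lra.
- move=> s01 ns.
  have [->] : [/\ f (gam k s) = 0, fX (gam k s) = 0 & fY (gam k s) = 0].
    apply: vanish; first by apply: gam_closure; lra.
    move=> /Uarc[|_ //]; first lra.
  by rewrite !mul0r.
Qed.

Let wE s : sa < s < sb ->
  prj b (nu (gam k s)) * enorm (velocity gam k s) = - (sg * sd) * dq s /\
  prj (~~ b) (nu (gam k s)) * enorm (velocity gam k s) = (sg * sd) * dp s.
Proof. by move=> /(chart_normal chart); rewrite (enorm_prj b). Qed.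

Let sab : sa < sb. Proof. by have [] := chart_s chart; lra. Qed.

Let fgam : {within `[sa, sb], continuous (fun s => f (gam k s))}.
Proof.
have [cf _ _] := fX1; apply: (within_continuous_comp _ _ cf).
  exact: continuous_subspaceT.
by move=> s; rewrite /= in_itv/= => /sI; exact: gam_closure.
Qed.

Let graphE s : sa <= s <= sb -> coord b (p s) (h (p s)) = gam k s.
Proof. by move=> /(chart_h chart)[_ -> _]; exact: prj_coord. Qed.

Let chw : {within `[a, c], continuous h}.
Proof.
apply: continuous_in_subspaceT => x; rewrite inE/= in_itv/=.
by move=> /(chart_dh chart)[/is_derive1_continuous].
Qed.

Let cdhw : {within `[a, c], continuous dh}.
Proof.
apply: continuous_in_subspaceT => x; rewrite inE/= in_itv/=.
by move=> /(chart_dh chart)[].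
Qed.

Let graph_continuous : {within `[a, c], continuous (fun x => f (coord b x (h x)))}.
Proof.
have [cf _ _] := fX1.
apply: (within_continuous_comp (S := fun x => coord b x (h x)) _ _ cf).
  have c1 : {within `[a, c], continuous (@id R)}.
    by apply: continuous_subspaceT => x; exact: cvg_id.
  have c2 : {within `[a, c], continuous (fun x => (h x, x))}.
    by move=> x; exact: (cvg_pair (@chw x) (c1 x)).
  have c3 : {within `[a, c], continuous (fun x => (x, h x))}.
    by move=> x; exact: (cvg_pair (c1 x) (@chw x)).
  by rewrite /coord; case: (b); [exact: c2|exact: c3].
by move=> x; rewrite /= in_itv/=; exact: (chart_graph_closure chart).
Qed.

Let cst_within (r : R) (A : set R) : {within A, continuous (cst r)}.
Proof. exact/continuous_subspaceT/cst_continuous. Qed.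

(** The substitution [x = p s] turns [sd dx] into [sg * sd * dp s ds], and [sg * sd * dp] is the
    transverse normal component times the speed. *)
Lemma chart_Green_y : area_integral Om fY =
  line_integral gam setT (fun z => f z * prj (~~ b) (nu z)).
Proof.
rewrite (chart_area_y oOm bOm chart fX1 fY1 Ubox vanish).
rewrite (@line_local _ (fun s => sg * sd * dp s)); last by move=> s /wE[].
rewrite (@Rintegral_monotone_change _ p dp _ sa sb a c sg)//.
- apply: eq_Rintegral => s; rewrite inE/= in_itv/= => ss.
  by rewrite graphE; [ring|lra].
- exact: (chart_ac chart).
- exact: (chart_dp chart).
- exact: (chart_sg chart).
- by move=> x; exact: (continuousM (@cst_within sd _ x) (@graph_continuous x)).
- by move=> s /(chart_h chart)[].
Qed.

(** As [dh (p s) = dq s / dp s], the substitution [x = p s] turns [dh dx] into [sg * dq s ds]; times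
    [- sd] this is the normal component along the axis times the speed. *)
Lemma chart_Green_x : area_integral Om fX =
  line_integral gam setT (fun z => f z * prj b (nu z)).
Proof.
rewrite (chart_area_x oOm bOm chart fX1 fY1 Ubox vanish).
rewrite (@line_local _ (fun s => - (sg * sd) * dq s)); last by move=> s /wE[].
rewrite (@Rintegral_monotone_change _ p dp _ sa sb a c sg)//.
- transitivity (- \int[mu]_(s in `]sa, sb[) (f (gam k s) * ((sg * sd) * dq s))).
    congr (- _); apply: eq_Rintegral => s; rewrite inE/= in_itv/= => ss.
    have ss' : sa <= s <= sb by lra.
    have [_ _ ->] := chart_h chart ss'.
    have dp0 : dp s != 0.
      by have := chart_dp chart ss'; apply: contraTneq => ->; rewrite mulr0 ltxx.
    by rewrite graphE//; field.
  rewrite -mulN1r -RintegralZl//; last first.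
    have cg : {within `[sa, sb], continuous (fun s => f (gam k s) * ((sg * sd) * dq s))}.
      have cdqw : {within `[sa, sb], continuous dq} by exact: continuous_subspaceT.
      by move=> s; exact: (continuousM (@fgam s) (continuousM (@cst_within (sg * sd) _ s) (cdqw s))).
    have : mu.-integrable `[sa, sb] (EFin \o (fun s => f (gam k s) * ((sg * sd) * dq s))).
      by apply: continuous_compact_integrable => //; exact: segment_compact.
    by apply: integrableS => //; apply: subset_itv_oo_cc.
  by apply: eq_Rintegral => s _; ring.
- exact: (chart_ac chart).
- exact: (chart_dp chart).
- exact: (chart_sg chart).
- by move=> x; exact: (continuousM (@cdhw x) (continuousM (@cst_within sd _ x) (@graph_continuous x))).
- by move=> s /(chart_h chart)[].
Qed.

End chart_line.





(** * The Gauss-Green formula *)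

Section domain.
Context {R : realType}.
Notation mu := (@lebesgue_measure R).
Variables (Om : set (R * R)) (N : nat) (gam : 'I_N -> R -> R * R) (nu : R * R -> R * R).
Hypotheses (hOm : bounded_domain Om) (hgam : piecewise_C1_boundary gam Om).
Hypothesis hnu : unit_outward_normal gam Om nu.

Let oOm : open Om. Proof. by case: hOm. Qed.
Let bOm : bounded_set Om. Proof. by case: hOm. Qed.

Lemma prj_continuous b : continuous (@prj R b).
Proof. by case: b => z; [exact: cvg_snd|exact: cvg_fst]. Qed.

Lemma prjB b (z w : R * R) : prj b (z - w) = prj b z - prj b w.
Proof. by case: b. Qed.

Lemma prjZ b r (z : R * R) : prj b (r *: z) = r * prj b z.
Proof. by case: b. Qed.

Lemma arc_is_derive b k (s : R) :
  is_derive s 1 (fun s => prj b (gam k s)) (prj b (velocity gam k s)).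
Proof.
have dk : derivable (gam k) s 1 by exact: arc_derivable hgam _ _.
have cv : (fun h => h^-1 *: (prj b (gam k (h *: 1 + s)) - prj b (gam k s))) @ 0^' -->
    prj b (velocity gam k s).
  rewrite (_ : (fun h => _) = prj b \o
     (fun h => h^-1 *: (gam k (h *: 1 + s) - gam k s))); last first.
    by apply/funext => h /=; rewrite prjZ prjB.
  apply: continuous_cvg; first exact: prj_continuous.
  by rewrite /velocity derive1E; exact: dk.
apply: DeriveDef; first exact: cvgP cv.
exact: cvg_lim cv.
Qed.

Lemma arc_continuous k : continuous (gam k).
Proof.
move=> s; have c b := is_derive1_continuous (arc_is_derive b k s).
have -> : gam k = (fun s => (prj false (gam k s), prj true (gam k s))).
  by apply/funext => t /=; case: (gam k t).
exact: (cvg_pair (c false) (c true)).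
Qed.

Lemma velocity_continuous b k : continuous (fun s => prj b (velocity gam k s)).
Proof.
move=> s; apply: (@continuous_comp _ _ _ (velocity gam k) (prj b)).
  exact: (arc_C1 hgam).
exact: prj_continuous.
Qed.

Lemma arc_boundary k s : 0 <= s <= 1 -> boundary Om (gam k s).
Proof. by move=> s01; rewrite (arc_cover hgam); exists k => //; exists s. Qed.

Lemma arc_closure k s : 0 <= s <= 1 -> closure Om (gam k s).
Proof. by move=> /(arc_boundary k)[]. Qed.

Lemma boundary_out z : boundary Om z -> ~ Om z.
Proof. by move=> [_ nO] Oz; apply: nO; move: oOm; rewrite openE; exact. Qed.

Lemma compact_avoid (C : set R) (g : R -> R * R) y : compact C -> continuous g ->
  (forall s, C s -> g s <> y) -> \forall r \near 0^'+, forall s, C s -> ~ ball y r (g s).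
Proof.
move=> kC cg gy.
have kgC : compact (g @` C).
  by apply: continuous_compact => //; exact: continuous_subspaceT.
have cgC : closed (g @` C).
  by apply: compact_closed => //; exact: (@norm_hausdorff _ (R * R)%type).
have : nbhs y (~` (g @` C)).
  apply: open_nbhs_nbhs; split; first exact: closed_openC.
  by move=> [s Cs gs]; exact: gy gs.
move=> /nbhs_ballP[e /= e0 eC]; near=> r => s Cs bs.
have re : r <= e by near: r; exact: nbhs_right_le.
apply: (eC (g s)); last by exists s.
by apply: le_ball bs.
Unshelve. all: by end_near. Qed.

(** There are finitely many arcs. For each, the parameters to be excluded (all of them on another
    arc, those at distance at least [d] from [s0] on the arc [k]) form a compact set, whose image
    misses [gam k s0] by [arc_simple]. *)
Lemma arc_isolated k s0 d : 0 < s0 < 1 -> 0 < d ->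
  \forall r \near 0^'+, forall l s, 0 <= s <= 1 -> ball (gam k s0) r (gam l s) ->
    l = k /\ `|s - s0| < d.
Proof.
move=> s01 d0; apply: filter_forall => l.
pose C := [set s : R | 0 <= s <= 1 /\ (l = k -> d <= `|s - s0|)].
have kC : compact C.
  apply: (subclosed_compact _ (@segment_compact R 0 1)); last first.
    by move=> s [s01' _] /=; rewrite in_itv.
  have -> : C = `[0, 1] `&` (if l == k then [set s | d <= `|s - s0|] else setT).
    apply/seteqP; split => s; rewrite /C /= in_itv/=.
    - by move=> [s1 s2]; split => //; case: eqP => // /s2.
    - by move=> [s1 s2]; split => // lk; move: s2; rewrite lk eqxx.
  apply: closedI; first exact: interval_closed.
  case: ifP => _; last exact: closedT.
  rewrite (_ : [set _ | _] = (fun s => `|s - s0|) @^-1` [set x | d <= x])//.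
  apply: closed_comp => [s _|]; last exact: closed_ge.
  apply: cvg_norm; apply: (@continuousB _ _ _ id (cst s0)).
    exact: cvg_id.
  exact: cvg_cst.
have := @compact_avoid C (gam l) (gam k s0) kC (@arc_continuous l).
have Cn s : C s -> gam l s <> gam k s0.
  move=> [s01' lk] E; have [kl ss] := arc_simple hgam s01 s01' (esym E).
  by have := lk (esym kl); rewrite ss subrr normr0; lra.
move=> /(_ Cn); apply: filterS => r h s s01' b.
have nC : ~ C s by move=> /h; exact.
have [lk|lk] := eqVneq l k; last first.
  by exfalso; apply: nC; split => // lk'; rewrite lk' eqxx in lk.
by split => //; rewrite ltNge; apply/negP => ds; apply: nC; split.
Qed.

Definition Green b (f g : R * R -> R) : Prop :=
  area_integral Om g = line_integral gam setT (fun z => f z * prj b (nu z)).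

Definition C1plane (f f0 f1 : R * R -> R) : Prop :=
  C1on Om (coord false 1 0) f f0 /\ C1on Om (coord true 1 0) f f1.

Definition null_off (U : set (R * R)) (f f0 f1 : R * R -> R) : Prop :=
  forall z, closure Om z -> ~ U z -> [/\ f z = 0, f0 z = 0 & f1 z = 0].

Definition corner (z : R * R) : Prop := exists k, z = gam k 0 \/ z = gam k 1.

(** The local form of the formula; the bumps reduce the global one to it. *)
Definition Green_in (U : set (R * R)) : Prop := forall f f0 f1,
  C1plane f f0 f1 -> null_off U f f0 f1 -> Green false f f0 /\ Green true f f1.

(** Balls of the max norm are squares, so this is a slab along a constant graph. The function
    vanishes on the four edges of the square and on the boundary, so both sides of the formula are
    zero. *)
Lemma Green_interior z : Om z -> exists2 r, 0 < r & Green_in (ball z r).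
Proof.
case: z => x y Oz; have /nbhs_ballP[e /= e0 eO] : nbhs (x, y) Om by exact: open_nbhs_nbhs.
exists (e / 2); first lra.
move=> f f0 f1 [C0 C1] nf.
have lin b : line_integral gam setT (fun z => f z * prj b (nu z)) = 0.
  rewrite line_integral_full big1// => k _; apply: Rintegral_eq0 => s.
  rewrite /= in_itv/= => s01; have [] := nf (gam k s).
  - by apply: arc_closure; lra.
  - move=> bz; apply: (@boundary_out (gam k s)); first by apply: arc_boundary; lra.
    by apply: eO; apply: le_ball bz; lra.
  - by move=> -> _ _; rewrite !mul0r.
rewrite /Green !lin.
have r0 : 0 < e / 2 by lra.
have inb (u v : R) : x - e / 2 < u < x + e / 2 -> y - e / 2 < v < y + e / 2 ->
    Om (coord false u v).
  by move=> uI vI; apply: eO; split; rewrite /ball/= ltr_norml; lra.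
have offb (u v : R) : closure Om (coord false u v) ->
    ~ (x - e / 2 < u < x + e / 2 /\ y - e / 2 < v < y + e / 2) ->
    [/\ f (coord false u v) = 0, f0 (coord false u v) = 0 & f1 (coord false u v) = 0].
  move=> cl n; apply: nf => // -[]; rewrite /ball/= !ltr_norml => bu bv.
  by apply: n; split; lra.
have inb' (u v : R) : x - e / 2 <= u <= x + e / 2 -> y - e / 2 <= v <= y + e / 2 ->
    closure Om (coord false u v).
  by move=> uI vI; apply/subset_closure/eO; split; rewrite /ball/= ltr_norml; lra.
have tt : - (e / 2) < e / 2 by lra.
have ac : x - e / 2 < x + e / 2 by lra.
have cc (A : set R) (r : R) : {within A, continuous (cst r)}.
  exact/continuous_subspaceT/cst_continuous.
have hd u : x - e / 2 < u < x + e / 2 -> is_derive u 1 (cst y) (0 : R).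
  by move=> _; exact: is_derive_cst.
have ins u v : x - e / 2 < u < x + e / 2 ->
    cst y u + - (e / 2) < v < cst y u + e / 2 -> Om (coord false u v).
  exact: inb.
have ins' u v : x - e / 2 <= u <= x + e / 2 ->
    cst y u + - (e / 2) <= v <= cst y u + e / 2 -> closure Om (coord false u v).
  exact: inb'.
have off u v : Om (coord false u v) -> ~ (x - e / 2 < u < x + e / 2 /\
    cst y u + - (e / 2) < v < cst y u + e / 2) ->
    f0 (coord false u v) = 0 /\ f1 (coord false u v) = 0.
  by move=> O n; have [] := offb _ _ (subset_closure O) n.
have fy0 u t : x - e / 2 < u < x + e / 2 -> t = e / 2 \/ t = - (e / 2) ->
    f (coord false u (y + t)) = 0.
  move=> uI tI; have [] // := offb u (y + t).
    by apply: inb'; [lra|case: tI => ->; lra].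
  by move=> [_]; case: tI => ->; rewrite ltxx ?andbF.
split.
- rewrite (slab_area_x oOm bOm ac tt (cc _ _) (cc _ (0 : R)) hd C0 C1 ins ins' off).
  + by rewrite Rintegral_eq0 ?oppr0// => u _; rewrite mul0r.
  + move=> t tI; split.
    * have [] // := offb (x - e / 2) (y + t); first by apply: inb'; lra.
      by move=> [/andP[]]; rewrite ltxx.
    * have [] // := offb (x + e / 2) (y + t); first by apply: inb'; lra.
      by move=> [/andP[_]]; rewrite ltxx.
- rewrite (slab_area_y oOm bOm tt C0 C1 ins ins' off).
  apply: Rintegral_eq0 => u; rewrite /= in_itv/= => uI.
  by rewrite !fy0 ?subrr//; [right|left].
Qed.

(** A regular arc has a nonzero velocity coordinate, which selects the axis [b]. *)
Lemma arc_chart k s : 0 < s < 1 ->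
  exists b sa sb a c kap sg sd h dh, graph_chart Om b
    (fun s => prj b (gam k s)) (fun s => prj (~~ b) (gam k s))
    (fun s => prj b (velocity gam k s)) (fun s => prj (~~ b) (velocity gam k s))
    (fun s => prj b (nu (gam k s))) (fun s => prj (~~ b) (nu (gam k s)))
    s sa sb a c kap sg sd h dh.
Proof.
move=> s01.
have [b vb] : exists b, prj b (velocity gam k s) != 0.
  have := @arc_regular _ _ _ _ hgam k s; case: (velocity gam k s) => v1 v2 v0.
  have [v10|v10] := eqVneq v1 0; last by exists false.
  exists true; apply/eqP => /= v20; have : (v1, v2) != 0 by apply: v0; lra.
  by rewrite v10 v20 => /eqP; apply.
have isol d : 0 < d -> exists2 r, 0 < r &
    forall z, ball (coord b (prj b (gam k s)) (prj (~~ b) (gam k s))) r z -> boundary Om z ->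
    exists2 t, `|t - s| < d & z = coord b (prj b (gam k t)) (prj (~~ b) (gam k t)).
  move=> d0; have [r [r0 rP]] := filter_ex (filterI (nbhs_right_gt 0) (arc_isolated k s01 d0)).
  exists r => // z; rewrite prj_coord => bz; rewrite (arc_cover hgam) => -[l _ [t t01 E]].
  have [|lk ts] := rP l t t01; first by rewrite E.
  by exists t => //; rewrite prj_coord -E lk.
have nrm t : 0 < t < 1 ->
    [/\ prj b (nu (gam k t)) ^+ 2 + prj (~~ b) (nu (gam k t)) ^+ 2 = 1,
     prj b (nu (gam k t)) * prj b (velocity gam k t) +
       prj (~~ b) (nu (gam k t)) * prj (~~ b) (velocity gam k t) = 0 &
    \forall e \near 0^'+,
      Om (coord b (prj b (gam k t) - e * prj b (nu (gam k t)))
                  (prj (~~ b) (gam k t) - e * prj (~~ b) (nu (gam k t)))) /\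
      ~ closure Om (coord b (prj b (gam k t) + e * prj b (nu (gam k t)))
                  (prj (~~ b) (gam k t) + e * prj (~~ b) (nu (gam k t))))].
  move=> t01; have [n1 n2 n3] := hnu k t01; split.
  - move: n1; rewrite (enorm_prj b) => /(congr1 (fun x => x ^+ 2)).
    by rewrite expr1n sqr_sqrtr// addr_ge0// sqr_ge0.
  - by move: n2; rewrite /dot big_ord_recl big_ord1 /co/=; case: (b) => //=; rewrite addrC.
  - apply: filterS n3 => e.
    by case: (gam k t) (nu (gam k t)) => z1 z2 [w1 w2]; case: (b).
have bd t : 0 < t < 1 -> boundary Om (coord b (prj b (gam k t)) (prj (~~ b) (gam k t))).
  by move=> t01; rewrite prj_coord; apply: arc_boundary; lra.
exists b; exact: (graph_chart_exists oOm (arc_is_derive b k) (arc_is_derive (~~ b) k)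
   (@velocity_continuous b k) (@velocity_continuous (~~ b) k) s01 vb bd isol nrm).
Qed.

(** [nu] is specified only pointwise; in a chart, [nu] times the speed is the velocity turned by a
    right angle, with a constant sign. This makes line integrands measurable. *)
Lemma arc_normal_continuous b k s : 0 < s < 1 ->
  {for s, continuous (fun s => prj b (nu (gam k s)) * enorm (velocity gam k s))}.
Proof.
move=> s01.
have [b' [sa [sb [a [c [kap [sg [sd [h [dh chart]]]]]]]]]] := arc_chart k s01.
have [_ sas ssb _] := chart_s chart.
have nI : \forall t \near s, sa < t < sb.
  by near=> t; apply/andP; split; near: t; [exact: lt_nbhsr|exact: lt_nbhsl].
have key b1 (w : R -> R) : continuous w ->
    (forall t, sa < t < sb -> prj b1 (nu (gam k t)) * enorm (velocity gam k t) = w t) ->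
    {for s, continuous (fun s => prj b1 (nu (gam k s)) * enorm (velocity gam k s))}.
  move=> cw E; rewrite /prop_for /continuous_at E; last by rewrite sas ssb.
  apply: cvg_trans (cw s); apply: near_eq_cvg; near=> t.
  by rewrite E//; near: t.
have cd b1 (r : R) : continuous (fun t => r * prj b1 (velocity gam k t)).
  by move=> t; exact: (continuousM (@cst_continuous _ _ r t) (@velocity_continuous b1 k t)).
have [->|->] : b = b' \/ b = ~~ b' by case: (b) (b') => -[]; [left|right|right|left].
- by apply: (key _ _ (@cd (~~ b') (- (sg * sd)))) => t /(chart_normal chart)[<- _]; rewrite -enorm_prj.
- by apply: (key _ _ (@cd b' (sg * sd))) => t /(chart_normal chart)[_ <-]; rewrite -enorm_prj.
Unshelve. all: by end_near. Qed.

Lemma Green_arc k s : 0 < s < 1 -> exists2 r, 0 < r & Green_in (ball (gam k s) r).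
Proof.
move=> s01.
have [b [sa [sb [a [c [kap [sg [sd [h [dh chart]]]]]]]]]] := arc_chart k s01.
have [sa0 sas ssb sb1] := chart_s chart.
have ss : sa <= s <= sb by lra.
have [d0 dP] : 0 < Num.min (s - sa) (sb - s) /\
    forall t, `|t - s| < Num.min (s - sa) (sb - s) -> sa < t < sb.
  by split => [|t]; rewrite ?lt_min ?ltr_norml; lra.
have kap0 := chart_kap chart.
have [hx _ _] := chart_h chart ss.
have [/is_derive1_continuous ch _] := chart_dh chart hx.
have x0I : a < prj b (gam k s) < c.
  by apply: (chart_p chart (s := s)); lra.
have hs : h (prj b (gam k s)) = prj (~~ b) (gam k s) by case: (chart_h chart ss).
have nh : \forall x \near prj b (gam k s),
    `|prj (~~ b) (gam k s) - h x| < kap / 4.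
  by rewrite -hs; move/cvgrPdist_lt : ch; apply; lra.
have /nbhs_ballP[e1 /= e10 e1P] := nh.
(* [r < e1] keeps the graph within [kap / 4] of the height of the centre and [r < kap / 4] does so
   for the point, which adds up to the [kap / 2] of [Ubox]. The other bounds keep the ball over []a,
   c[] and its arc points in []sa, sb[]. *)
have [r [r0 r1 r2 r3 [r4 rP]]] : exists r, [/\ 0 < r, r < e1, r < kap / 4,
    r < Num.min (prj b (gam k s) - a) (c - prj b (gam k s)) &
    True /\ forall l t, 0 <= t <= 1 -> ball (gam k s) r (gam l t) ->
    l = k /\ `|t - s| < Num.min (s - sa) (sb - s)].
  apply: (@filter_ex _ (0^'+)); near=> r; split; last 1 first.
  - by split => //; near: r; exact: (arc_isolated k s01 d0).
  - by near: r; exact: nbhs_right_gt.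
  - by near: r; exact: nbhs_right_lt.
  - by near: r; apply: nbhs_right_lt; lra.
  - near: r; apply: nbhs_right_lt; rewrite lt_min; lra.
exists r => //.
have G f fX fY : C1on Om (coord b 1 0) f fX -> C1on Om (coord b 0 1) f fY ->
    null_off (ball (gam k s) r) f fX fY -> Green b f fX /\ Green (~~ b) f fY.
  move=> CX CY nf.
  have Ubox x y : ball (gam k s) r (coord b x y) -> a < x < c /\ `|y - h x| < kap / 2.
    rewrite -{1}(prj_coord b (gam k s)) => /coord_ball[bx by_].
    have hxy : `|prj (~~ b) (gam k s) - h x| < kap / 4.
      by apply: e1P; rewrite /ball/=; lra.
    split; last first.
      have -> : y - h x = (prj (~~ b) (gam k s) - h x) - (prj (~~ b) (gam k s) - y) by ring.
      by apply: (le_lt_trans (ler_normB _ _)); lra.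
    by move: r3 bx; rewrite lt_min ltr_norml => /andP[? ?] /andP[? ?]; lra.
  have Uarc l t : 0 <= t <= 1 -> ball (gam k s) r (gam l t) -> l = k /\ sa < t < sb.
    by move=> t01 /(rP _ _ t01)[-> /dP].
  split.
  - exact: (chart_Green_x oOm bOm chart CX CY Ubox nf (arc_is_derive b k)
      (@velocity_continuous b k) (@velocity_continuous (~~ b) k) (@arc_continuous k)
      arc_closure Uarc).
  - exact: (chart_Green_y oOm bOm chart CX CY Ubox nf (arc_is_derive b k)
      (@velocity_continuous b k) arc_closure Uarc).
move=> f f0 f1 [C0 C1] nf; move: G; case: (b) => /(_ f) G.
(* For [b = true] the axes are exchanged and the two derivatives swap roles. *)
- have nf' : null_off (ball (gam k s) r) f f1 f0.
    by move=> z cz nz; have [? ? ?] := nf z cz nz.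
  by have [] := G _ _ C1 C0 nf'.
- exact: G C0 C1 nf.
Unshelve. all: by end_near. Qed.

End domain.

(** * Bump functions of class C^1 *)

Section bump.
Context {R : realType}.

(* [pos2 t = max(t, 0)^2], written with [`|t|] to be visibly of class C^1. *)
Definition pos2 (t : R) : R := ((t + `|t|) / 2) ^+ 2.
Definition dpos2 (t : R) : R := t + `|t|.

Lemma pos2_le0 t : t <= 0 -> pos2 t = 0.
Proof. by move=> t0; rewrite /pos2 ler0_norm// subrr mul0r expr0n. Qed.

Lemma dpos2_le0 t : t <= 0 -> dpos2 t = 0.
Proof. by move=> t0; rewrite /dpos2 ler0_norm// subrr. Qed.

Lemma pos2_ge0 t : 0 <= t -> pos2 t = t ^+ 2.
Proof. by move=> t0; rewrite /pos2 ger0_norm//; congr (_ ^+ 2); field. Qed.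

Lemma pos2_itv t : t <= 1 -> 0 <= pos2 t <= 1.
Proof.
move=> t1; rewrite /pos2 sqr_ge0/=; have [t0|/ltW t0] := leP t 0.
  by rewrite ler0_norm// subrr mul0r expr0n.
rewrite ger0_norm// (_ : (t + t) / 2 = t); last by field.
by rewrite expr_le1.
Qed.

Lemma dpos2_continuous : continuous dpos2.
Proof. by move=> z; apply: cvgD; [exact: cvg_id|exact: norm_continuous]. Qed.

Lemma is_derive_pos2 (t : R) : is_derive t 1 pos2 (dpos2 t).
Proof.
have [t0|t0|->] := ltgtP t 0.
- have dc : is_derive t 1 (cst (0 : R)) (0 : R) by exact: is_derive_cst.
  rewrite dpos2_le0 ?ltW//; apply: near_eq_is_derive dc.
  by near=> z; rewrite pos2_le0//; apply/ltW; near: z; exact: lt_nbhsl.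
- have -> : dpos2 t = t *: 1 + t *: 1.
    by rewrite /dpos2 gtr0_norm// /GRing.scale/= !mulr1.
  have dm : is_derive t 1 (fun z : R => z * z) (t *: 1 + t *: 1).
    exact: (is_deriveM (is_derive_id t 1) (is_derive_id t 1)).
  apply: near_eq_is_derive dm.
  by near=> z; rewrite pos2_ge0 ?expr2//; apply/ltW; near: z; exact: lt_nbhsr.
- apply/is_derive1_caratheodory; exists (fun z => dpos2 z / 2); split.
  + move=> z; rewrite !subr0 [pos2 0]pos2_le0// subr0 /pos2 /dpos2.
    have [z0|/ltW z0] := leP 0 z; first by rewrite ger0_norm//; field.
    by rewrite ler0_norm// subrr !mul0r expr0n.
  + apply: cvgM; [exact: dpos2_continuous|exact: cvg_cst].
  + by rewrite dpos2_le0// mul0r.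
Unshelve. all: by end_near. Qed.

(** [pos2 (1 - t * t)] is 0 for [|t| >= 1] and at least [9 / 16] for [|t| <= 1 / 2]. Doubling lifts
    the latter above 1, so the outer [pos2] vanishes there and [bump1] has a plateau of height 1. *)
Definition bump1 (t : R) : R := 1 - pos2 (1 - 2 * pos2 (1 - t * t)).
Definition dbump1 (t : R) : R :=
  - (dpos2 (1 - 2 * pos2 (1 - t * t)) * (- (2 * (dpos2 (1 - t * t) * - (t + t))))).

Lemma is_derive_bump1 (t : R) : is_derive t 1 bump1 (dbump1 t).
Proof.
have d1 : is_derive t 1 (fun t => 1 - t * t) (- (t + t)).
  have dt := is_deriveM (is_derive_id t 1) (is_derive_id t 1).
  apply: is_derive_eq (is_deriveB (is_derive_cst (1 : R) t 1) dt) _.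
  by rewrite /GRing.scale/= sub0r !mulr1.
have d2 : is_derive t 1 (fun t => pos2 (1 - t * t)) (dpos2 (1 - t * t) * - (t + t)).
  exact: (@is_derive1_comp _ pos2 (fun t => 1 - t * t) t _ _ (is_derive_pos2 _) d1).
have d3 : is_derive t 1 (fun t => 1 - 2 * pos2 (1 - t * t))
    (- (2 * (dpos2 (1 - t * t) * - (t + t)))).
  have dm := is_deriveM (is_derive_cst (2 : R) t 1) d2.
  apply: is_derive_eq (is_deriveB (is_derive_cst (1 : R) t 1) dm) _.
  by rewrite /GRing.scale/= sub0r; ring.
have d4 : is_derive t 1 (fun t => pos2 (1 - 2 * pos2 (1 - t * t)))
    (dpos2 (1 - 2 * pos2 (1 - t * t)) * (- (2 * (dpos2 (1 - t * t) * - (t + t))))).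
  exact: (@is_derive1_comp _ pos2 (fun t => 1 - 2 * pos2 (1 - t * t)) t _ _ (is_derive_pos2 _) d3).
apply: is_derive_eq (is_deriveB (is_derive_cst (1 : R) t 1) d4) _.
by rewrite sub0r.
Qed.

Lemma dbump1_continuous : continuous dbump1.
Proof.
have cp z : {for z, continuous pos2} := is_derive1_continuous (is_derive_pos2 z).
have c1 : continuous (fun t : R => 1 - t * t).
  by move=> z; apply: cvgB; [exact: cvg_cst|apply: cvgM; exact: cvg_id].
have c2 : continuous (fun t : R => 1 - 2 * pos2 (1 - t * t)).
  move=> z; apply: cvgB; first exact: cvg_cst.
  apply: cvgM; first exact: cvg_cst.
  exact: (continuous_comp (c1 z) (cp _)).
move=> z; apply: cvgN; apply: cvgM.
  exact: (continuous_comp (c2 z) (@dpos2_continuous _)).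
apply: cvgN; apply: cvgM; first exact: cvg_cst.
apply: cvgM; first exact: (continuous_comp (c1 z) (@dpos2_continuous _)).
by apply: cvgN; apply: cvgD; exact: cvg_id.
Qed.

Lemma bump1_itv t : 0 <= bump1 t <= 1.
Proof.
have : 1 - 2 * pos2 (1 - t * t) <= 1.
  have : 0 <= pos2 (1 - t * t) by rewrite /pos2 sqr_ge0.
  lra.
by move=> /pos2_itv; rewrite /bump1; lra.
Qed.

Lemma bump1_out t : 1 <= `|t| -> bump1 t = 0 /\ dbump1 t = 0.
Proof.
move=> t1; have tt : 1 - t * t <= 0.
  rewrite subr_le0 -expr2 -real_normK ?num_real//.
  by rewrite exprn_ege1.
rewrite /bump1 /dbump1 (pos2_le0 tt) (dpos2_le0 tt) mulr0 subr0 (@pos2_ge0 1)//.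
by split; ring.
Qed.

Lemma bump1_in t : `|t| <= 2^-1 -> bump1 t = 1 /\ dbump1 t = 0.
Proof.
move=> t1; have tt : 3 / 4 <= 1 - t * t.
  have : `|t| ^+ 2 <= 2^-1 ^+ 2 by rewrite lerXn2r// nnegrE// invr_ge0.
  by rewrite real_normK ?num_real// !expr2; lra.
have le0 : 1 - 2 * pos2 (1 - t * t) <= 0.
  by rewrite pos2_ge0; [nra|lra].
by rewrite /bump1 /dbump1 (pos2_le0 le0) (dpos2_le0 le0) subr0 mul0r oppr0.
Qed.

Lemma dbump1_bounded : exists C, 0 < C /\ forall t, `|dbump1 t| <= C.
Proof.
have [C [C0 hC]] := within_continuous_bounded (@segment_compact R (-1) 1)
  (continuous_subspaceT dbump1_continuous).
exists C; split => // t; have [t1|t1] := leP `|t| 1.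
  by apply: hC; rewrite /= in_itv/= -ler_norml.
by have [_ ->] := bump1_out (ltW t1); rewrite normr0 ltW.
Qed.

Lemma C1on_prj (D : set (R * R)) b (g dg : R -> R) :
  (forall t : R, is_derive t 1 g (dg t)) -> continuous dg ->
  C1on D (coord b 1 0) (fun z => g (prj b z)) (fun z => dg (prj b z)) /\
  C1on D (coord (~~ b) 1 0) (fun z => g (prj b z)) (fun=> 0).
Proof.
move=> gd cdg; have cg : continuous g by move=> t; exact: is_derive1_continuous (gd t).
have c1 : {within closure D, continuous (fun z => g (prj b z))}.
  apply: continuous_subspaceT => z.
  exact: (continuous_comp (@prj_continuous _ b z) (cg _)).
have line (v : R * R) (F : R -> R) z d : (forall h, F h = g (prj b (h *: v + z))) ->
    is_derive (0 : R) 1 F d -> is_derive z v (fun z => g (prj b z)) d.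
  move=> FE [Fd Fd'].
  have E : (fun h : R => h^-1 *: (F (h *: (1 : R) + 0) - F 0)) =
           (fun h : R => h^-1 *: (g (prj b (h *: v + z)) - g (prj b z))).
    apply/funext => h; rewrite [h *: 1]mulr1 addr0 !FE; congr (_ *: (_ - _)).
    by rewrite scale0r add0r.
  by apply: DeriveDef; [move: Fd; rewrite /derivable E|move: Fd'; rewrite /derive E].
split; split => //.
- apply: continuous_subspaceT => z.
  exact: (continuous_comp (@prj_continuous _ b z) (cdg _)).
- move=> z _; apply: (line _ (fun h => g (h + prj b z))).
    by move=> h; congr g; case: (b) => /=; rewrite [h *: 1]mulr1.
  have dgz := gd (prj b z).
  apply: (@is_derive_line _ _ g _ 0 (prj b z) 1) => // h.
  by rewrite addr0 [h *: 1]mulr1.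
- exact/continuous_subspaceT/cst_continuous.
- move=> z _; apply: (line _ (cst (g (prj b z)))).
  by move=> h; congr g; case: (b) => /=; rewrite scaler0 add0r.
Qed.

(** As a product over the two coordinates, it has balls of the max norm as plateau and support. *)
Definition bump (z0 : R * R) (r : R) (z : R * R) : R :=
  bump1 ((z.1 - z0.1) / r) * bump1 ((z.2 - z0.2) / r).

Definition dbump b (z0 : R * R) (r : R) (z : R * R) : R :=
  if b then bump1 ((z.1 - z0.1) / r) * (dbump1 ((z.2 - z0.2) / r) / r)
  else (dbump1 ((z.1 - z0.1) / r) / r) * bump1 ((z.2 - z0.2) / r).

Lemma bump_C1 (D : set (R * R)) b z0 r :
  C1on D (coord b 1 0) (bump z0 r) (dbump b z0 r).
Proof.
have dg (c t : R) : is_derive t 1 (fun t => bump1 ((t - c) / r)) (dbump1 ((t - c) / r) / r).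
  have da : is_derive t 1 (fun t => (t - c) / r) r^-1.
    have dm := is_deriveM (is_deriveB (is_derive_id t 1) (is_derive_cst (c : R) t 1))
       (is_derive_cst (r^-1 : R) t 1).
    by apply: is_derive_eq dm _; rewrite /GRing.scale/= subr0; ring.
  exact: (@is_derive1_comp _ bump1 (fun t => (t - c) / r) t _ _ (is_derive_bump1 _) da).
have cdg (c : R) : continuous (fun t => dbump1 ((t - c) / r) / r).
  move=> t; apply: cvgM; last exact: cvg_cst.
  have ca : {for t, continuous (fun t => (t - c) / r)}.
    by apply: cvgM; [apply: cvgB; [exact: cvg_id|exact: cvg_cst]|exact: cvg_cst].
  exact: (continuous_comp ca (@dbump1_continuous _)).
have [X0 X1] := C1on_prj D false (dg z0.1) (@cdg z0.1).
have [Y1 Y0] := C1on_prj D true (dg z0.2) (@cdg z0.2).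
case: b.
- have := C1onM X1 Y1; congr (C1on _ _ _ _); apply/funext => z.
  by rewrite mul0r add0r.
- have := C1onM X0 Y0; congr (C1on _ _ _ _); apply/funext => z.
  by rewrite mulr0 addr0.
Qed.

Lemma bump_itv z0 r z : 0 <= bump z0 r z <= 1.
Proof.
have /andP[a0 a1] := bump1_itv ((z.1 - z0.1) / r).
have /andP[b0 b1] := bump1_itv ((z.2 - z0.2) / r).
by rewrite mulr_ge0//= mulr_ile1.
Qed.

Lemma bump_in z0 r z : 0 < r -> ball z0 (r / 2) z ->
  [/\ bump z0 r z = 1, dbump false z0 r z = 0 & dbump true z0 r z = 0].
Proof.
move=> r0 [b1 b2]; have inn (u v : R) : `|u - v| < r / 2 ->
    bump1 ((v - u) / r) = 1 /\ dbump1 ((v - u) / r) = 0.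
  move=> uv; apply: bump1_in.
  by rewrite normrM normfV (gtr0_norm r0) ler_pdivrMr// distrC mulrC ltW.
have [[h1 h2] [h3 h4]] := (inn _ _ b1, inn _ _ b2).
by rewrite /bump /dbump h1 h2 h3 h4 !(mul0r, mulr0, mulr1).
Qed.

Lemma bump_out z0 r z : 0 < r -> ~ ball z0 r z ->
  [/\ bump z0 r z = 0, dbump false z0 r z = 0 & dbump true z0 r z = 0].
Proof.
move=> r0 nb; have out (u v : R) : r <= `|u - v| ->
    bump1 ((v - u) / r) = 0 /\ dbump1 ((v - u) / r) = 0.
  move=> uv; apply: bump1_out.
  by rewrite normrM normfV (gtr0_norm r0) ler_pdivlMr// mul1r distrC.
have : r <= `|z0.1 - z.1| \/ r <= `|z0.2 - z.2|.
  apply: contrapT => /not_orP[/negP n1 /negP n2]; apply: nb.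
  by split; rewrite /ball/= ltNge.
by move=> [/out[h1 h2]|/out[h1 h2]]; rewrite /bump /dbump h1 h2 !(mul0r, mulr0).
Qed.

Lemma dbump_bounded : exists C, 0 < C /\ forall b z0 r z, 0 < r ->
  `|dbump b z0 r z| <= C / r.
Proof.
have [C [C0 hC]] := dbump1_bounded; exists C; split => // b z0 r z r0.
have b1 t : `|bump1 t| <= 1.
  by have /andP[? ?] := bump1_itv t; rewrite ger0_norm.
have d1 t : `|dbump1 t / r| <= C / r.
  by rewrite normrM normfV (gtr0_norm r0) ler_wpM2r// invr_ge0 ltW.
rewrite /dbump; case: b; rewrite normrM.
- by rewrite -[leRHS]mul1r ler_pM.
- by rewrite -[leRHS]mulr1 ler_pM.
Qed.

End bump.

(** * Localization and removal of the corners *)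

Section Gauss_Green.
Context {R : realType}.
Notation mu := (@lebesgue_measure R).
Notation mu2 := (mu \x mu)%E.
Variables (Om : set (R * R)) (N : nat) (gam : 'I_N -> R -> R * R) (nu : R * R -> R * R).
Hypotheses (hOm : bounded_domain Om) (hgam : piecewise_C1_boundary gam Om).
Hypothesis hnu : unit_outward_normal gam Om nu.
Notation Green := (Green Om gam nu).
Notation corner := (corner gam).
Implicit Types (f g : R * R -> R).

Let oOm : open Om. Proof. by case: hOm. Qed.
Let bOm : bounded_set Om. Proof. by case: hOm. Qed.
Let mOm : measurable (Om : set (measurableTypeR R * measurableTypeR R)).
Proof. exact: open2_measurable. Qed.
Let kOm : compact (closure Om). Proof. exact: bounded_closure_compact. Qed.

Lemma integrable_domain f : {within closure Om, continuous f} ->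
  mu2.-integrable Om (EFin \o f).
Proof.
move=> cf; have [M [_ hM]] := within_continuous_bounded kOm cf.
have [B _ hB] := bounded_set2P bOm.
apply: (@integrable_bounded2 _ _ _ B M) => //.
- apply: (measurable_funS _ (@subset_closure _ Om)).
    by apply: closed2_measurable; exact: closed_closure.
  by apply: within_continuous2_measurable => //; exact: closed_closure.
- by move=> z /subset_closure/hM.
Qed.

Lemma norm_Rintegral_le d (T : measurableType d) (m : {measure set T -> \bar R})
    (D : set T) (g : T -> R) (K c : R) : measurable D -> (m D <= c%:E)%E -> 0 <= K ->
  m.-integrable D (EFin \o g) -> (forall x, D x -> `|g x| <= K) ->
  `|\int[m]_(x in D) g x| <= K * c.
Proof.
move=> mD mc K0 ig gK; apply: le_trans (le_normr_Rintegral mD ig) _.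
have mfin : m D \is a fin_num.
  by rewrite ge0_fin_numE//; exact: le_lt_trans mc (ltry _).
apply: (@le_trans _ _ (\int[m]_(x in D) K)).
  apply: le_Rintegral => //; first exact: (integrable_abse ig).
  apply: measurable_bounded_integrable => //.
    by rewrite -ge0_fin_numE.
  by exists K; split; rewrite ?num_real// => x Kx y _ /=; rewrite ger0_norm// ltW.
rewrite Rintegral_cst//; apply: ler_wpM2l => //.
by rewrite -lee_fin fineK.
Qed.

Lemma speed_bounded : exists V, 0 < V /\ forall b k s, 0 < s < 1 ->
  `|prj b (nu (gam k s)) * enorm (velocity gam k s)| <= V.
Proof.
have [V [V0 hV]] : exists V, 0 < V /\ forall k s, 0 <= s <= 1 -> enorm (velocity gam k s) <= V.
  have hk k : \forall V \near +oo, forall s, 0 <= s <= 1 -> enorm (velocity gam k s) <= V.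
    have ce : continuous (fun s => enorm (velocity gam k s)).
      move=> s; rewrite (_ : (fun s => _) = (fun s => Num.sqrt
        (prj false (velocity gam k s) * prj false (velocity gam k s) +
         prj true (velocity gam k s) * prj true (velocity gam k s)))); last first.
        by apply/funext => t; rewrite (enorm_prj false) !expr2.
      have c1 b : {for s, continuous (fun s => prj b (velocity gam k s) * prj b (velocity gam k s))}.
        have c0 := @velocity_continuous _ _ _ _ hgam b k s.
        exact: (continuousM c0 c0).
      exact: (continuous_comp (continuousD (c1 false) (c1 true)) (@sqrt_continuous _ _)).
    have [M [_ hM]] := within_continuous_bounded (@segment_compact R 0 1) (continuous_subspaceT ce).
    near=> V; move=> s s01; apply: (le_trans (ler_norm _)).
    apply: (le_trans (hM s _)); first by rewrite /= in_itv.
    by near: V; apply: nbhs_pinfty_ge; rewrite num_real.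
  have /filter_forall hV := hk; have [V [V0 VP]] := filter_ex (filterI (nbhs_pinfty_gt (num_real 0)) hV).
  by exists V; split.
exists V; split => // b k s s01; rewrite normrM [X in _ * X]ger0_norm ?sqrtr_ge0//.
rewrite -[leRHS]mul1r ler_pM//; first exact: sqrtr_ge0.
- have [n1 _ _] := hnu k s01; rewrite -n1 (enorm_prj b) -sqrtr_sqr.
  by rewrite ler_wsqrtr// lerDl sqr_ge0.
- by apply: hV; lra.
Unshelve. all: by end_near. Qed.

Lemma integrable_arc b k f : {within closure Om, continuous f} ->
  mu.-integrable `]0, 1[
    (EFin \o (fun s => f (gam k s) * prj b (nu (gam k s)) * enorm (velocity gam k s))).
Proof.
move=> cf; have [M [M0 hM]] := within_continuous_bounded kOm cf.
have [V [V0 hV]] := speed_bounded.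
have cfg : {within `]0, 1[, continuous (fun s => f (gam k s))}.
  apply: (within_continuous_comp _ _ cf).
    by apply: continuous_subspaceT; exact: (arc_continuous hgam).
  by move=> s; rewrite /= in_itv/= => s01; apply: (arc_closure hgam); lra.
apply: (@integrable_bounded1 _ _ _ 1 (M * V)).
- exact: measurable_itv.
- apply: measurable_realfun.open_continuous_measurable_fun; first exact: interval_open.
  move=> s sI; have s01 : 0 < s < 1 by move: sI; rewrite inE/= in_itv.
  have c1 : {for s, continuous (fun s => f (gam k s))}.
    by move: cfg; rewrite continuous_open_subspace; [apply|exact: interval_open].
  rewrite (_ : (fun s => _) =
      (fun s => f (gam k s) * (prj b (nu (gam k s)) * enorm (velocity gam k s)))).
    exact: (continuousM c1 (@arc_normal_continuous _ _ _ _ _ hOm hgam hnu b k s s01)).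
  by apply/funext => t; rewrite mulrA.
- by move=> s; rewrite /= !in_itv/=; lra.
- move=> s; rewrite /= in_itv/= => s01; rewrite -mulrA normrM ler_pM//.
    by apply: hM; apply: (arc_closure hgam); lra.
  exact: hV.
Qed.

(** Stated for the defect, the difference of the two sides, because it is used when the formula is
    known for one summand only. *)
Lemma Green_add b f1 g1 f2 g2 :
  C1on Om (coord b 1 0) f1 g1 -> C1on Om (coord b 1 0) f2 g2 ->
  area_integral Om (fun z => g1 z + g2 z) -
     line_integral gam setT (fun z => (f1 z + f2 z) * prj b (nu z)) =
  (area_integral Om g1 - line_integral gam setT (fun z => f1 z * prj b (nu z))) +
  (area_integral Om g2 - line_integral gam setT (fun z => f2 z * prj b (nu z))).
Proof.
move=> [cf1 cg1 _] [cf2 cg2 _].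
have -> : area_integral Om (fun z => g1 z + g2 z) = area_integral Om g1 + area_integral Om g2.
  by apply: RintegralD => //; exact: integrable_domain.
have -> : line_integral gam setT (fun z => (f1 z + f2 z) * prj b (nu z)) =
   line_integral gam setT (fun z => f1 z * prj b (nu z)) +
   line_integral gam setT (fun z => f2 z * prj b (nu z)).
  rewrite !line_integral_full -big_split/=; apply: eq_bigr => k _.
  rewrite -RintegralD//; [|exact: integrable_arc|exact: integrable_arc].
  by apply: eq_Rintegral => s _; rewrite !mulrDl.
ring.
Qed.

Lemma Green_null f f0 f1 : null_off Om set0 f f0 f1 -> Green false f f0 /\ Green true f f1.
Proof.
move=> nf; have n z : closure Om z -> [/\ f z = 0, f0 z = 0 & f1 z = 0].
  by move=> cz; apply: nf.
have lin b : line_integral gam setT (fun z => f z * prj b (nu z)) = 0.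
  rewrite line_integral_full big1// => k _; apply: Rintegral_eq0 => s.
  rewrite /= in_itv/= => s01; have [] := n (gam k s).
    by apply: (arc_closure hgam); lra.
  by move=> -> _ _; rewrite !mul0r.
by split; apply: etrans (esym (lin _)); apply: Rintegral_eq0 => z /subset_closure/n[].
Qed.

Lemma C1planeM f f0 f1 g g0 g1 : C1plane Om f f0 f1 -> C1plane Om g g0 g1 ->
  C1plane Om (fun z => f z * g z) (fun z => f0 z * g z + f z * g0 z)
    (fun z => f1 z * g z + f z * g1 z).
Proof. by move=> [h1 h2] [h3 h4]; split; exact: C1onM. Qed.

Lemma C1plane_bump z r : C1plane Om (bump z r) (dbump false z r) (dbump true z r).
Proof. by split; exact: bump_C1. Qed.

Lemma C1plane_cobump z r : C1plane Om (fun w => 1 - bump z r w)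
  (fun w => - dbump false z r w) (fun w => - dbump true z r w).
Proof.
have [h0 h1] := C1plane_bump z r.
split.
- have := C1onB (C1on_cst Om (coord false 1 0) (1 : R)) h0.
  by congr (C1on _ _ _ _); apply/funext => w; rewrite sub0r.
- have := C1onB (C1on_cst Om (coord true 1 0) (1 : R)) h1.
  by congr (C1on _ _ _ _); apply/funext => w; rewrite sub0r.
Qed.

(** Once the formula holds for [(1 - bump) * f], the defect of [f] is that of [bump * f]. *)
Lemma Green_cut z r f f0 f1 : C1plane Om f f0 f1 ->
  (Green false (fun w => (1 - bump z r w) * f w)
     (fun w => - dbump false z r w * f w + (1 - bump z r w) * f0 w) /\
   Green true (fun w => (1 - bump z r w) * f w)
     (fun w => - dbump true z r w * f w + (1 - bump z r w) * f1 w)) ->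
  forall b, area_integral Om (if b then f1 else f0) -
      line_integral gam setT (fun w => f w * prj b (nu w)) =
    area_integral Om (fun w => dbump b z r w * f w + bump z r w * (if b then f1 else f0) w) -
      line_integral gam setT (fun w => bump z r w * f w * prj b (nu w)).
Proof.
move=> cf [G0 G1] b.
have [c0 c1] := C1planeM (C1plane_cobump z r) cf.
have [d0 d1] := C1planeM (C1plane_bump z r) cf.
have split_f : f = (fun w => (1 - bump z r w) * f w + bump z r w * f w).
  by apply/funext => w; ring.
case: b.
- have := Green_add c1 d1; rewrite {1}(_ : (fun w => _ + _) = f1); last first.
    by apply/funext => w; ring.
  by rewrite (_ : (fun w => (_ + _) * _) = (fun w => f w * prj true (nu w)));
    [move=> ->; rewrite G1 subrr add0r|apply/funext => w; congr (_ * _); ring].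
- have := Green_add c0 d0; rewrite {1}(_ : (fun w => _ + _) = f0); last first.
    by apply/funext => w; ring.
  by rewrite (_ : (fun w => (_ + _) * _) = (fun w => f w * prj false (nu w)));
    [move=> ->; rewrite G0 subrr add0r|apply/funext => w; congr (_ * _); ring].
Qed.

Lemma compact_ball_cover (K : set (R * R)) (r : R * R -> R) : compact K ->
  (forall z, 0 < r z) -> exists2 l : seq (R * R), (forall z, z \in l -> K z) &
    K `<=` (fun w => exists2 z, z \in l & ball z (r z) w).
Proof.
move=> /compact_near_coveringP kK r0.
(* The filter of finite sequences that contain a given one, directed by concatenation; compactness
   in near-covering form along it yields the finite subcover. *)
pose F := filter_from setT (fun l0 : seq (R * R) => [set l : seq (R * R) | {subset l0 <= l}]).
have FF : ProperFilter F.
  apply: filter_from_proper; last by move=> l _; exists l => /= z.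
  apply: filter_from_filter; first by exists [::].
  move=> l1 l2 _ _; exists (l1 ++ l2) => // l h; split => z zl;
    by apply: h; rewrite mem_cat zl ?orbT.
pose P (l : seq (R * R)) (w : R * R) := exists2 z, K z /\ z \in l & ball z (r z) w.
have H : \forall l \near F, K `<=` P l.
  apply: kK => z Kz; exists (ball z (r z), [set l : seq (R * R) | {subset [:: z] <= l}]).
    by split; [exact: nbhsx_ballx|exists [:: z]].
  move=> [w l] [/= bw zl]; exists z => //; split => //.
  by apply: zl; rewrite mem_head.
have [l lP] := filter_ex H.
exists [seq z <- l | `[< K z >]].
  by move=> z; rewrite mem_filter => /andP[/asboolP].
move=> w /lP[z [Kz zl] bw]; exists z => //.
by rewrite mem_filter zl andbT; apply/asboolP.
Qed.

Let away (rho : R) : set (R * R) := fun z => forall c, corner c -> ~ ball c rho z.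

(** Induction on a finite cover by half balls: around the first centre the formula holds for
    [bump * f], while [(1 - bump) * f] vanishes on that half ball and is left to the shorter
    list. *)
Lemma Green_away_corners rho f f0 f1 : 0 < rho -> C1plane Om f f0 f1 ->
  null_off Om (away rho) f f0 f1 -> Green false f f0 /\ Green true f f1.
Proof.
move=> rho0 Cf nf.
(* A radius for every point, arbitrary off the closure. At a corner [rho] works: a function null
   near all corners and null off the ball is null. *)
have loc z : exists r, 0 < r /\ (closure Om z -> forall f f0 f1, C1plane Om f f0 f1 ->
    null_off Om (away rho) f f0 f1 -> null_off Om (ball z r) f f0 f1 ->
    Green false f f0 /\ Green true f f1).
  have [cz|ncz] := pselect (closure Om z); last by exists 1.
  have [kz|nkz] := pselect (corner z).
    exists rho; split => // _ g g0 g1 Cg ng1 ng2; apply: Green_null => w cw _.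
    have [bw|nbw] := pselect (ball z rho w); last exact: ng2.
    by apply: ng1 => // /(_ _ kz); exact.
  have [Oz|nOz] := pselect (Om z).
    have [r r0 rP] := Green_interior nu hOm hgam Oz.
    by exists r; split => // _ g g0 g1 Cg _; exact: rP.
  have : boundary Om z by split => //; move=> /interior_subset.
  rewrite (arc_cover hgam) => -[k _ [s s01 sz]].
  have s01' : 0 < s < 1.
    rewrite !lt_neqAle; case/andP: s01 => -> ->; rewrite !andbT.
    by apply/andP; split; apply/eqP => E; apply: nkz; exists k; rewrite -sz;
      [left; rewrite E|right; rewrite E].
  have [r r0 rP] := Green_arc hOm hgam hnu k s01'.
  by exists r; rewrite -sz; split => // _ g g0 g1 Cg _; exact: rP.
have [r rP] := choice loc.
(* Half radii, because [bump z (r z)] equals 1 only on the half ball. *)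
have [D Dcl DP] := compact_ball_cover kOm (fun z => divr_gt0 (rP z).1 (ltr0n _ 2)).
suff H (l : seq (R * R)) : (forall z, z \in l -> closure Om z) ->
    forall g g0 g1, C1plane Om g g0 g1 -> null_off Om (away rho) g g0 g1 ->
    null_off Om (fun w => exists2 z, z \in l & ball z (r z / 2) w) g g0 g1 ->
    Green false g g0 /\ Green true g g1.
  apply: (H D) => //.
  by move=> w cw; case; have [z zD zw] := DP w cw; exists z.
elim: l => [_ g g0 g1 _ _ ng|z l IH cl g g0 g1 Cg ng1 ng2].
  by apply: Green_null => w cw _; apply: ng => // -[].
have [rz0 /(_ (cl z (mem_head _ _))) rzP] := rP z.
have cG := C1planeM (C1plane_cobump z (r z)) Cg.
have dG := C1planeM (C1plane_bump z (r z)) Cg.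
have [H0 H1] : Green false (fun w => bump z (r z) w * g w)
      (fun w => dbump false z (r z) w * g w + bump z (r z) w * g0 w) /\
    Green true (fun w => bump z (r z) w * g w)
      (fun w => dbump true z (r z) w * g w + bump z (r z) w * g1 w).
  apply: (rzP _ _ _ dG).
  - by move=> w cw nw; have [-> -> ->] := ng1 w cw nw; split; ring.
  - by move=> w cw nw; have [-> -> ->] := bump_out rz0 nw; split; ring.
have cut : Green false (fun w => (1 - bump z (r z) w) * g w)
      (fun w => - dbump false z (r z) w * g w + (1 - bump z (r z) w) * g0 w) /\
    Green true (fun w => (1 - bump z (r z) w) * g w)
      (fun w => - dbump true z (r z) w * g w + (1 - bump z (r z) w) * g1 w).
  apply: (IH _ _ _ _ cG).
  - by move=> y yl; apply: cl; rewrite in_cons yl orbT.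
  - by move=> w cw nw; have [-> -> ->] := ng1 w cw nw; split; ring.
  - move=> w cw nw; have [bw|nbw] := pselect (ball z (r z / 2) w).
      by have [-> -> ->] := bump_in rz0 bw; split; ring.
    have [] := ng2 w cw; last by move=> -> -> ->; split; ring.
    move=> [y]; rewrite in_cons => /orP[/eqP->|yl] yw; first exact: nbw.
    by apply: nw; exists y.
have E := Green_cut Cg cut; split; apply/eqP; rewrite -subr_eq0.
- by have /= -> := E false; rewrite H0 subrr.
- by have /= -> := E true; rewrite H1 subrr.
Qed.


(** Since [rho] is arbitrary, the function may live as close to the corners of [cs] as desired. *)
Let Green_near (cs : seq (R * R)) : Prop := forall rho f f0 f1, 0 < rho ->
  C1plane Om f f0 f1 ->
  null_off Om (fun z => forall c, c \in cs -> ~ ball c rho z) f f0 f1 ->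
  Green false f f0 /\ Green true f f1.

(** In the corner estimate [eta] is the parameter length cut off at each end of an arc; below
    [1 / 2] the two cuts do not overlap. *)
Lemma small_eq0 (x K : R) : 0 <= K ->
  (forall eta, 0 < eta < 2^-1 -> `|x| <= K * eta) -> x = 0.
Proof.
move=> K0 H; apply/eqP/negPn/negP => x0; have xp : 0 < `|x| by rewrite normr_gt0.
have K1 : 0 < 2 * (K + 1) by lra.
(* The divisor [2 * (K + 1)] makes [K * eta] at most half of [|x|]; the added 1 covers [K = 0]. *)
have m0 : 0 < Num.min 4^-1 (`|x| / (2 * (K + 1))) by rewrite lt_min divr_gt0// andbT; lra.
have m1 : Num.min 4^-1 (`|x| / (2 * (K + 1))) <= 4^-1 by rewrite ge_min lexx.
have m2 : Num.min 4^-1 (`|x| / (2 * (K + 1))) <= `|x| / (2 * (K + 1)).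
  by rewrite ge_min lexx orbT.
have := H (Num.min 4^-1 (`|x| / (2 * (K + 1)))) _.
rewrite m0 (le_lt_trans m1); last by lra.
move=> /(_ isT) h.
have : K * Num.min 4^-1 (`|x| / (2 * (K + 1))) <= `|x| / 2.
  apply: (@le_trans _ _ (K * (`|x| / (2 * (K + 1))))); first exact: ler_wpM2l.
  by rewrite mulrA ler_pdivrMr//; nra.
lra.
Qed.

(* A bump of radius [ep] at a corner has gradient of size [1 / ep] on an area
   [4 ep ^ 2], so that it may be removed. *)
Lemma Green_corner_removal c cs : corner c -> Green_near (c :: cs) -> Green_near cs.
Proof.
move=> cc IH rho f f0 f1 rho0 Cf nf.
have [C [C0 hC]] := @dbump_bounded R.
have [V [V0 hV]] := speed_bounded.
have bnd g : {within closure Om, continuous g} -> \forall M \near +oo,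
    forall z, closure Om z -> `|g z| <= M.
  move=> cg; have [M [M0 hM]] := within_continuous_bounded kOm cg.
  near=> M'; move=> z cz; apply: (le_trans (hM z cz)).
  by near: M'; apply: nbhs_pinfty_ge; rewrite num_real.
have [[cf cf0 _] [_ cf1 _]] := Cf.
have [M [M0 hf hf0 hf1]] : exists M, [/\ 0 < M,
    forall z, closure Om z -> `|f z| <= M, forall z, closure Om z -> `|f0 z| <= M &
    forall z, closure Om z -> `|f1 z| <= M].
  have [M [[M0 h] [h0 h1]]] := filter_ex (filterI
    (filterI (nbhs_pinfty_gt (num_real 0)) (bnd _ cf)) (filterI (bnd _ cf0) (bnd _ cf1))).
  by exists M.
(* The first summand comes from the area term; in the line term each of the [N] arcs contributes
   [M * V] on two parameter intervals of length [eta]. *)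
pose K := 4 * (C * M + M) + N%:R * (M * V * 2).
have K0 : 0 <= K.
  rewrite addr_ge0// mulr_ge0//; first by rewrite addr_ge0// ?mulr_ge0// ltW.
  by rewrite !mulr_ge0// ltW.
have defect b eta : 0 < eta < 2^-1 ->
    `|area_integral Om (if b then f1 else f0) -
      line_integral gam setT (fun w => f w * prj b (nu w))| <= K * eta.
  move=> /andP[eta0 eta1].
  (* [e] is chosen after [eta]: the parts of the arcs away from their ends avoid [c], hence a ball
     about it, so that the bump meets the arcs only at parameters within [eta] of 0 or 1. *)
  have av : \forall e \near 0^'+, forall k s, s \in `[eta, 1 - eta] -> ~ ball c e (gam k s).
    apply: filter_forall => k.
    have := @compact_avoid R `[eta, 1 - eta]%classic (gam k) c (@segment_compact _ _ _)
      (arc_continuous hgam (k := k)).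
    apply => s; rewrite /= in_itv/= => sI E; have s01 : 0 < s < 1 by lra.
    have [l [El|El]] := cc; rewrite -E in El.
    + have e01 : 0 <= (0 : R) <= 1 by rewrite lexx ler01.
      by have [_ s0] := arc_simple hgam s01 e01 El; lra.
    + have e01 : 0 <= (1 : R) <= 1 by rewrite ler01 lexx.
      by have [_ s0] := arc_simple hgam s01 e01 El; lra.
  have [e [[e0 ee] avP]] : exists e, (0 < e /\ e < eta) /\
      forall k s, s \in `[eta, 1 - eta] -> ~ ball c e (gam k s).
    apply: (@filter_ex _ (0^'+)); near=> e; split; last by near: e.
    by split; near: e; [exact: nbhs_right_gt|exact: nbhs_right_lt].
  (* [1 - bump] vanishes on the ball of radius [e / 2] at [c], so the cut function is null near
     every corner of [c :: cs]. *)
  have cut := IH (Num.min rho (e / 2)) _ _ _ _ (C1planeM (C1plane_cobump c e) Cf) _.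
  rewrite (@Green_cut c e f f0 f1 Cf); last first.
    apply: cut; first by rewrite lt_min rho0; lra.
    move=> w cw nw.
    have [bw|nbw] := pselect (ball c (e / 2) w).
      by have [-> -> ->] := bump_in e0 bw; split; ring.
    have [] := nf w cw; last by move=> -> -> ->; split; ring.
    move=> h; apply: nw => y; rewrite in_cons => /orP[/eqP->|ycs] yw.
      by apply: nbw; apply: le_ball yw; rewrite ge_min lexx orbT.
    by apply: (h y ycs); apply: le_ball yw; rewrite ge_min lexx.
  have [d0 d1] := C1planeM (C1plane_bump c e) Cf.
  have bump_le1 w : `|bump c e w| <= 1.
    by have /andP[? ?] := bump_itv c e w; rewrite ger0_norm.
  have area_le : `|area_integral Om (fun w => dbump b c e w * f w +
      bump c e w * (if b then f1 else f0) w)| <= 4 * (C * M + M) * eta.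
    set g := fun w => _; have cg : {within closure Om, continuous g}.
      by rewrite /g; case: (b); [case: d1|case: d0].
    pose B := (`[c.1 - e, c.1 + e]%classic `*` `[c.2 - e, c.2 + e]%classic).
    have -> : area_integral Om g = \int[mu2]_(w in Om `&` B) g w.
      apply: Rintegral_support => [w [Ow _]//|w Ow nB].
      have nb : ~ ball c e w.
        move=> [b1 b2]; apply: nB; split => //.
        by split; rewrite /= in_itv/= -ler_distl distrC ltW.
      rewrite /g; have [h1 h2 h3] := bump_out e0 nb.
      by case: (b); rewrite h1 ?h2 ?h3 !mul0r addr0.
    have mB : measurable (B : set (measurableTypeR R * measurableTypeR R)).
      by apply: measurableX; exact: measurable_itv.
    have mOB : measurable (Om `&` B : set (measurableTypeR R * measurableTypeR R)).
      exact: measurableI.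
    have muB : (mu2 (Om `&` B) <= ((2 * e) * (2 * e))%:E)%E.
      apply: (@le_trans _ _ (mu2 B)); first by apply: le_measure; rewrite ?inE//; exact: subIsetr.
      by rewrite /B mu2_box; [rewrite lee_fin|lra|lra]; rewrite le_eqVlt; apply/orP; left; apply/eqP; ring.
    apply: (@le_trans _ _ ((C / e * M + M) * ((2 * e) * (2 * e)))).
      apply: norm_Rintegral_le => //.
      - exact: (addr_ge0 (mulr_ge0 (divr_ge0 (ltW C0) (ltW e0)) (ltW M0)) (ltW M0)).
      - by apply: integrableS (integrable_domain cg).
      - move=> w [Ow _]; have cw := subset_closure Ow.
        apply: (le_trans (ler_normD _ _)).
        rewrite (normrM (dbump b c e w)) (normrM (bump c e w)) lerD//.
          by apply: ler_pM => //; [exact: hC|exact: hf].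
        rewrite -[leRHS]mul1r.
        apply: (ler_pM (normr_ge0 _) (normr_ge0 _) (bump_le1 w)).
        by case: (b); [apply: hf1|apply: hf0].
    (* The area [4 * e ^ 2] absorbs the gradient bound [C / e], leaving a term linear in [e]; the
       quadratic term is controlled by [e < eta < 1 / 2]. *)
    rewrite (_ : _ * _ = 4 * e * (C * M) + 4 * e * e * M); last by field; rewrite gt_eqF.
    rewrite (_ : 4 * (C * M + M) * eta = 4 * eta * (C * M) + 4 * eta * M); last by ring.
    have CM : 0 <= C * M by rewrite mulr_ge0// ltW.
    apply: lerD; apply: ler_wpM2r => //; [lra|exact: ltW|].
    by move: e0 ee eta1; nra.
  have line_le : `|line_integral gam setT (fun w => bump c e w * f w * prj b (nu w))|
      <= N%:R * (M * V * 2) * eta.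
    have -> : N%:R * (M * V * 2) * eta = \sum_(k < N) (M * V) * (2 * eta).
      by rewrite sumr_const card_ord -mulr_natl; ring.
    rewrite line_integral_full; apply: (le_trans (ler_norm_sum _ _ _)); apply: ler_sum => k _.
    pose g s := bump c e (gam k s) * f (gam k s) * prj b (nu (gam k s)) * enorm (velocity gam k s).
    pose D := `]0, eta[%classic `|` `]1 - eta, 1[%classic : set R.
    have mD : measurable D by apply: measurableU; exact: measurable_itv.
    have Dsub : D `<=` `]0, 1[%classic by move=> s []; rewrite /= !in_itv/=; lra.
    have ig : mu.-integrable `]0, 1[ (EFin \o g).
      apply: (@integrable_arc b k (fun w => bump c e w * f w)).
      by case: d0.
    rewrite (@Rintegral_support _ _ _ mu _ D _ g); last 2 first.
    - by move=> s Ds; split => //; exact: Dsub.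
    - move=> s; rewrite /= in_itv/= => s01 nD.
      have sI : s \in `[eta, 1 - eta].
        rewrite in_itv/= !leNgt; apply/andP; split; apply/negP => h; apply: nD.
        + by left; rewrite /= in_itv/=; lra.
        + by right; rewrite /= in_itv/=; lra.
      by have [h _ _] := bump_out e0 (avP k s sI); rewrite /g h !mul0r.
    apply: norm_Rintegral_le => //.
    - have h : (mu D <= mu `]0%R, eta[ + mu `](1 - eta)%R, 1%R[)%E.
        by apply: measureU2; exact: measurable_itv.
      apply: (le_trans h); rewrite /= !lebesgue_measure_itv/= !lte_fin eta0 ifT; last by lra.
      by rewrite -!EFinB -EFinD lee_fin; lra.
    - by rewrite mulr_ge0// ltW.
    - exact: integrableS ig.
    - move=> s /Dsub; rewrite /= in_itv/= => s01; rewrite /g -mulrA normrM.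
      apply: ler_pM => //; last exact: hV.
      rewrite normrM -[leRHS]mul1r; apply: ler_pM => //; apply: hf.
      by apply: (arc_closure hgam); lra.
  by apply: (le_trans (ler_normB _ _)); rewrite /K mulrDl lerD.
split; apply/eqP; rewrite -subr_eq0; apply/eqP.
- exact: (small_eq0 K0 (defect false)).
- exact: (small_eq0 K0 (defect true)).
Unshelve. all: by end_near. Qed.

(** With all end points listed, [Green_away_corners] applies. Corners are then dropped one at a
    time, and for the empty list the vanishing condition is void. *)
Theorem Gauss_Green f f0 f1 : C1plane Om f f0 f1 -> Green false f f0 /\ Green true f f1.
Proof.
move=> Cf; pose cs := flatten [seq [:: gam k 0; gam k 1] | k <- enum 'I_N].
have csP c : corner c <-> c \in cs.
  split.
  - move=> [k kc]; apply/flattenP; exists [:: gam k 0; gam k 1].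
      by apply: map_f; rewrite mem_enum.
    by rewrite !inE; case: kc => ->; rewrite eqxx ?orbT.
  - by move=> /flattenP[_ /mapP[k _ ->]]; rewrite !inE => /orP[] /eqP ->; exists k; [left|right].
have H0 : Green_near cs.
  move=> rho g g0 g1 rho0 Cg ng; apply: (Green_away_corners rho0 Cg) => w cw nw.
  by apply: ng => // h; apply: nw => c /csP; exact: h.
have : forall c, c \in cs -> corner c by move=> c /csP.
elim: cs H0 {csP} => [H0 _|c cs IH H0 H].
  by apply: (H0 1 f f0 f1) => // w cw nw; exfalso; apply: nw.
apply: IH; last by move=> y ycs; apply: H; rewrite in_cons ycs orbT.
by apply: Green_corner_removal H0; apply: H; rewrite mem_head.
Qed.

End Gauss_Green.





(** * Integrands depending on time *)

Section time_dependent.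
Context {R : realType}.
Notation mu := (@lebesgue_measure R).
Notation mu2 := (mu \x mu)%E.
Variables (Om : set (R * R)) (N : nat) (gam : 'I_N -> R -> R * R) (nu : R * R -> R * R).
Variable T : R.
Hypotheses (hOm : bounded_domain Om) (hgam : piecewise_C1_boundary gam Om).
Hypothesis hnu : unit_outward_normal gam Om nu.
Hypothesis T0 : 0 < T.
Notation cyl := (cylinder Om T).
Implicit Types F G : (R * R) * R -> R.

Let oOm : open Om. Proof. by case: hOm. Qed.
Let bOm : bounded_set Om. Proof. by case: hOm. Qed.
Let kOm : compact (closure Om). Proof. exact: bounded_closure_compact. Qed.

Lemma cylinder_open : open cyl.
Proof.
have -> : cyl = (fst @^-1` Om) `&` (snd @^-1` `]0, T[%classic).
  by apply/seteqP; split => z; rewrite /cylinder /= in_itv.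
apply: openI; apply: open_comp => //.
- by move=> z _; exact: cvg_fst.
- by move=> z _; exact: cvg_snd.
Qed.

Lemma time_slice_continuous F t : 0 <= t <= T -> {within closure cyl, continuous F} ->
  {within closure Om, continuous (fun x => F (x, t))}.
Proof.
move=> tT cF; apply: (within_continuous_comp (S := fun x => (x, t)) _ _ cF).
  by apply: continuous_subspaceT => x; exact: (cvg_pair cvg_id (cvg_cst t)).
by move=> x cx; exact: closure_slab.
Qed.

(** Compactness of [closure Om] makes the modulus uniform in [x]: near [(x, t0)] both [F (y, t)] and
    [F (y, t0)] are within [eps / 2] of [F (x, t0)]. *)
Lemma time_uniform F t0 eps : 0 <= t0 <= T -> 0 < eps ->
  {within closure cyl, continuous F} ->
  exists2 d, 0 < d & forall t, 0 <= t <= T -> `|t - t0| < d ->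
    forall x, closure Om x -> `|F (x, t) - F (x, t0)| <= eps.
Proof.
move=> tT e0 cF.
pose P (t : R) (x : R * R) := closure Om x -> 0 <= t <= T ->
  `|F (x, t) - F (x, t0)| <= eps.
have near_uniform : \forall t \near t0, closure Om `<=` P t.
  have /compact_near_coveringP kK := kOm.
  apply: (kK R (nbhs t0) P (nbhs_filter t0)) => x cx.
  have cFx := (subspace_continuousP _ _).1 cF (x, t0) (closure_slab T0 cx tT).
  move/cvgrPdist_lt : cFx => /(_ (eps / 2)).
  rewrite divr_gt0// => /(_ isT) nF.
  have {}nF : nbhs ((x, t0) : (R * R) * R)
      (fun z => closure cyl z -> `|F (x, t0) - F z| < eps / 2) := nF.
  have /nbhs_ballP[d /= d0 dP] := nF.
  exists (ball x d, ball t0 d); first by split; exact: nbhsx_ballx.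
  move=> [y t] [/= xy tt] cy tT'.
  have h1 : `|F (x, t0) - F (y, t)| < eps / 2.
    by apply: dP; [split|exact: closure_slab].
  have h2 : `|F (x, t0) - F (y, t0)| < eps / 2.
    by apply: dP; [split => //=; exact: ballxx|exact: closure_slab].
  have -> : F (y, t) - F (y, t0) = (F (x, t0) - F (y, t0)) - (F (x, t0) - F (y, t)) by ring.
  by apply: (le_trans (ler_normB _ _)); lra.
have /nbhs_ballP[d /= d0 dP] := near_uniform.
exists d => // t tT' td x cx; apply: (dP t _ x) => //.
by rewrite /ball/= distrC.
Qed.

Lemma domain_area : exists2 m, 0 < m & (mu2 Om <= m%:E)%E.
Proof.
have [B B0 hB] := bounded_set2P bOm.
exists ((2 * B) * (2 * B)); first by rewrite !mulr_gt0.
apply: (@le_trans _ _ (mu2 (`[-B, B]%classic `*` `[-B, B]%classic))).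
  by apply: le_measure; rewrite ?inE//; [exact: open2_measurable|exact: measurableX].
by rewrite mu2_box; [rewrite lee_fin le_eqVlt; apply/orP; left; apply/eqP; ring|lra|lra].
Qed.

(** By the mean value theorem the difference quotient at [x] is [Ft (x, xi)] with [xi] between [s]
    and [t], so it is within [eps / m] of [Ft (x, t)], uniformly in [x], and [m] bounds the area.
    Only derivatives at interior times are used, which covers [t = 0] and [t = T]. *)
Lemma deriv_within_area_integral F Ft t : C1on cyl (dirt : (R * R) * R) F Ft ->
  0 <= t <= T ->
  deriv_within [set s | 0 <= s <= T] (fun s => area_integral Om (fun x => F (x, s))) t
    (area_integral Om (fun x => Ft (x, t))).
Proof.
move=> [cF cFt dF] tT.
have [m m0 mOm] := domain_area.
rewrite /deriv_within; apply/cvgrPdist_le => eps e0.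
have [d d0 dP] := time_uniform tT (divr_gt0 e0 m0) cFt.
have nd : \forall s \near t^', 0 <= s <= T -> `|s - t| < d /\ s != t.
  near=> s => _; split; last by near: s; exact: nbhs_dnbhs_neq.
  near: s; apply: cvg_within.
  by near=> s; rewrite distrC; near: s; exact: (nbhsx_ballx t _ d0).
rewrite near_withinE; apply: filterS nd => s h sT.
have [sd st] := h sT.
have iF r : 0 <= r <= T -> mu2.-integrable Om (EFin \o (fun x => F (x, r))).
  by move=> rT; apply: integrable_domain => //; exact: time_slice_continuous.
have iFt r : 0 <= r <= T -> mu2.-integrable Om (EFin \o (fun x => Ft (x, r))).
  by move=> rT; apply: integrable_domain => //; exact: time_slice_continuous.
have mO := open2_measurable oOm.
have iq : mu2.-integrable Om (EFin \o (fun x => (s - t)^-1 * (F (x, s) - F (x, t)))).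
  have := integrableZl mO (s - t)^-1 (integrableB mO (iF _ sT) (iF _ tT)).
  by apply: eq_integrable => // x _.
have -> : area_integral Om (fun x => Ft (x, t)) -
    (area_integral Om (fun x => F (x, s)) - area_integral Om (fun x => F (x, t))) / (s - t) =
    area_integral Om (fun x => Ft (x, t) - (s - t)^-1 * (F (x, s) - F (x, t))).
  rewrite /area_integral RintegralB//; last exact: iFt.
  congr (_ - _); rewrite RintegralZl//; last first.
    by have := integrableB mO (iF _ sT) (iF _ tT); apply: eq_integrable.
  by rewrite RintegralB; [rewrite mulrC|exact: mO|exact: iF|exact: iF].
rewrite -[leRHS](divfK (lt0r_neq0 m0)).
apply: norm_Rintegral_le => //.
- by rewrite divr_ge0// ltW.
- by have := integrableB mO (iFt _ tT) iq; apply: eq_integrable.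
move=> x Ox; have cx := subset_closure Ox.
have mvt a b : 0 <= a -> a < b -> b <= T ->
    exists2 c, a < c < b & F (x, b) - F (x, a) = Ft (x, c) * (b - a).
  move=> a0 ab bT; have [c cab E] : exists2 c, c \in `]a, b[ &
      F (x, b) - F (x, a) = Ft (x, c) * (b - a).
    apply: (@MVT _ (fun r => F (x, r)) (fun r => Ft (x, r))) => // [r|].
      rewrite in_itv/= => rab; have cr : cyl (x, r) by split=> //=; lra.
      apply: (is_derive_line _ (dF _ cr)) => u; congr F.
      by congr pair; rewrite /= ?scaler0 ?add0r// [u *: 1]mulr1.
    apply: (within_continuous_comp (S := fun r => (x, r)) _ _ cF).
      by apply: continuous_subspaceT => r; exact: (cvg_pair (cvg_cst x) cvg_id).
    by move=> r; rewrite /= in_itv/= => rab; apply: closure_slab => //; lra.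
  by exists c => //; rewrite in_itv/= in cab.
have [xi xib E] : exists2 xi, 0 < xi < T /\ `|xi - t| <= `|s - t| &
    F (x, s) - F (x, t) = Ft (x, xi) * (s - t).
  have [st'|st'] := ltP s t.
  - have [s0' t1'] : 0 <= s /\ t <= T by case/andP: sT => ? _; case/andP: tT.
    have [c cI E] := mvt s t s0' st' t1'.
    exists c; last by rewrite -opprB E; ring.
    split; first lra.
    by rewrite !ltr0_norm ?subr_lt0//; lra.
  - have {}st' : t < s by rewrite lt_neqAle eq_sym st.
    have [t0' s1'] : 0 <= t /\ s <= T by case/andP: sT => _ ?; case/andP: tT.
    have [c cI E] := mvt t s t0' st' s1'.
    exists c => //; split; first lra.
    by rewrite !gtr0_norm ?subr_gt0//; lra.
rewrite E mulrC mulfK ?subr_eq0// distrC; apply: dP => //; lra.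
Unshelve. all: by end_near. Qed.

Lemma C1on_time_slice (v : R * R) F G t : 0 < t < T -> C1on cyl (v, 0) F G ->
  C1on Om v (fun x => F (x, t)) (fun x => G (x, t)).
Proof.
move=> tT [cF cG dF]; have tT' : 0 <= t <= T by lra.
split; [exact: time_slice_continuous|exact: time_slice_continuous|].
move=> x Ox; have [Fd Fd'] := dF (x, t) (conj Ox tT).
have E : (fun h : R => h^-1 *: (F (h *: v + x, t) - F (x, t))) =
    (fun h : R => h^-1 *: (F (h *: (v, 0) + (x, t)) - F (x, t))).
  apply/funext => h; congr (_ *: (F _ - _)); congr pair.
  by rewrite /= scaler0 add0r.
by apply: DeriveDef; [move: Fd; rewrite /derivable -E|move: Fd'; rewrite /derive -E].
Qed.

Lemma time_approx t d : 0 <= t <= T -> 0 < d -> exists2 s, 0 < s < T & `|s - t| < d.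
Proof.
move=> tT d0; pose m := Num.min (d / 2) (T / 4); have m0 : 0 < m by rewrite lt_min !divr_gt0.
have m1 : m <= d / 2 by rewrite ge_min lexx.
have m2 : m <= T / 4 by rewrite ge_min lexx orbT.
have [tT2|tT2] := leP t (T / 2).
- by exists (t + m); [lra|rewrite addrAC subrr add0r gtr0_norm//; lra].
- by exists (t - m); [lra|rewrite addrAC subrr add0r normrN gtr0_norm//; lra].
Qed.

(* At [t = 0] and [t = T] the slice of [F] need not be differentiable in space:
   the formula is obtained there as a limit. *)
Lemma Green_time b F F0 F1 t : 0 <= t <= T ->
  C1on cyl (coord false 1 0, 0) F F0 -> C1on cyl (coord true 1 0, 0) F F1 ->
  area_integral Om (fun x => (if b then F1 else F0) (x, t)) =
  line_integral gam setT (fun x => F (x, t) * prj b (nu x)).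
Proof.
move=> tT C0 C1.
have [m m0 mOm] := domain_area.
have [V [V0 hV]] := speed_bounded hgam hnu.
set Fb := if b then F1 else F0.
have cF : {within closure cyl, continuous F} by case: C0.
have cFb : {within closure cyl, continuous Fb} by rewrite /Fb; case: (b); [case: C1|case: C0].
apply/eqP; rewrite -subr_eq0; apply/eqP.
(* Replacing [t] by a nearby interior time [s] changes the area side by at most [eta * m] and the
   line side by at most [N * V * eta]. *)
have K0 : 0 <= m + N%:R * V by rewrite addr_ge0 ?mulr_ge0// ltW.
apply: (small_eq0 K0) => eta /andP[eta0 _].
have [d1 d10 d1P] := time_uniform tT eta0 cF.
have [d2 d20 d2P] := time_uniform tT eta0 cFb.
have [s sT st] : exists2 s, 0 < s < T & `|s - t| < Num.min d1 d2.
  by apply: time_approx => //; rewrite lt_min d10.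
have [st1 st2] : `|s - t| < d1 /\ `|s - t| < d2 by move: st; rewrite lt_min => /andP.
have sT' : 0 <= s <= T by lra.
have D0 : area_integral Om (fun x => Fb (x, s)) =
    line_integral gam setT (fun x => F (x, s) * prj b (nu x)).
  have [G0 G1] := Gauss_Green hOm hgam hnu
    (conj (C1on_time_slice sT C0) (C1on_time_slice sT C1)).
  by rewrite /Fb; case: (b); [exact: G1|exact: G0].
have iFb r : 0 <= r <= T -> mu2.-integrable Om (EFin \o (fun x => Fb (x, r))).
  by move=> rT; apply: integrable_domain => //; exact: time_slice_continuous.
have mO := open2_measurable oOm.
have E1 : `|area_integral Om (fun x => Fb (x, s)) - area_integral Om (fun x => Fb (x, t))|
    <= eta * m.
  rewrite /area_integral -RintegralB//; [|exact: iFb|exact: iFb].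
  apply: norm_Rintegral_le => //; first exact: ltW.
    by have := integrableB mO (iFb _ sT') (iFb _ tT); apply: eq_integrable.
  by move=> x Ox; apply: d2P => //; exact: subset_closure.
have E2 : `|line_integral gam setT (fun x => F (x, s) * prj b (nu x)) -
    line_integral gam setT (fun x => F (x, t) * prj b (nu x))| <= N%:R * V * eta.
  rewrite !line_integral_full -sumrB.
  have -> : N%:R * V * eta = \sum_(k < N) (eta * V) * 1.
    by rewrite sumr_const card_ord -mulr_natl; ring.
  apply: (le_trans (ler_norm_sum _ _ _)); apply: ler_sum => k _.
  have ia r : 0 <= r <= T -> mu.-integrable `]0, 1[ (EFin \o
      (fun s => F (gam k s, r) * prj b (nu (gam k s)) * enorm (velocity gam k s))).
    move=> rT; apply: (integrable_arc hOm hgam hnu b k (f := fun x => F (x, r))).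
    exact: time_slice_continuous.
  rewrite -RintegralB//; [|exact: ia|exact: ia].
  apply: norm_Rintegral_le => //.
  - by rewrite /= lebesgue_measure_itv/= lte_fin ltr01 -EFinB subr0.
  - by rewrite mulr_ge0// ltW.
  - by have := integrableB _ (ia _ sT') (ia _ tT); apply => //; exact: measurable_itv.
  - move=> r; rewrite /= in_itv/= => r01; rewrite -!mulrBl -mulrA normrM.
    apply: ler_pM => //; last exact: hV.
    by apply: d1P => //; apply: (arc_closure hgam); lra.
have -> : area_integral Om (fun x => Fb (x, t)) -
    line_integral gam setT (fun x => F (x, t) * prj b (nu x)) =
  (line_integral gam setT (fun x => F (x, s) * prj b (nu x)) -
    line_integral gam setT (fun x => F (x, t) * prj b (nu x))) -
  (area_integral Om (fun x => Fb (x, s)) - area_integral Om (fun x => Fb (x, t))).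
  by rewrite D0; ring.
apply: (le_trans (ler_normB _ _)).
by rewrite mulrDl addrC [m * _]mulrC lerD.
Qed.

End time_dependent.





(** * The closed space-time cylinder *)

Section closed_cylinder.
Context {R : realType}.

Lemma closure_eq (V : normedModType R) (D : set V) (f g : V -> R) :
  {within closure D, continuous f} -> {within closure D, continuous g} ->
  (forall z, D z -> f z = g z) -> forall z, closure D z -> f z = g z.
Proof.
move=> cf cg fg z cz.
have pD : ProperFilter (within D (nbhs z)) by exact: within_nbhs_proper.
have lim_ (h : V -> R) : {within closure D, continuous h} ->
    h @ within D (nbhs z) --> h z.
  move=> ch; apply: cvg_trans ((subspace_continuousP _ _).1 ch z cz).
  by apply: cvg_app; apply: within_subset; exact: subset_closure.
have hf := lim_ _ cf; have hg := lim_ _ cg.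
apply: (@cvg_unique _ (@norm_hausdorff _ R^o) _ _ _ _ hf).
apply: cvg_trans hg; apply: near_eq_cvg.
by rewrite near_withinE; near=> y => Dy; rewrite fg.
Unshelve. all: by end_near. Qed.

(** [dbar] is the limit along [D] of a derivative that equals [g] on [D], and [g] is continuous up
    to the closure. *)
Lemma dbar_C1on (V : normedModType R) (D : set V) (v : V) (f g : V -> R) :
  C1on D v f g -> forall z, closure D z -> dbar D v f z = g z.
Proof.
move=> [_ cg dg] z cz; rewrite /dbar.
have pD : ProperFilter (within D (nbhs z)) by exact: within_nbhs_proper.
apply: cvg_lim; first exact: norm_hausdorff.
have : g @ within D (nbhs z) --> g z.
  apply: cvg_trans ((subspace_continuousP _ _).1 cg z cz).
  by apply: cvg_app; apply: within_subset; exact: subset_closure.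
apply: cvg_trans; apply: near_eq_cvg.
rewrite near_withinE; near=> y => Dy.
by have dy := dg y Dy; rewrite derive_val.
Unshelve. all: by end_near. Qed.

Lemma closure_cylinder_fst (Om : set (R * R)) T z :
  closure (cylinder Om T) z -> closure Om z.1.
Proof.
move=> cz B nB; have nz : nbhs z (fst @^-1` B) by apply: cvg_fst.
by have [y [[Oy _] By]] := cz _ nz; exists y.1.
Qed.

Lemma C1on_lift (Om : set (R * R)) T (v : R * R) f g : C1on Om v f g ->
  C1on (cylinder Om T) (v, 0) (fun z => f z.1) (fun z => g z.1).
Proof.
move=> [cf cg df]; have cont (h : R * R -> R) : {within closure Om, continuous h} ->
    {within closure (cylinder Om T), continuous (fun z => h z.1)}.
  move=> ch; apply: (within_continuous_comp (S := @fst _ _) _ _ ch).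
    by apply: continuous_subspaceT => z; exact: cvg_fst.
  by move=> z; exact: closure_cylinder_fst.
split; [exact: cont|exact: cont|move=> z [Oz _]].
have [Fd Fd'] := df _ Oz.
by apply: DeriveDef; [exact: Fd|exact: Fd'].
Qed.

Lemma C1on_lift_time (Om : set (R * R)) T f : {within closure Om, continuous f} ->
  C1on (cylinder Om T) (dirt : (R * R) * R) (fun z => f z.1) (fun=> 0).
Proof.
move=> cf; split.
- apply: (within_continuous_comp (S := @fst _ _) _ _ cf).
    by apply: continuous_subspaceT => z; exact: cvg_fst.
  by move=> z; exact: closure_cylinder_fst.
- exact/continuous_subspaceT/cst_continuous.
- move=> z _.
  have E : (fun h : R => h^-1 *: (f (h *: dirt + z).1 - f z.1)) = cst (0 : R).
    by apply/funext => h; rewrite /= scaler0 add0r subrr scaler0.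
  apply: DeriveDef; first by rewrite /derivable E; exact: is_cvg_cst.
  by rewrite /derive E; apply: cvg_lim; [exact: norm_hausdorff|exact: cvg_cst].
Qed.

(** Carries boundary conditions, given for [0 < t < T], to the two end times. *)
Lemma time_extend (Om : set (R * R)) T (F : (R * R) * R -> R) x : 0 < T ->
  {within closure (cylinder Om T), continuous F} -> closure Om x ->
  (forall t, 0 < t < T -> F (x, t) = 0) -> forall t, 0 <= t <= T -> F (x, t) = 0.
Proof.
move=> T0 cF cx F0 t tT.
have cFx : {within `[0, T], continuous (fun t => F (x, t))}.
  apply: (within_continuous_comp (S := pair x) _ _ cF).
    by apply: continuous_subspaceT => s; exact: (cvg_pair (cvg_cst x) cvg_id).
  by move=> s /=; rewrite in_itv/=; exact: closure_slab.
apply: (small_eq0 ler01) => e /andP[e0 _]; rewrite mul1r.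
have tI : `[0, T]%classic t by rewrite /= in_itv.
have := (subspace_continuousP _ _).1 cFx t tI.
move/cvgrPdist_lt => /(_ e e0) nF.
have {}nF : nbhs t (fun s => `[0, T]%classic s -> `|F (x, t) - F (x, s)| < e) := nF.
have /nbhs_ballP[d /= d0 dP] := nF.
have [s sT st] := time_approx T0 tT d0.
have := dP s; rewrite /ball/= distrC => /(_ st); rewrite in_itv/= (F0 s sT) subr0.
by move=> h; apply/ltW/h; lra.
Qed.

(** One component of the energy flux: [p], [a], [b], [e] stand for the height [phi], the two
    velocity components and [eta], [w] is the velocity component in the direction of the flux, and
    [P], [Q] form the matching column of the strain. The derivative is expanded to fit
    [energy_balance]. *)
Lemma C1on_flux (V : normedModType R) (D : set V) v (rho mu g : R)
    (p p' w w' a a' b b' e e' P P' Q Q' : V -> R) :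
  C1on D v p p' -> C1on D v w w' -> C1on D v a a' -> C1on D v b b' ->
  C1on D v e e' -> C1on D v P P' -> C1on D v Q Q' ->
  C1on D v
   (fun z => - (rho / 2) * (p z * (a z * a z + b z * b z) * w z)
     - rho * g * (p z * e z * w z) + 2 * mu * (p z * (P z * a z + Q z * b z)))
   (fun z => - (rho / 2) * ((p' z * (a z * a z + b z * b z) +
        p z * (2 * a z * a' z + 2 * b z * b' z)) * w z
        + p z * (a z * a z + b z * b z) * w' z)
     - rho * g * ((p' z * e z + p z * e' z) * w z + p z * e z * w' z)
     + 2 * mu * (p' z * (P z * a z + Q z * b z) +
         p z * (P' z * a z + P z * a' z + Q' z * b z + Q z * b' z))).
Proof.
move=> Cp Cw Ca Cb Ce CP CQ.
have Cq := C1onD (C1onM Ca Ca) (C1onM Cb Cb).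
have H1 := C1on_scale (- (rho / 2)) (C1onM (C1onM Cp Cq) Cw).
have H2 := C1on_scale (rho * g) (C1onM (C1onM Cp Ce) Cw).
have H3 := C1on_scale (2 * mu) (C1onM Cp (C1onD (C1onM CP Ca) (C1onM CQ Cb))).
have := C1onD (C1onB H1 H2) H3.
by congr (C1on _ _ _ _); apply/funext => z; ring.
Qed.

Lemma measurable_arc (N : nat) (gam : 'I_N -> R -> R * R) (Om A : set (R * R)) k :
  piecewise_C1_boundary gam Om ->
  measurable (A : set (measurableTypeR R * measurableTypeR R)) ->
  measurable [set s : R | 0 < s < 1 /\ A (gam k s)].
Proof.
move=> hgam mA.
have mg : measurable_fun (setT : set (measurableTypeR R))
    (gam k : measurableTypeR R -> measurableTypeR R * measurableTypeR R).
  have -> : gam k = (fun s => ((gam k s).1, (gam k s).2)).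
    by apply/funext => s; case: (gam k s).
  apply: measurable_fun_pair; apply: measurable_realfun.continuous_measurable_fun => s.
  - exact: is_derive1_continuous (arc_is_derive hgam false k s).
  - exact: is_derive1_continuous (arc_is_derive hgam true k s).
rewrite (_ : [set s | _] = `]0, 1[%classic `&` (gam k @^-1` A)); last first.
  by apply/seteqP; split => s /=; rewrite in_itv.
apply: measurableI; first exact: measurable_itv.
by rewrite -[X in measurable X]setTI; exact: mg.
Qed.

End closed_cylinder.





(** * Line integrals over parts of the boundary *)

Section boundary_flux.
Context {R : realType}.
Notation mu := (@lebesgue_measure R).
Variables (Om : set (R * R)) (N : nat) (gam : 'I_N -> R -> R * R) (nu : R * R -> R * R).
Hypotheses (hOm : bounded_domain Om) (hgam : piecewise_C1_boundary gam Om).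
Hypothesis hnu : unit_outward_normal gam Om nu.
Implicit Types (f : R * R -> R).

Definition normal_comp (f0 f1 : R * R -> R) x : R :=
  f0 x * prj false (nu x) + f1 x * prj true (nu x).

Let arc_itv (A : set (R * R)) k :
  [set s : R | 0 < s < 1 /\ A (gam k s)] `<=` `]0, 1[.
Proof. by move=> s /= [s01 _]; rewrite in_itv. Qed.

Let integrable_normal (A : set (R * R)) k f0 f1 :
  measurable (A : set (measurableTypeR R * measurableTypeR R)) ->
  {within closure Om, continuous f0} -> {within closure Om, continuous f1} ->
  mu.-integrable [set s : R | 0 < s < 1 /\ A (gam k s)]
    (EFin \o (fun s => normal_comp f0 f1 (gam k s) * enorm (velocity gam k s))).
Proof.
move=> mA c0 c1.
have i : mu.-integrable `]0, 1[
    (EFin \o (fun s => normal_comp f0 f1 (gam k s) * enorm (velocity gam k s))).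
  have i0 := @integrable_arc R Om N gam nu hOm hgam hnu false k f0 c0.
  have i1 := @integrable_arc R Om N gam nu hOm hgam hnu true k f1 c1.
  have := integrableD _ i0 i1; move=> /(_ (measurable_itv _)).
  apply: eq_integrable; first exact: measurable_itv.
  by move=> s _; rewrite /= /normal_comp mulrDl EFinD.
apply: integrableS _ _ _ i; [exact: measurable_itv|exact: (measurable_arc k hgam mA)|exact: arc_itv].
Qed.

Lemma eq_line_integral A f f' : (forall k s, 0 < s < 1 -> A (gam k s) ->
  f (gam k s) = f' (gam k s)) -> line_integral gam A f = line_integral gam A f'.
Proof.
move=> ff; apply: eq_bigr => k _; apply: eq_Rintegral => s.
by rewrite inE => -[s01 As]; rewrite ff.
Qed.

Lemma line_integral_disjoint A f : A `&` boundary Om = set0 -> line_integral gam A f = 0.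
Proof.
move=> A0; apply: big1 => k _; apply: Rintegral_eq0 => s [s01 As].
suff : set0 (gam k s) by [].
rewrite -A0; split => //; rewrite (arc_cover hgam).
by exists k => //; exists s => //=; move/andP: s01 => [/ltW-> /ltW->].
Qed.

Lemma line_integralD A f0 f1 g0 g1 :
  measurable (A : set (measurableTypeR R * measurableTypeR R)) ->
  {within closure Om, continuous f0} -> {within closure Om, continuous f1} ->
  {within closure Om, continuous g0} -> {within closure Om, continuous g1} ->
  line_integral gam A (normal_comp (fun x => f0 x + g0 x) (fun x => f1 x + g1 x)) =
  line_integral gam A (normal_comp f0 f1) + line_integral gam A (normal_comp g0 g1).
Proof.
move=> mA cf0 cf1 cg0 cg1; rewrite -big_split/=; apply: eq_bigr => k _.
rewrite -RintegralD//; [|exact: (measurable_arc k hgam mA)|exact: integrable_normal|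
  exact: integrable_normal].
by apply: eq_Rintegral => s _; rewrite /normal_comp; ring.
Qed.

Lemma line_integralZ A c f0 f1 :
  measurable (A : set (measurableTypeR R * measurableTypeR R)) ->
  {within closure Om, continuous f0} -> {within closure Om, continuous f1} ->
  line_integral gam A (normal_comp (fun x => c * f0 x) (fun x => c * f1 x)) =
  c * line_integral gam A (normal_comp f0 f1).
Proof.
move=> mA cf0 cf1; rewrite /line_integral mulr_sumr; apply: eq_bigr => k _.
rewrite -RintegralZl//; [|exact: (measurable_arc k hgam mA)|exact: integrable_normal].
by apply: eq_Rintegral => s _; rewrite /normal_comp; ring.
Qed.

(** Nothing is known of the integrand on [Z], but [Z] has zero length; once it is removed, the
    integrand vanishes off [A]. *)
Lemma line_integral_null_part A Z f0 f1 :
  measurable (A : set (measurableTypeR R * measurableTypeR R)) ->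
  measurable (Z : set (measurableTypeR R * measurableTypeR R)) ->
  null_length gam Z -> A `&` Z = set0 ->
  {within closure Om, continuous f0} -> {within closure Om, continuous f1} ->
  (forall k s, 0 < s < 1 -> ~ A (gam k s) -> ~ Z (gam k s) ->
    normal_comp f0 f1 (gam k s) = 0) ->
  line_integral gam setT (normal_comp f0 f1) = line_integral gam A (normal_comp f0 f1).
Proof.
move=> mA mZ nZ AZ cf0 cf1 f00; apply: eq_bigr => k _.
set D := [set s : R | _ /\ setT _]; set S := [set s : R | _ /\ A _].
pose NZ := [set s : R | 0 < s < 1 /\ Z (gam k s)].
have mD : measurable D by exact: (measurable_arc k hgam measurableT).
have mN : measurable NZ by exact: (measurable_arc k hgam mZ).
set h := fun s => _.
have ih : mu.-integrable D (EFin \o h) by exact: integrable_normal.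
transitivity (\int[mu]_(s in D `\` NZ) h s).
  rewrite /Rintegral; congr fine.
  by apply: negligible_integral; [exact: mN|exact: mD|exact: ih|exact: nZ].
apply: Rintegral_support.
- move=> s [s01 As]; split => //; split; first by split.
  by move=> [_ Zs]; have : set0 (gam k s) by rewrite -AZ.
- move=> s [[s01 _] nN] nS; rewrite /h f00 ?mul0r//.
    by move=> As; apply: nS.
  by move=> Zs; apply: nN.
Qed.

Lemma line_integral_normal f0 f1 :
  {within closure Om, continuous f0} -> {within closure Om, continuous f1} ->
  line_integral gam setT (normal_comp f0 f1) =
  line_integral gam setT (fun x => f0 x * prj false (nu x)) +
  line_integral gam setT (fun x => f1 x * prj true (nu x)).
Proof.
move=> cf0 cf1; rewrite !line_integral_full -big_split/=; apply: eq_bigr => k _.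
have i0 := @integrable_arc R Om N gam nu hOm hgam hnu false k f0 cf0.
have i1 := @integrable_arc R Om N gam nu hOm hgam hnu true k f1 cf1.
rewrite -RintegralD//.
by apply: eq_Rintegral => s _; rewrite mulrDl.
Qed.

End boundary_flux.

(** * Pointwise algebra of the energy balance *)

Section energy_algebra.
Context {R : realType}.

Lemma sum2 (F : 'I_2 -> R) : \sum_(i < 2) F i = F 0 + F 1.
Proof. by rewrite big_ord_recl big_ord1; congr (_ + F _); apply/val_inj. Qed.

Lemma dot2 (a b : R * R) : dot a b = a.1 * b.1 + a.2 * b.2.
Proof. by rewrite /dot sum2. Qed.

(* [S nu . u = (S nu . nu)(u . nu) + (S nu x nu)(u x nu)] for a unit vector [nu]. *)
Lemma slip_no_work (w u n : R * R) : enorm n = 1 -> cross w n = 0 -> dot u n = 0 ->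
  dot w u = 0.
Proof.
rewrite /cross !dot2 => n1 wn un.
have n2 : n.1 * n.1 + n.2 * n.2 = 1.
  have := n1; rewrite /enorm dot2 => /(congr1 (fun x => x ^+ 2)).
  by rewrite expr1n sqr_sqrtr// -!expr2 addr_ge0// sqr_ge0.
transitivity ((w.1 * u.1 + w.2 * u.2) * (n.1 * n.1 + n.2 * n.2)).
  by rewrite n2 mulr1.
transitivity ((w.1 * n.1 + w.2 * n.2) * (u.1 * n.1 + u.2 * n.2) +
   (w.1 * n.2 - w.2 * n.1) * (u.1 * n.2 - u.2 * n.1)); first by ring.
by rewrite un wn mul0r mulr0 addr0.
Qed.

(** Suffixes [t], [0], [1] mark derivatives in time and space, and [dij] is the derivative of [sij]
    in direction [j]. The dissipation appears because the strain is the symmetric part of the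
    velocity gradient, so that their contraction is [|D(u)|^2]. *)
Lemma energy_balance (rho mu g p pt p0 p1 a at_ a0 a1 b bt b0 b1 e e0 e1
    s00 s01 s10 s11 d00 d01 d10 d11 : R) :
  s00 = 2^-1 * (a0 + a0) -> s01 = 2^-1 * (a1 + b0) ->
  s10 = 2^-1 * (b0 + a1) -> s11 = 2^-1 * (b1 + b1) ->
  pt + ((p0 * a + p * a0) + (p1 * b + p * b1)) = 0 ->
  rho * p * (at_ + (a * a0 + b * a1))
  - 2 * mu * ((p0 * s00 + p * d00) + (p1 * s01 + p * d01)) + rho * g * p * e0 = 0 ->
  rho * p * (bt + (a * b0 + b * b1))
  - 2 * mu * ((p0 * s10 + p * d10) + (p1 * s11 + p * d11)) + rho * g * p * e1 = 0 ->
  rho / 2 * (pt * (a * a + b * b) + p * (2 * a * at_ + 2 * b * bt))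
    + rho * g * (e * pt) =
  (- (rho / 2) * ((p0 * (a * a + b * b) + p * (2 * a * a0 + 2 * b * b0)) * a
        + p * (a * a + b * b) * a0)
     - rho * g * ((p0 * e + p * e0) * a + p * e * a0)
     + 2 * mu * (p0 * (s00 * a + s10 * b) +
         p * (d00 * a + s00 * a0 + d10 * b + s10 * b0)))
  + (- (rho / 2) * ((p1 * (a * a + b * b) + p * (2 * a * a1 + 2 * b * b1)) * b
        + p * (a * a + b * b) * b1)
     - rho * g * ((p1 * e + p * e1) * b + p * e * b1)
     + 2 * mu * (p1 * (s01 * a + s11 * b) +
         p * (d01 * a + s01 * a1 + d11 * b + s11 * b1)))
  + - (2 * mu) * (p * ((s00 ^+ 2 + s01 ^+ 2) + (s10 ^+ 2 + s11 ^+ 2))).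
Proof.
move=> -> -> -> -> h h0 h1; apply/eqP; rewrite -subr_eq0; apply/eqP.
set s00' := 2^-1 * (a0 + a0) in h0 *; set s01' := 2^-1 * (a1 + b0) in h0 *.
set s10' := 2^-1 * (b0 + a1) in h1 *; set s11' := 2^-1 * (b1 + b1) in h1 *.
(* The mass balance is tested with [rho / 2 |u|^2 + rho g eta] and the momentum
   balance with [u]. *)
transitivity ((rho / 2 * (a * a + b * b) + rho * g * e) *
   (pt + ((p0 * a + p * a0) + (p1 * b + p * b1))) +
  a * (rho * p * (at_ + (a * a0 + b * a1))
  - 2 * mu * ((p0 * s00' + p * d00) + (p1 * s01' + p * d01)) + rho * g * p * e0) +
  b * (rho * p * (bt + (a * b0 + b * b1))
  - 2 * mu * ((p0 * s10' + p * d10) + (p1 * s11' + p * d11)) + rho * g * p * e1)).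
  by rewrite /s00' /s01' /s10' /s11'; field.
by rewrite h h0 h1 !mulr0 !addr0.
Qed.

End energy_algebra.

(** * The energy balance *)

Section balance_law.
Context {R : realType}.
Variables (Om : set (R * R)) (N : nat) (gam : 'I_N -> R -> R * R) (nu : R * R -> R * R).
Variable T : R.
Hypotheses (hOm : bounded_domain Om) (hgam : piecewise_C1_boundary gam Om).
Hypotheses (hnu : unit_outward_normal gam Om nu) (T0 : 0 < T).
Implicit Types F : (R * R) * R -> R.
Notation cyl := (cylinder Om T).

Lemma area_integralD f g :
  {within closure Om, continuous f} -> {within closure Om, continuous g} ->
  area_integral Om (fun x => f x + g x) = area_integral Om f + area_integral Om g.
Proof.
move=> cf cg; rewrite /area_integral RintegralD//.
- by apply: open2_measurable; case: hOm.
- exact: integrable_domain.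
- exact: integrable_domain.
Qed.

(** The pointwise balance passes from the open cylinder to its closure by continuity, which reaches
    the two end times. Each flux component comes with both partial derivatives because the shear
    behind Gauss-Green mixes them. *)
Lemma balance_law (K Kt X X0 X1 Y Y0 Y1 Z : (R * R) * R -> R) :
  C1on cyl dirt K Kt ->
  C1on cyl (dirx 0) X X0 -> C1on cyl (dirx 1) X X1 ->
  C1on cyl (dirx 0) Y Y0 -> C1on cyl (dirx 1) Y Y1 ->
  {within closure cyl, continuous Z} ->
  (forall z, cyl z -> Kt z = X0 z + Y1 z + Z z) ->
  forall t, 0 <= t <= T ->
  deriv_within [set s | 0 <= s <= T] (fun s => area_integral Om (fun x => K (x, s))) t
    (line_integral gam setT (normal_comp nu (fun x => X (x, t)) (fun x => Y (x, t)))
     + area_integral Om (fun x => Z (x, t))).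
Proof.
move=> CK CX0 CX1 CY0 CY1 cZ balance t tT.
have [cX cX0 _] := CX0; have [cY cY1 _] := CY1; have [_ cKt _] := CK.
have slice F := @time_slice_continuous R Om T T0 F t tT.
rewrite (line_integral_normal hOm hgam hnu (slice _ cX) (slice _ cY)).
rewrite -(@Green_time R Om N gam nu T hOm hgam hnu T0 false X X0 X1 t tT CX0 CX1).
rewrite -(@Green_time R Om N gam nu T hOm hgam hnu T0 true Y Y0 Y1 t tT CY0 CY1) /=.
have cXY : {within closure cyl, continuous (fun z => X0 z + Y1 z)}.
  by move=> z; exact: (continuousD (cX0 z) (cY1 z)).
have cXYZ : {within closure cyl, continuous (fun z => X0 z + Y1 z + Z z)}.
  by move=> z; exact: (continuousD (cXY z) (cZ z)).
rewrite -area_integralD; [|exact: slice|exact: slice].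
rewrite -area_integralD; [|exact: (slice _ cXY)|exact: slice].
have := deriv_within_area_integral hOm T0 CK tT.
congr (deriv_within _ _ _ _); apply: eq_Rintegral => x; rewrite inE => Ox.
apply: (closure_eq cKt cXYZ balance); apply: closure_slab => //.
exact: subset_closure.
Qed.

End balance_law.





(** * The energy identity *)

Section energy.
Context {R : realType}.
Variables (Om : set (R * R)) (N : nat) (gam : 'I_N -> R -> R * R) (nu : R * R -> R * R).
Variables (GD GS GT : set (R * R)) (T rho mu g : R) (zeta : R * R -> R).
Variables (phi eta : (R * R) * R -> R) (u : (R * R) * R -> R * R).
Hypotheses (hOm : bounded_domain Om) (hgam : piecewise_C1_boundary gam Om).
Hypotheses (hnu : unit_outward_normal gam Om nu) (hG : boundary_parts gam Om GD GS GT).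
Hypothesis (T0 : 0 < T).
Hypotheses (hzeta : Ck_closure 1 Om zeta) (hphi : smooth_closure (cylinder Om T) phi).
Hypothesis hu : forall i, smooth_closure (cylinder Om T) (ucomp u i).
Hypothesis heta : {within closure (cylinder Om T), continuous eta}.
Hypothesis hmass : forall z, cylinder Om T z -> continuity_eq phi u z.
Hypothesis hmom : forall z, cylinder Om T z -> momentum_eq Om T rho mu g phi eta u z.
Hypothesis hheight : forall z, cylinder Om T z -> phi z = eta z + zeta z.1.
Notation cyl := (cylinder Om T).
Notation str i j := (fun z => strain Om T u z i j).

Lemma derive_C1on (V : normedModType R) (D : set V) v (f h : V -> R) :
  C1on D v f h -> forall z, D z -> 'D_v f z = h z.
Proof. by move=> [_ _ d] z Dz; have dz := d z Dz; rewrite derive_val. Qed.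

Section within_continuous_algebra.
Variables (S : topologicalType) (A : set S).
Implicit Types f h : S -> R.

Lemma within_continuous_cst (c : R) : {within A, continuous (fun=> c)}.
Proof. exact/continuous_subspaceT/cst_continuous. Qed.

Lemma within_continuousD f h : {within A, continuous f} -> {within A, continuous h} ->
  {within A, continuous (fun x => f x + h x)}.
Proof. by move=> cf ch z; apply: continuousD; [exact: cf|exact: ch]. Qed.

Lemma within_continuousM f h : {within A, continuous f} -> {within A, continuous h} ->
  {within A, continuous (fun x => f x * h x)}.
Proof. by move=> cf ch z; apply: continuousM; [exact: cf|exact: ch]. Qed.

End within_continuous_algebra.

Lemma eq_deriv_within (A : set R) (f f' : R -> R) t l : A t ->
  (forall s, A s -> f s = f' s) -> deriv_within A f t l -> deriv_within A f' t l.
Proof.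
move=> At ff; apply: cvg_trans; apply: near_eq_cvg; rewrite near_withinE.
by near=> s => As; rewrite !ff.
Unshelve. all: by end_near. Qed.

Lemma open_cyl : open cyl.
Proof. by apply: cylinder_open; case: hOm. Qed.

(** [eta] is only assumed continuous; its space derivatives come from [phi - zeta], which equals
    [eta] in the cylinder and, by continuity, on the closure. *)
Lemma C1on_eta v (v' : R * R) p : v = (v', 0) -> C1on cyl v phi p ->
  exists e', C1on cyl v eta e'.
Proof.
move=> -> Cp; have [z' Cz _] := Ck_closure_C1on v' hzeta.
exists (fun z => p z - z' z.1).
have := C1onB Cp (C1on_lift T Cz).
apply: eq_C1on => //; first exact: open_cyl.
apply: closure_eq => //.
- by have [] := C1onB Cp (C1on_lift T Cz).
- by move=> z cz; rewrite hheight// addrK.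
Qed.

(** [zeta] does not depend on time, so the mass equation also governs the potential energy. *)
Lemma C1on_eta_time p : C1on cyl dirt phi p -> C1on cyl dirt eta p.
Proof.
move=> Cp; have cz : {within closure Om, continuous zeta} by case: hzeta.
have := C1onB Cp (C1on_lift_time T cz).
apply: eq_C1on => //; first exact: open_cyl.
- apply: closure_eq => //.
  + by have [] := C1onB Cp (C1on_lift_time T cz).
  + by move=> z cyz; rewrite hheight// addrK.
- by move=> z _; rewrite subr0.
Qed.

Lemma strain_C1on i j aij aji : C1on cyl (dirx j) (ucomp u i) aij ->
  C1on cyl (dirx i) (ucomp u j) aji ->
  forall z, closure cyl z -> strain Om T u z i j = 2^-1 * (aij z + aji z).
Proof.
by move=> C1 C2 z cz; rewrite mxE (dbar_C1on C1)// (dbar_C1on C2).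
Qed.

(** On the closure [strain] agrees with the extended first derivatives of [u], which second-order
    smoothness allows to differentiate once more. *)
Lemma strain_C1 i j v : exists P', C1on cyl v (str i j) P'.
Proof.
have [a Ca sa] := Ck_closure_C1on (dirx j) (hu i 2).
have [b Cb sb] := Ck_closure_C1on (dirx i) (hu j 2).
have [a' Ca' _] := Ck_closure_C1on v sa.
have [b' Cb' _] := Ck_closure_C1on v sb.
exists (fun z => 2^-1 * (a' z + b' z)).
have := C1on_scale 2^-1 (C1onD Ca' Cb').
apply: eq_C1on => //; first exact: open_cyl.
by move=> z cz; rewrite (strain_C1on Ca Cb).
Qed.


Notation ux := (ucomp u 0).
Notation uy := (ucomp u 1).

Definition energy_flux w P Q z :=
  - (rho / 2) * (phi z * (ux z * ux z + uy z * uy z) * w z)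
  - rho * g * (phi z * eta z * w z) + 2 * mu * (phi z * (P z * ux z + Q z * uy z)).

Definition dissipation z := phi z * frob2 (strain Om T u z).

Lemma frob2E z : frob2 (strain Om T u z) =
  (str 0 0 z ^+ 2 + str 0 1 z ^+ 2) + (str 1 0 z ^+ 2 + str 1 1 z ^+ 2).
Proof. by rewrite /frob2 !sum2. Qed.

Lemma dissipation_C1 : exists d, C1on cyl dirt dissipation d.
Proof.
have [p Cp _] := Ck_closure_C1on dirt (hphi 1).
have [s00 C00] := strain_C1 0 0 dirt; have [s01 C01] := strain_C1 0 1 dirt.
have [s10 C10] := strain_C1 1 0 dirt; have [s11 C11] := strain_C1 1 1 dirt.
have CE := C1onM Cp (C1onD (C1onD (C1onM C00 C00) (C1onM C01 C01))
   (C1onD (C1onM C10 C10) (C1onM C11 C11))).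
have E z : closure cyl z -> phi z *
    ((str 0 0 z * str 0 0 z + str 0 1 z * str 0 1 z) +
     (str 1 0 z * str 1 0 z + str 1 1 z * str 1 1 z)) = dissipation z.
  by move=> _; rewrite /dissipation frob2E !expr2.
by eexists; exact: (eq_C1on open_cyl E (fun _ _ => erefl) CE).
Qed.

Lemma energy_rate t : 0 <= t <= T ->
  deriv_within [set s | 0 <= s <= T] (energy Om rho g phi eta u) t
    (line_integral gam setT (normal_comp nu
       (fun x => energy_flux ux (str 0 0) (str 1 0) (x, t))
       (fun x => energy_flux uy (str 0 1) (str 1 1) (x, t)))
     + I4 Om T mu phi u t).
Proof.
move=> tT.
have [pt Cpt _] := Ck_closure_C1on dirt (hphi 1).
have [p0 Cp0 _] := Ck_closure_C1on (dirx 0) (hphi 1).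
have [p1 Cp1 _] := Ck_closure_C1on (dirx 1) (hphi 1).
have [at_ Cat _] := Ck_closure_C1on dirt (hu 0 1).
have [a0 Ca0 _] := Ck_closure_C1on (dirx 0) (hu 0 1).
have [a1 Ca1 _] := Ck_closure_C1on (dirx 1) (hu 0 1).
have [bt Cbt _] := Ck_closure_C1on dirt (hu 1 1).
have [b0 Cb0 _] := Ck_closure_C1on (dirx 0) (hu 1 1).
have [b1 Cb1 _] := Ck_closure_C1on (dirx 1) (hu 1 1).
have [e0 Ce0] := C1on_eta (erefl : dirx 0 = (bas 0, 0)) Cp0.
have [e1 Ce1] := C1on_eta (erefl : dirx 1 = (bas 1, 0)) Cp1.
have Cet := C1on_eta_time Cpt.
have [d00 C00] := strain_C1 0 0 (dirx 0); have [d10 C10] := strain_C1 1 0 (dirx 0).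
have [d01 C01] := strain_C1 0 1 (dirx 1); have [d11 C11] := strain_C1 1 1 (dirx 1).
(* The transverse derivatives: they stay out of the divergence but make each flux component C^1 in
   both directions. *)
have [c00 B00] := strain_C1 0 0 (dirx 1); have [c10 B10] := strain_C1 1 0 (dirx 1).
have [c01 B01] := strain_C1 0 1 (dirx 0); have [c11 B11] := strain_C1 1 1 (dirx 0).
have FX0 := C1on_flux rho mu g Cp0 Ca0 Ca0 Cb0 Ce0 C00 C10.
have FX1 := C1on_flux rho mu g Cp1 Ca1 Ca1 Cb1 Ce1 B00 B10.
have FY0 := C1on_flux rho mu g Cp0 Cb0 Ca0 Cb0 Ce0 B01 B11.
have FY1 := C1on_flux rho mu g Cp1 Cb1 Ca1 Cb1 Ce1 C01 C11.
have Kk := C1on_scale (rho / 2) (C1onM Cpt (C1onD (C1onM Cat Cat) (C1onM Cbt Cbt))).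
have Kp := C1on_scale (rho * g / 2) (C1onM Cet Cet).
have CK := C1onD Kk Kp.
have [d Cd] := dissipation_C1.
have [cZ _ _] := C1on_scale (- (2 * mu)) Cd.
lapply (balance_law hOm hgam hnu T0 CK FX0 FX1 FY0 FY1 cZ); last first.
  move=> z cz; have zc := subset_closure cz.
  have := hmass cz; have := hmom cz 0; have := hmom cz 1.
  rewrite /continuity_eq !sum2 !(derive_C1on Cpt cz) !(derive_C1on Cat cz)
   !(derive_C1on Cbt cz) !(derive_C1on Ca0 cz) !(derive_C1on Ca1 cz)
   !(derive_C1on Cb0 cz) !(derive_C1on Cb1 cz) !(derive_C1on Ce0 cz)
   !(derive_C1on Ce1 cz) !(derive_C1on (C1onM Cp0 Ca0) cz)
   !(derive_C1on (C1onM Cp1 Cb1) cz) !(derive_C1on (C1onM Cp0 C00) cz)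
   !(derive_C1on (C1onM Cp1 C01) cz) !(derive_C1on (C1onM Cp0 C10) cz)
   !(derive_C1on (C1onM Cp1 C11) cz).
  move=> m1 m0 m.
  have := energy_balance (eta z) (strain_C1on Ca0 Ca0 zc) (strain_C1on Ca1 Cb0 zc)
    (strain_C1on Cb0 Ca1 zc) (strain_C1on Cb1 Cb1 zc) m m0 m1.
  rewrite -frob2E => E; transitivity (rho / 2 * (pt z * (ux z * ux z + uy z * uy z) +
     phi z * (2 * ux z * at_ z + 2 * uy z * bt z)) + rho * g * (eta z * pt z)).
    by field.
  exact: E.
move=> /(_ t tT).
have -> : area_integral Om (fun x => - (2 * mu) * dissipation (x, t)) = I4 Om T mu phi u t.
  rewrite /I4 /area_integral RintegralZl//; first by apply: open2_measurable; case: hOm.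
  by case: Cd => cd _ _; exact: (integrable_domain hOm (time_slice_continuous T0 tT cd)).
apply: eq_deriv_within => // s sT.
have slice F := @time_slice_continuous R Om T T0 F s sT.
have [[ck _ _] [cp _ _]] := (Kk, Kp).
rewrite (area_integralD hOm (slice _ ck) (slice _ cp)); congr (_ + _); apply: eq_Rintegral => x _; first by rewrite dot2 mulrA.
by rewrite real_normK ?num_real// expr2; field.
Qed.

Lemma strain_continuous i j : {within closure cyl, continuous (str i j)}.
Proof. by have [s []] := strain_C1 i j dirt. Qed.

Lemma ucomp_continuous i : {within closure cyl, continuous (ucomp u i)}.
Proof. by case: (hu i 0). Qed.

Lemma phi_continuous : {within closure cyl, continuous phi}.
Proof. by case: (hphi 0). Qed.

Lemma dirichlet_flux x t : dirichlet_bc T u GD -> GD x -> closure Om x -> 0 <= t <= T ->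
  normal_comp nu (fun x => energy_flux ux (str 0 0) (str 1 0) (x, t))
    (fun x => energy_flux uy (str 0 1) (str 1 1) (x, t)) x = 0.
Proof.
move=> hD Dx cx tT.
have u0 i : ucomp u i (x, t) = 0.
  apply: (time_extend T0 (@ucomp_continuous i) cx _ tT) => s sT.
  by rewrite /ucomp hD// /co; case: ifP.
by rewrite /normal_comp /energy_flux !u0; ring.
Qed.

(** The convective and gravity terms carry the factor [u . n]; what remains is the work of [D(u) n]
    on [u], zero by [slip_no_work]. As [x] is fixed, [n] is constant in time and both slip
    conditions extend to the end times. *)
Lemma slip_flux x t : slip_bc Om T u gam nu GS -> GS x -> regular_pt gam x ->
  closure Om x -> enorm (nu x) = 1 -> 0 <= t <= T ->
  normal_comp nu (fun x => energy_flux ux (str 0 0) (str 1 0) (x, t))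
    (fun x => energy_flux uy (str 0 1) (str 1 1) (x, t)) x = 0.
Proof.
move=> hS Sx rx cx n1 tT; set n := nu x.
have cM c (F : (R * R) * R -> R) : {within closure cyl, continuous F} ->
    {within closure cyl, continuous (fun z => F z * c)}.
  by move=> cF; exact: (within_continuousM cF (@within_continuous_cst _ _ c)).
have un : dot (u (x, t)) n = 0.
  pose F z := ux z * n.1 + uy z * n.2.
  have cF : {within closure cyl, continuous F}.
    exact: within_continuousD (cM _ _ (@ucomp_continuous 0)) (cM _ _ (@ucomp_continuous 1)).
  rewrite dot2; apply: (time_extend T0 cF cx _ tT) => s sT.
  by have [_] := hS x s Sx rx sT; rewrite dot2.
have cr : cross (mxact (strain Om T u (x, t)) n) n = 0.
  pose F z := (str 0 0 z * n.1 + str 0 1 z * n.2) * n.2 +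
    (str 1 0 z * n.1 + str 1 1 z * n.2) * - n.1.
  have cS i : {within closure cyl, continuous (fun z => str i 0 z * n.1 + str i 1 z * n.2)}.
    exact: within_continuousD (cM _ _ (@strain_continuous i 0))
      (cM _ _ (@strain_continuous i 1)).
  have cF : {within closure cyl, continuous F}.
    exact: within_continuousD (cM _ _ (cS 0)) (cM _ _ (cS 1)).
  rewrite /cross /mxact !sum2 -mulrN; apply: (time_extend T0 cF cx _ tT) => s sT.
  by have [+ _] := hS x s Sx rx sT; rewrite /cross /mxact !sum2 -mulrN.
have := slip_no_work n1 cr un; move: un; rewrite !dot2 /mxact !sum2 /= => un w0.
rewrite /normal_comp /energy_flux -/n.
transitivity ((- (rho / 2) * (phi (x, t) * (ux (x, t) * ux (x, t) + uy (x, t) * uy (x, t)))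
    - rho * g * (phi (x, t) * eta (x, t))) * ((u (x, t)).1 * n.1 + (u (x, t)).2 * n.2)
  + 2 * mu * phi (x, t) *
     ((str 0 0 (x, t) * n.1 + str 0 1 (x, t) * n.2) * (u (x, t)).1 +
      (str 1 0 (x, t) * n.1 + str 1 1 (x, t) * n.2) * (u (x, t)).2)).
  by rewrite /ucomp /co /prj /=; ring.
by rewrite un w0 !mulr0 addr0.
Qed.

(** The flux vanishes on [GD] and [GS], and the residual part of the boundary has zero length, so
    only [GT] is left; there the flux is split by linearity. *)
Lemma boundary_flux t : dirichlet_bc T u GD -> slip_bc Om T u gam nu GS -> 0 <= t <= T ->
  line_integral gam setT (normal_comp nu
       (fun x => energy_flux ux (str 0 0) (str 1 0) (x, t))
       (fun x => energy_flux uy (str 0 1) (str 1 1) (x, t))) =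
  I1 rho phi u gam nu GT t + I2 rho g phi eta u gam nu GT t + I3 Om T mu phi u gam nu GT t.
Proof.
move=> hD hS tT.
have slice F := @time_slice_continuous R Om T T0 F t tT.
have cp := slice _ phi_continuous; have ce := slice _ heta.
have cu i := slice _ (@ucomp_continuous i); have cs i j := slice _ (@strain_continuous i j).
(* Coordinates of the three vector fields whose normal components are the integrands of [I1], [I2]
   and [I3]. *)
pose c1 i x := phi (x, t) * (ux (x, t) * ux (x, t) + uy (x, t) * uy (x, t)) *
  ucomp u i (x, t).
pose c2 i x := phi (x, t) * eta (x, t) * ucomp u i (x, t).
pose c3 i x := phi (x, t) * (str 0 i (x, t) * ux (x, t) + str 1 i (x, t) * uy (x, t)).
have M := @within_continuousM _ (closure Om); have D := @within_continuousD _ (closure Om).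
have C (c : R) := @within_continuous_cst _ (closure Om) c.
have k1 i : {within closure Om, continuous (c1 i)}.
  exact: M (M _ _ cp (D _ _ (M _ _ (cu 0) (cu 0)) (M _ _ (cu 1) (cu 1)))) (cu i).
have k2 i : {within closure Om, continuous (c2 i)} by exact: M (M _ _ cp ce) (cu i).
have k3 i : {within closure Om, continuous (c3 i)}.
  exact: M cp (D _ _ (M _ _ (cs 0 i) (cu 0)) (M _ _ (cs 1 i) (cu 1))).
have k12 i : {within closure Om, continuous (fun x => - (rho / 2) * c1 i x + - (rho * g) * c2 i x)}.
  exact: D (M _ _ (C _) (k1 i)) (M _ _ (C _) (k2 i)).
have k33 i : {within closure Om, continuous (fun x => 2 * mu * c3 i x)}.
  exact: M (C _) (k3 i).
have kE i : {within closure Om, continuous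
    (fun x => (- (rho / 2) * c1 i x + - (rho * g) * c2 i x) + 2 * mu * c3 i x)}.
  exact: D (k12 i) (k33 i).
have fluxE i : (fun x => energy_flux (ucomp u i) (str 0 i) (str 1 i) (x, t)) =
    (fun x => (- (rho / 2) * c1 i x + - (rho * g) * c2 i x) + 2 * mu * c3 i x).
  by apply/funext => x; rewrite /energy_flux /c1 /c2 /c3; ring.
have mpart G := parts_measurable (G := G) hG.
have mGT := mpart _ (Or33 _ _ (erefl GT)).
pose Z := boundary Om `\` (GD `|` GS `|` GT).
have mZ : measurable (Z : set (measurableTypeR R * measurableTypeR R)).
  apply: measurableD; last first.
    by apply: measurableU => //; apply: measurableU; apply: mpart; [exact: Or31|exact: Or32].
  apply: measurableD; last by apply: open2_measurable; exact: open_interior.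
  by apply: closed2_measurable; exact: closed_closure.
have GTZ : GT `&` Z = set0.
  by apply/seteqP; split => // x [Gx [_ nx]]; apply: nx; right.
have vanish k s : 0 < s < 1 -> ~ GT (gam k s) -> ~ Z (gam k s) ->
    normal_comp nu (fun x => energy_flux ux (str 0 0) (str 1 0) (x, t))
      (fun x => energy_flux uy (str 0 1) (str 1 1) (x, t)) (gam k s) = 0.
  move=> s01 nT nZ.
  have bx : boundary Om (gam k s).
    by rewrite (arc_cover hgam); exists k => //; exists s => //=; move/andP: s01 => [/ltW-> /ltW->].
  have [cx _] := bx.
  have [Dx|nD] := pselect (GD (gam k s)); first exact: dirichlet_flux.
  have [Sx|nS] := pselect (GS (gam k s)); last by case: nZ; split => // -[[]|].
  have [n1 _ _] := hnu k s01.
  by apply: slip_flux => //; exists k, s.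
rewrite (fluxE 0) (fluxE 1) in vanish *.
rewrite (line_integral_null_part hOm hgam hnu mGT mZ (parts_residual hG) GTZ (kE 0) (kE 1) vanish).
rewrite (line_integralD hOm hgam hnu mGT (k12 0) (k12 1) (k33 0) (k33 1)).
rewrite (line_integralD hOm hgam hnu mGT (M _ _ (C _) (k1 0)) (M _ _ (C _) (k1 1))
  (M _ _ (C _) (k2 0)) (M _ _ (C _) (k2 1))).
rewrite (line_integralZ hOm hgam hnu _ mGT (k1 0) (k1 1))
  (line_integralZ hOm hgam hnu _ mGT (k2 0) (k2 1))
  (line_integralZ hOm hgam hnu _ mGT (k3 0) (k3 1)).
rewrite /I1 /I2 /I3; congr (_ * _ + _ * _ + _ * _); apply: eq_line_integral => k s _ _;
  rewrite /normal_comp /c1 /c2 /c3 ?dot2 /mxact ?sum2 /ucomp /co /prj /=; ring.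
Qed.

End energy.

Theorem corollary3p3 (R : realType)
  (Om : set (R * R)) (N : nat) (gam : 'I_N -> R -> R * R) (nu : R * R -> R * R)
  (GD GS GT : set (R * R))
  (T rho mu g c0 : R) (zeta : R * R -> R)
  (phi eta : (R * R) * R -> R) (u : (R * R) * R -> R * R)
  (hOm : bounded_domain Om)
  (hgam : piecewise_C1_boundary gam Om)
  (hnu : unit_outward_normal gam Om nu)
  (hG : boundary_parts gam Om GD GS GT)
  (hT : 0 < T) (hrho : 0 < rho) (hmu : 0 < mu) (hg : 0 < g) (hc0 : 0 < c0)
  (hzeta : Ck_closure 1 Om zeta)
  (hzeta0 : forall x, closure Om x -> 0 < zeta x)
  (hphi : smooth_closure (cylinder Om T) phi)
  (hu : forall i, smooth_closure (cylinder Om T) (ucomp u i))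
  (heta : {within closure (cylinder Om T), continuous eta})
  (hmass : forall z, cylinder Om T z -> continuity_eq phi u z)
  (hmom : forall z, cylinder Om T z -> momentum_eq Om T rho mu g phi eta u z)
  (hheight : forall z, cylinder Om T z -> phi z = eta z + zeta z.1)
  (hD : dirichlet_bc T u GD)
  (hS : slip_bc Om T u gam nu GS)
  (hTr : transmission_bc T g c0 zeta phi eta u gam nu GT) :
  (forall t, 0 <= t <= T ->
     deriv_within [set s | 0 <= s <= T] (energy Om rho g phi eta u) t
       (I1 rho phi u gam nu GT t + I2 rho g phi eta u gam nu GT t
        + I3 Om T mu phi u gam nu GT t + I4 Om T mu phi u t))
  /\
  (boundary Om = GD `|` GS ->
   (forall z, closure Om z.1 -> 0 <= z.2 <= T -> 0 < phi z) ->
   forall t, 0 <= t <= T ->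
     deriv_within [set s | 0 <= s <= T] (energy Om rho g phi eta u) t
       (I4 Om T mu phi u t)
     /\ I4 Om T mu phi u t <= 0).
Proof.
have rate t (tT : 0 <= t <= T) := energy_rate hOm hgam hnu hT hzeta hphi hu heta hmass hmom hheight tT.
have flux t (tT : 0 <= t <= T) := boundary_flux rho mu g hOm hgam hnu hG hT hphi hu heta hD hS tT.
split=> [t tT|GDS phi0 t tT]; first by rewrite -flux//; exact: rate.
(* [line_integral] sees [GT] only through points of the arcs, so it is enough that [GT] misses the
   boundary. *)
have GT0 : GT `&` boundary Om = set0.
  apply/seteqP; split => // x [Tx]; rewrite GDS => -[Dx|Sx].
    by rewrite -(parts_TD hG).
  by rewrite -(parts_ST hG).
split.
  have := rate t tT.
  by rewrite flux// /I1 /I2 /I3 !(line_integral_disjoint hgam)// !mulr0 !add0r.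
rewrite /I4 mulNr oppr_le0; apply: mulr_ge0; first lra.
apply: Rintegral_ge0 => x Ox; apply: mulr_ge0.
  by apply/ltW/phi0; [exact: subset_closure|].
by rewrite /frob2; apply: sumr_ge0 => i _; apply: sumr_ge0 => j _; exact: sqr_ge0.
Qed.
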